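(* Let $K$ be a field of positive characteristic $p$ and $G$ a group such that the group algebra $KG$ is Lie nilpotent. Then $t_L(KG)=|G'|-p+2$ if and only if one of the following conditions holds: (i) $p=2$, $cl(G)=2$ and $\gamma_2(G)$ is noncyclic of order $4$; (ii) $p=2$, $cl(G)=4$, $\gamma_2(G)\cong C_4\times C_2$ and $\gamma_3(G)\cong C_2\times C_2$; (iii) $p=2$, $cl(G)=4$ and $\gamma_2(G)$ is elementary abelian of order $8$; (iv) $p=3$, $cl(G)=3$ and $\gamma_2(G)$ is elementary abelian of order $9$.
   Context: For an associative algebra $R$ with identity, $[x,y]=xy-yx$ and $[x_1,\ldots,x_n]=[[x_1,\ldots,x_{n-1}],x_n]$. The $n$-th lower Lie power $R^{[n]}$ is the associative ideal generated by all $[x_1,\ldots,x_n]$ with $x_i\in R$ ($R^{[1]}=R$). $R$ is Lie nilpotent if $R^{[m]}=0$ for some $m$, and the lower Lie nilpotency index $t_L(R)$ is the minimal such $m$. $G'=\gamma_2(G)$ is the commutator subgroup, $\gamma_i(G)$ the terms of the lower central series of $G$, $cl(G)$ the nilpotency class of $G$, and $C_n$ the cyclic group of order $n$. (It is known that for Lie nilpotent $KG$, $G'$ is a finite $p$-group and $t_L(KG)\le |G'|+1$.) *)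

(* Defs.v *)
From HB Require Import structures.
From mathcomp Require Import all_boot all_order all_algebra.
From mathcomp Require Import monoid.
Set Implicit Arguments. Unset Strict Implicit. Unset Printing Implicit Defensive.
Import GRing.Theory.

Section GroupDefs.
Variable G : groupType.
Local Open Scope group_scope.

Definition is_subgroup (H : G -> Prop) : Prop :=
  H 1 /\ (forall x y, H x -> H y -> H (x * y^-1)).

Definition gen_subgroup (S : G -> Prop) : G -> Prop :=
  fun x => forall H, is_subgroup H -> (forall y, S y -> H y) -> H x.

Definition comm_subgroup (A B : G -> Prop) : G -> Prop :=
  gen_subgroup (fun z => exists a b, A a /\ B b /\ z = [~ a, b]).

(* lower central series, shifted: lcs n = gamma_{n+1}(G); lcs 0 = G *)
Fixpoint lcs (n : nat) : G -> Prop :=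
  match n with
  | 0 => fun _ => True
  | n'.+1 => comm_subgroup (lcs n') (fun _ => True)
  end.

(* gamma_i(G), for i >= 1 (gamma_1 = G) *)
Definition gamma (i : nat) : G -> Prop := lcs i.-1.

Definition trivial_sub (A : G -> Prop) : Prop := forall x, A x -> x = 1.

Definition nil_class (c : nat) : Prop :=
  trivial_sub (gamma c.+1) /\ forall k, k < c -> ~ trivial_sub (gamma k.+1).

Definition has_order (A : G -> Prop) (n : nat) : Prop :=
  exists s : seq G, [/\ uniq s, size s = n & forall x, A x <-> x \in s].

Definition cyclic_sub (A : G -> Prop) : Prop :=
  exists g, A g /\ forall x, A x -> exists k : nat, x = g ^+ k \/ x = (g ^+ k)^-1.

Definition abelian_sub (A : G -> Prop) : Prop :=
  forall x y, A x -> A y -> x * y = y * x.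

Definition elem_abelian (A : G -> Prop) : Prop :=
  abelian_sub A /\ exists q, prime q /\ forall x, A x -> x ^+ q = 1.

(* A is isomorphic to C_a x C_b: there is a surjective homomorphism
   f : N x N -> A (componentwise addition) whose fibres are exactly the
   classes modulo (a, b), i.e. A ~ (Z x Z)/(aZ x bZ). *)
Definition iso_Ca_x_Cb (A : G -> Prop) (a b : nat) : Prop :=
  exists f : nat -> nat -> G,
    [/\ forall i j i' j', f i j * f i' j' = f (i + i') (j + j'),
        forall i j i' j', f i j = f i' j' <-> (i = i' %[mod a] /\ j = j' %[mod b])
      & forall x, A x <-> exists i j, f i j = x].
End GroupDefs.
Arguments lcs G n : clear implicits.
Arguments gamma G i : clear implicits.
Arguments nil_class G c : clear implicits.

Section RingDefs.
Local Open Scope ring_scope.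
Variables (K : fieldType) (R : algType K).

Fixpoint lcomm (x : nat -> R) (n : nat) : R :=
  match n with
  | 0 => x 0%N
  | n'.+1 => lcomm x n' * x n - x n * lcomm x n'
  end.

Definition is_ideal (I : R -> Prop) : Prop :=
  [/\ I 0, (forall a b, I a -> I b -> I (a - b)),
      (forall r a, I a -> I (r * a)) & (forall r a, I a -> I (a * r))].

Definition ideal_gen (S : R -> Prop) : R -> Prop :=
  fun z => forall I, is_ideal I -> (forall y, S y -> I y) -> I z.

(* n-th lower Lie power R^[n] (n >= 1): ideal generated by all [x_1,...,x_n] *)
Definition lie_power (n : nat) : R -> Prop :=
  ideal_gen (fun z => exists x : nat -> R, z = lcomm x n.-1).

Definition lie_power_zero (n : nat) : Prop := forall z, lie_power n z -> z = 0.

Definition lie_nilpotent : Prop := exists m, (1 <= m)%N /\ lie_power_zero m.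

Definition is_tL (t : nat) : Prop :=
  [/\ (1 <= t)%N, lie_power_zero t &
      forall k, (1 <= k)%N -> (k < t)%N -> ~ lie_power_zero k].
End RingDefs.

(* R (with e : G -> R) is the group algebra KG: e is a monoid morphism into
   the multiplicative monoid of R and (e g)_{g in G} is a K-basis of R. *)
Definition is_group_algebra (K : fieldType) (G : groupType) (R : algType K)
  (e : G -> R) : Prop :=
  [/\ e 1%g = 1%R,
      (forall x y, e (x * y)%g = (e x * e y)%R),
      (forall (s : seq G) (c : G -> K), uniq s ->
         (\sum_(g <- s) c g *: e g = 0)%R -> forall g, g \in s -> c g = 0%R)
    & (forall r : R, exists (s : seq G) (c : G -> K),
         r = (\sum_(g <- s) c g *: e g)%R)].

(* Main.v *)
(* Write G' for the commutator subgroup, of order n, and R = KG. The lower Lie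
   powers are bounded from above by the upper ones, which are controlled by
   weights. If G' = N_1 > N_2 > ... > N is a G-invariant series with
   [N_v, G] <= N_(v+1), the products (m_1 - 1) ... (m_k - 1) r with m_j of weight
   v_j and v_1 + ... + v_k >= w span, modulo the ideal J generated by N - 1, an
   ideal containing the upper power of index w. Peeling off one generator of a
   polycyclic series at a time shows that this ideal lies in J for w large; and
   once the index S leads into J, the index |N| S leads to 0. When G' is not
   cyclic it has a G-invariant N with G'/N = C_p x C_p. Taking the weights of
   this quotient, or of a quotient of order 8, gives t < n - p + 2 except in the
   four cases of the theorem, in a class 3 case with |G'| = 4, and in the cyclic
   case.

   The lower bounds come from explicit commutators, whose leading terms are
   computed in the graded ring of the filtration: commuting with h acts as a
   derivation, plus multiplication by the class of [g, h] - 1 on the factor g.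
   For suitable x, y, b = [x, y], c = [b, x], d = [c, x], and with B = b - 1,
   C = c - 1, D = d - 1, the commutator [x, y, x, x] has leading term B C (p = 2),
   [x, y, x, y, y, xy, x] has B^2 C^2 (p = 3), [x, y, x, x, y, xy, x] has B C D
   (p = 2), and [x, y, ..., y] has C^(n-1), C = [x, y] - 1, when G' is cyclic. *)

From HB Require Import structures.
From mathcomp Require Import all_boot all_order monoid all_fingroup all_solvable all_algebra.
From mathcomp Require Import ring zify boolp.
(* [Defs] comes last: [all_solvable] exports another [nil_class]. *)
Require Import Defs.
Import GRing.Theory.
Set Implicit Arguments. Unset Strict Implicit. Unset Printing Implicit Defensive.

(* [nc] proves identities valid in every ring, not necessarily commutative:
   expand, then cancel opposite monomials pairwise. Monomials are compared up
   to unification because they may be typed with different instances of the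
   ring structure. *)
Ltac nc_cancel :=
  match goal with
  | |- is_true (_ + ?s + - ?t == 0)%R => unify s t; rewrite addrK
  | |- is_true (_ + - ?s + ?t == 0)%R => unify s t; rewrite subrK
  | |- is_true (_ + - ?t == 0)%R =>
      match goal with |- context [(?A + ?s + ?B)%R] =>
        unify s t; rewrite (addrAC A s B); nc_cancel end
  | |- is_true (_ + ?t == 0)%R =>
      match goal with |- context [(?A + - ?s + ?B)%R] =>
        unify s t; rewrite (addrAC A _ B); nc_cancel end
  end.
Ltac nc :=
  repeat match goal with x := _ |- _ => clearbody x end;
  apply/eqP; rewrite -subr_eq0;
  rewrite ?(mulrDl, mulrDr, mulrBl, mulrBr, mulNr, mulrN, mul1r, mulr1, mul0r, mulr0,
    opprD, opprB, opprK, oppr0, addr0, add0r, mulrA);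
  match goal with |- is_true (?S == _)%R => rewrite -[S]add0r end;
  rewrite ?addrA; repeat nc_cancel; rewrite ?addr0; exact: eqxx.

(** * Ideals and Lie powers *)

(** The case analysis comes from comparing an upper index with n - p. With weights 1 and 2 on a
    quotient of order p^2, the index |N|(3p - 2) is at most n - p = |N| p^2 - p unless p = 2, or p =
    3 and N = 1. For p = 2 a layer of weight 3 is added, and 7 |N_2| <= 8 |N_2| - 2 unless N_2 = 1.
    Orders 4, 8 and 9 remain. In class at least 3 the commutator word must then reach the top weight
    exactly, which dictates its letters: each new letter multiplies the leading term by a scalar
    modulo p read off from the preceding letters. The obstacle is that G may be infinite, while
    counting fixed points and taking Frattini subgroups require a finite p-group. Lie nilpotency
    enters through ad(y)^(p^a) = ad(y^(p^a)): all p^a-th powers are central in G, so G acts on the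
    finite group G' through a finite p-group. Fixed points of this action yield the invariant series
    and the nilpotency of G, from which G' is seen to be a p-group. *)

Section Ideals.
Local Open Scope ring_scope.
Variables (K : fieldType) (R : algType K).
Implicit Types (I J S : R -> Prop).

Lemma ideal_gen_ideal S : is_ideal (ideal_gen S).
Proof.
split.
- by move=> I [].
- by move=> a b Sa Sb I II SI; case: (II) => _ IB _ _; apply: IB; [apply: Sa|apply: Sb].
- by move=> r a Sa I II SI; case: (II) => _ _ IM _; apply: IM; apply: Sa.
- by move=> r a Sa I II SI; case: (II) => _ _ _ IM; apply: IM; apply: Sa.
Qed.

Lemma ideal_gen_mem S x : S x -> ideal_gen S x.
Proof. by move=> Sx I _; apply. Qed.

Lemma ideal0 I : is_ideal I -> I 0. Proof. by case. Qed.
Lemma idealB I a b : is_ideal I -> I a -> I b -> I (a - b).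
Proof. by case=> _ + _ _; apply. Qed.
Lemma idealN I a : is_ideal I -> I a -> I (- a).
Proof. by move=> II Ia; rewrite -sub0r; apply: idealB => //; apply: ideal0. Qed.
Lemma idealD I a b : is_ideal I -> I a -> I b -> I (a + b).
Proof. by move=> II Ia Ib; rewrite -[b]opprK; apply: idealB => //; apply: idealN. Qed.
Lemma idealMl I r a : is_ideal I -> I a -> I (r * a).
Proof. by case=> _ _ + _; apply. Qed.
Lemma idealMr I r a : is_ideal I -> I a -> I (a * r).
Proof. by case=> _ _ _; apply. Qed.
Lemma idealZ I (c : K) a : is_ideal I -> I a -> I (c *: a).
Proof. by move=> II Ia; rewrite -[a]mul1r scalerAl; apply: idealMl. Qed.

Lemma ideal_sum I (J : Type) (s : seq J) (P : pred J) (f : J -> R) :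
  is_ideal I -> (forall i, P i -> I (f i)) -> I (\sum_(i <- s | P i) f i).
Proof.
move=> II If; elim/big_rec: _ => [|i x Pi Ix]; first exact: ideal0.
by apply: idealD => //; apply: If.
Qed.

(* [upper n] is the upper Lie power usually written R^((n+1)); it contains the
   lower Lie power R^[n+1]. *)
Fixpoint upper (n : nat) : R -> Prop :=
  if n is n'.+1 then
    ideal_gen (fun z => exists a r, upper n' a /\ z = a * r - r * a)
  else fun _ => True.

Lemma upper_ideal n : is_ideal (upper n).
Proof. by case: n => [|n]; [split|apply: ideal_gen_ideal]. Qed.

Lemma upper_comm n a r : upper n a -> upper n.+1 (a * r - r * a).
Proof. by move=> Ua; apply: ideal_gen_mem; exists a, r. Qed.

(** The upper powers are the smallest chain of ideals that drops one step at each commutation; the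
    offset [m] lets the comparison start at a later index. *)
Lemma upper_min (F : nat -> R -> Prop) m :
  (forall n, is_ideal (F n)) -> (forall a, upper m a -> F 0%N a) ->
  (forall n a r, F n a -> F n.+1 (a * r - r * a)) ->
  forall n a, upper (n + m) a -> F n a.
Proof.
move=> Fi F0 Fc; elim=> [|n IHn] a; first exact: F0.
move/(_ (F n.+1)); apply=> // _ [b [r [Ub ->]]].
by apply/Fc/IHn.
Qed.

Lemma upper_lcomm (x : nat -> R) n : upper n (lcomm x n).
Proof. by elim: n => [|n IHn] //=; apply: upper_comm. Qed.

Lemma lie_power_upper n z : lie_power n.+1 z -> upper n z.
Proof.
apply; first exact: upper_ideal.
by move=> _ [x ->]; apply: upper_lcomm.
Qed.

(** [lcomm x n] is a word in n + 1 letters, which matches the index [n.+1]; vanishing of a Lie power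
    is tested on single words. *)
Lemma lie_power_zeroP n :
  lie_power_zero R n.+1 <-> forall x : nat -> R, lcomm x n = 0.
Proof.
split=> [Z x|Z z]; first by apply: Z; apply: ideal_gen_mem; exists x.
move/(_ (fun a => a = 0)); apply.
- split=> [//|a b -> ->|r a ->|r a ->]; by rewrite ?subr0 ?mulr0 ?mul0r.
- by move=> _ [x ->]; apply: Z.
Qed.

Lemma lcomm_zero (x : nat -> R) m n : (m <= n)%N -> lcomm x m = 0 -> lcomm x n = 0.
Proof.
move=> le_mn x0; rewrite -(subnK le_mn); elim: (n - m)%N => [//|k IHk].
by rewrite addSn /= IHk mul0r mulr0 subr0.
Qed.

Lemma lie_power_zero_mono m n :
  (0 < m)%N -> (m <= n)%N -> lie_power_zero R m -> lie_power_zero R n.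
Proof.
case: m n => [|m] [|n] // _ le_mn /lie_power_zeroP Z; apply/lie_power_zeroP => x.
exact: lcomm_zero (Z x).
Qed.

End Ideals.

(** * Augmentation ideals and weight filtrations *)

Section GroupAlgebra.
Local Open Scope ring_scope.
Variables (K : fieldType) (G : groupType) (R : algType K) (e : G -> R).
Hypothesis e1 : e 1%g = 1.
Hypothesis eM : forall x y, e (x * y)%g = e x * e y.
Hypothesis espan : forall r : R, exists (s : seq G) (c : G -> K),
  r = \sum_(g <- s) c g *: e g.

Lemma group_algebra_ind (P : R -> Prop) :
  P 0 -> (forall a b, P a -> P b -> P (a + b)) ->
  (forall c g, P (c *: e g)) -> forall r, P r.
Proof.
move=> P0 PD PZ r; have [s [c ->]] := espan r.
by elim/big_rec: _ => [//|g x _ Px]; apply: PD.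
Qed.

Lemma emV g : e g * e g^-1%g = 1. Proof. by rewrite -eM mulgV. Qed.
Lemma eX g n : e (g ^+ n)%g = e g ^+ n.
Proof. by elim: n => [|n IH]; rewrite ?expg0 ?expr0 // expgS eM IH exprS. Qed.
(** Since xy = yx [x, y], a ring commutator of group elements is a multiple of an augmentation
    element; this is the bridge between the two kinds of commutators. *)
Lemma eR x y : e x * e y - e y * e x = e (y * x)%g * (e [~ x, y] - 1).
Proof. by rewrite mulrBr mulr1 -!eM -commgC. Qed.

Lemma esub1_expr_pchar p g : p \in [pchar K] -> (e g - 1) ^+ p = e (g ^+ p)%g - 1.
Proof.
move=> pK; have pR : p \in [pchar R] by rewrite pchar_lalg.
rewrite -(pFrobenius_autE pR) pFrobenius_autB_comm; last exact: commr1.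
by rewrite !pFrobenius_autE expr1n -eX.
Qed.

(** For normal [N] this is the kernel of KG -> K[G/N]; working modulo it replaces passing to the
    quotient group. *)
Definition aug (N : G -> Prop) : R -> Prop :=
  ideal_gen (fun z => exists2 m, N m & z = e m - 1).

Lemma aug_ideal N : is_ideal (aug N). Proof. exact: ideal_gen_ideal. Qed.
Lemma aug_mem N m : N m -> aug N (e m - 1).
Proof. by move=> Nm; apply: ideal_gen_mem; exists m. Qed.

Lemma aug_trivial (N : G -> Prop) a : (forall x, N x -> x = 1%g) -> aug N a -> a = 0.
Proof.
move=> N1 /(_ (fun a => a = 0)); apply.
- split=> [//|b c -> ->|r b ->|r b ->]; by rewrite ?subr0 ?mulr0 ?mul0r.
- by move=> _ [m /N1 -> ->]; rewrite e1 subrr.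
Qed.

(* [Z = z - 1] is central modulo [aug N'], so by induction the upper power of
   index [i * S] lies in [Z ^ i R + aug N']; and [Z ^ p] is in [aug N']. *)
Section CentralExtension.
Variables (p : nat) (N N' : G -> Prop) (z : G) (S : nat).
Hypothesis pcharK : p \in [pchar K].
Hypothesis N'conj : forall x g, N' x -> N' (x ^ g)%g.
Hypothesis zcent : forall g, N' [~ z, g].
Hypothesis zp : N' (z ^+ p)%g.
Hypothesis Nz : forall m, N m -> exists i m', m = (z ^+ i * m')%g /\ N' m'.
Hypothesis US : forall a, upper S a -> aug N a.

Let Z := e z - 1.

Lemma aug_subZ a r : aug N' (Z * a * r - a * (Z * r)).
Proof.
have H : forall a, aug N' (Z * a - a * Z).
  move=> b; elim/group_algebra_ind: b => [|b c Hb Hc|k g].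
  - by rewrite mulr0 mul0r subrr; exact: ideal0 (aug_ideal N').
  - have -> : Z * (b + c) - (b + c) * Z = (Z * b - b * Z) + (Z * c - c * Z) by nc.
    exact: (idealD (aug_ideal N')).
  - rewrite -scalerAr -scalerAl -scalerBr; apply: (idealZ _ (aug_ideal N')).
    have -> : Z * e g - e g * Z = e z * e g - e g * e z by rewrite {1 2}/Z; nc.
    by rewrite eR; apply: (idealMl _ (aug_ideal N')); apply: aug_mem.
rewrite mulrA -mulrBl; apply: (idealMr _ (aug_ideal N')); apply: H.
Qed.

(** Write m = z^i m': then m - 1 = (z^i - 1) + z^i (m' - 1), and Z divides z^i - 1. Stability under
    left multiplication uses that Z is central modulo [aug N']. *)
Lemma augZ a : aug N a -> exists r j, a = Z * r + j /\ aug N' j.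
Proof.
have I' := aug_ideal N'.
move/(_ (fun a => exists r j, a = Z * r + j /\ aug N' j)); apply.
- split.
  + by exists 0, 0; rewrite mulr0 addr0; split=> //; exact: ideal0 I'.
  + move=> _ _ [r [j [-> Ij]]] [r' [j' [-> Ij']]]; exists (r - r'), (j - j').
    by rewrite opprD addrACA mulrBr; split=> //; exact: (idealB I').
  + move=> s _ [r [j [-> Ij]]]; exists (s * r), (s * j - (Z * s * r - s * (Z * r))).
    split; first by nc.
    by apply: idealB I' (idealMl _ I' Ij) (aug_subZ _ _).
  + move=> s _ [r [j [-> Ij]]]; exists (r * s), (j * s).
    by rewrite mulrDl mulrA; split=> //; exact: (idealMr _ I').
- move=> _ [m /Nz [i [m' [-> Nm']]] ->].
  exists (\sum_(k < i) e z ^+ k), (e z ^+ i * (e m' - 1)).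
  split; last by apply: (idealMl _ I'); apply: aug_mem.
  have E : e z ^+ i - 1 = Z * \sum_(k < i) e z ^+ k by exact: subrX1.
  by rewrite -E eM eX; nc.
Qed.

Lemma upper_central_ext a : upper (p * S) a -> aug N' a.
Proof.
have I' := aug_ideal N'.
(* Z^i times the upper power of index w, modulo [aug N']. As Z is central there, commutation acts on
   [b] alone; after S more steps [b] lies in [aug N], which yields one more factor Z. *)
pose X i w a := exists b j, [/\ a = Z ^+ i * b + j, upper w b & aug N' j].
have ZC i s r : aug N' (Z ^+ i * s * r - s * (Z ^+ i * r)).
  elim: i s r => [|i IH] s r; first by rewrite expr0 !mul1r subrr; exact: ideal0 I'.
  have -> : Z ^+ i.+1 * s * r - s * (Z ^+ i.+1 * r) =
     Z ^+ i * (Z * s * r - s * (Z * r)) + (Z ^+ i * s * (Z * r) - s * (Z ^+ i * (Z * r))).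
    have -> : Z ^+ i.+1 = Z ^+ i * Z by exact: exprSr.
    by nc.
  by apply: idealD I' (idealMl _ I' (aug_subZ _ _)) (IH _ _).
have XI i w : is_ideal (X i w).
  have Uw := @upper_ideal _ R w.
  split.
  + by exists 0, 0; rewrite mulr0 addr0; split=> //; [exact: ideal0 Uw|exact: ideal0 I'].
  + move=> _ _ [r [j [-> Ur Ij]]] [r' [j' [-> Ur' Ij']]]; exists (r - r'), (j - j').
    by rewrite opprD addrACA mulrBr; split=> //; [exact: (idealB Uw)|exact: (idealB I')].
  + move=> s _ [r [j [-> Ur Ij]]]; exists (s * r), (s * j - (Z ^+ i * s * r - s * (Z ^+ i * r))).
    split; [by nc|exact: (idealMl _ Uw)|].
    by apply: idealB I' (idealMl _ I' Ij) (ZC _ _ _).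
  + move=> s _ [r [j [-> Ur Ij]]]; exists (r * s), (j * s).
    by rewrite mulrDl mulrA; split=> //; [exact: (idealMr _ Uw)|exact: (idealMr _ I')].
have Xc i w b r : X i w b -> X i w.+1 (b * r - r * b).
  move=> [c [j [-> Uc Ij]]]; exists (c * r - r * c), ((j * r - r * j) + (Z ^+ i * r * c - r * (Z ^+ i * c))).
  split; last 1 first.
  + by apply: idealD I' (idealB I' (idealMr _ I' Ij) (idealMl _ I' Ij)) (ZC _ _ _).
  + by nc.
  + exact: upper_comm.
have main i : forall b, upper (i * S) b -> X i 0%N b.
  elim: i => [|i IHi] b; first by move=> Ub; exists b, 0; rewrite mul1r addr0; split=> //; exact: ideal0 I'.
  rewrite mulSn => Ub.
  have [c [j [-> Uc Ij]]] : X i S b by apply: (upper_min (XI i) IHi (Xc i)).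
  have [r [j' [-> Ij']]] := augZ (US Uc).
  exists r, (Z ^+ i * j' + j); split=> //; first by rewrite mulrDr exprSr -mulrA addrA.
  exact: (idealD I' (idealMl _ I' Ij')).
move=> /main [b [j [-> _ Ij]]]; apply: (idealD I') => //; apply: (idealMr _ I').
by rewrite esub1_expr_pchar //; apply: aug_mem.
Qed.

End CentralExtension.

Section WeightFiltration.
Variable J : R -> Prop.
Hypothesis Jideal : is_ideal J.

(* The span of the products [(m1 - 1) ... (mk - 1) r] with [N v_i m_i] and
   [v_1 + ... + v_k >= w], modulo [J]. *)
Inductive wfilt (N : nat -> G -> Prop) : nat -> R -> Prop :=
| wfilt0 r : wfilt N 0 r
| wfiltJ w a : J a -> wfilt N w a
| wfiltD w a b : wfilt N w a -> wfilt N w b -> wfilt N w (a + b)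
| wfiltM v w m a : N v m -> wfilt N w a -> wfilt N (v + w) ((e m - 1) * a)
| wfilt_le w w' a : (w' <= w)%N -> wfilt N w a -> wfilt N w' a.

Lemma wfilt_sub (N N' : nat -> G -> Prop) w a :
  (forall v x, N v x -> N' v x) -> wfilt N w a -> wfilt N' w a.
Proof.
move=> NN'; elim=> {w a} [r|w a Ja|w a b _ ? _ ?|v w m a Nm _ ?|w w' a le _ ?].
- exact: wfilt0.
- exact: wfiltJ.
- exact: wfiltD.
- by apply: wfiltM => //; apply: NN'.
- exact: wfilt_le le _.
Qed.

Lemma wfiltMr N w a r : wfilt N w a -> wfilt N w (a * r).
Proof.
elim=> {w a} [s|w a Ja|w a b _ ? _ ?|v w m a Nm _ ?|w w' a le _ ?].
- exact: wfilt0.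
- exact/wfiltJ/(idealMr _ Jideal).
- by rewrite mulrDl; apply: wfiltD.
- by rewrite -mulrA; apply: wfiltM.
- exact: wfilt_le le _.
Qed.

Lemma wfilt_zero N w : wfilt N w 0.
Proof. exact/wfiltJ/(ideal0 Jideal). Qed.

Lemma wfiltN N w a : wfilt N w a -> wfilt N w (- a).
Proof. by rewrite -mulrN1; apply: wfiltMr. Qed.

Lemma wfiltB N w a b : wfilt N w a -> wfilt N w b -> wfilt N w (a - b).
Proof. by move=> Fa Fb; apply: wfiltD => //; apply: wfiltN. Qed.

Lemma wfiltZ N w (c : K) a : wfilt N w a -> wfilt N w (c *: a).
Proof. by move=> Fa; rewrite -[a]mulr1 scalerAr; apply: wfiltMr. Qed.

Lemma wfilt_sum N w (I : Type) (s : seq I) (P : pred I) (f : I -> R) :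
  (forall i, P i -> wfilt N w (f i)) -> wfilt N w (\sum_(i <- s | P i) f i).
Proof.
move=> Ff; elim/big_rec: _ => [|i a Pi Fa]; first exact: wfilt_zero.
by apply: wfiltD => //; apply: Ff.
Qed.

Lemma wfilt_mem N v m : N v m -> wfilt N v (e m - 1).
Proof.
by move=> Nm; rewrite -[v]addn0 -[e m - 1]mulr1; apply: wfiltM => //; apply: wfilt0.
Qed.

Section Normal.
Variable N : nat -> G -> Prop.
Hypothesis Nconj : forall v x g, N v x -> N v (x ^ g)%g.

(** Moving g across m - 1 conjugates m, so normality of the terms of the series makes the filtration
    two-sided. *)
Lemma wfiltMl w a r : wfilt N w a -> wfilt N w (r * a).
Proof.
move=> Fa; elim/group_algebra_ind: r => [|b c Fb Fc|k g].
- by rewrite mul0r; apply: wfilt_zero.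
- by rewrite mulrDl; apply: wfiltD.
rewrite -scalerAl; apply: wfiltZ => {k}.
elim: Fa g => {w a} [s|w a Ja|w a b _ IHa _ IHb|v w m a Nm _ IHa|w w' a le _ IHa] g.
- exact: wfilt0.
- exact/wfiltJ/(idealMl _ Jideal).
- by rewrite mulrDr; apply: wfiltD.
- have -> : e g * ((e m - 1) * a) = (e (m ^ g^-1)%g - 1) * (e g * a).
    have E : e g * e m = e (m ^ g^-1)%g * e g by rewrite -!eM -conjgCV.
    have -> : e g * ((e m - 1) * a) = e g * e m * a - e g * a by nc.
    by rewrite E; nc.
  by apply: wfiltM => //; apply: Nconj.
- exact: wfilt_le le _.
Qed.

Lemma wfilt_ideal w : is_ideal (wfilt N w).
Proof.
split; [exact: wfilt_zero|exact: wfiltB|by move=> r a; apply: wfiltMl|].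
by move=> r a; apply: wfiltMr.
Qed.

Lemma wfilt_prod u v a b : wfilt N u a -> wfilt N v b -> wfilt N (u + v) (a * b).
Proof.
move=> Fa Fb; elim: Fa => {u a} [s|w a Ja|w a a' _ ? _ ?|v' w m a Nm _ ?|w w' a le _ ?].
- exact: wfiltMl.
- exact/wfiltJ/(idealMr _ Jideal).
- by rewrite mulrDl; apply: wfiltD.
- by rewrite -mulrA -addnA; apply: wfiltM.
- by apply: wfilt_le (_ : _ <= w + v)%N _ => //; rewrite leq_add2r.
Qed.

Hypothesis Ncomm1 : forall g h, N 1 [~ g, h]%g.
Hypothesis NcommS : forall v m g, N v m -> N v.+1 [~ m, g]%g.

Lemma wfilt_eR x y w : N w [~ x, y]%g -> wfilt N w (e x * e y - e y * e x).
Proof. by move=> Nxy; rewrite eR; apply/wfiltMl/wfilt_mem. Qed.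

(** By the Leibniz rule it suffices to look at one factor: commuting group elements produces an
    element of weight 1, and commuting m - 1 with g replaces m by [m, g], of weight one more. *)
Lemma wfilt_comm w a r : wfilt N w a -> wfilt N w.+1 (a * r - r * a).
Proof.
move=> Fa; elim/group_algebra_ind: r => [|b c Fb Fc|k g].
- by rewrite mulr0 mul0r subrr; apply: wfilt_zero.
- have -> : a * (b + c) - (b + c) * a = (a * b - b * a) + (a * c - c * a) by nc.
  exact: wfiltD.
rewrite -scalerAl -scalerAr -scalerBr; apply: wfiltZ => {k}.
elim: Fa g => {w a} [s|w a Ja|w a b _ IHa _ IHb|v w m a Nm Fa IHa|w w' a le _ IHa] g.
- elim/group_algebra_ind: s => [|b c Fb Fc|k h].
  + by rewrite mulr0 mul0r subrr; apply: wfilt_zero.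
  + have -> : (b + c) * e g - e g * (b + c) = (b * e g - e g * b) + (c * e g - e g * c) by nc.
    exact: wfiltD.
  rewrite -scalerAl -scalerAr -scalerBr; apply: wfiltZ.
  exact: wfilt_eR.
- by apply/wfiltJ/(idealB Jideal); [exact: (idealMr _ Jideal)|exact: (idealMl _ Jideal)].
- have -> : (a + b) * e g - e g * (a + b) = (a * e g - e g * a) + (b * e g - e g * b) by nc.
  exact: wfiltD.
- have -> : (e m - 1) * a * e g - e g * ((e m - 1) * a) =
    (e m - 1) * (a * e g - e g * a) + (e m * e g - e g * e m) * a by nc.
  apply: wfiltD; first by rewrite -addnS; apply: wfiltM.
  by rewrite -addSn; apply: wfilt_prod => //; apply: wfilt_eR; apply: NcommS.
- by apply: wfilt_le (_ : _ <= w.+1)%N _.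
Qed.

Lemma upper_wfilt w a : upper w a -> wfilt N w a.
Proof.
rewrite -[w in upper w]addn0; apply: (upper_min wfilt_ideal) => [b _|]; first exact: wfilt0.
by move=> n b r; apply: wfilt_comm.
Qed.

End Normal.

Section Peel.
Variables (p : nat) (N N' : nat -> G -> Prop) (b : G) (u : nat).
Hypothesis pcharK : p \in [pchar K].
Hypothesis NN' : forall v m, N v m ->
  exists j l, [/\ m = (b ^+ j * l)%g, N' v l & j = 0%N \/ (v <= u)%N].
Hypothesis bp : N' (p * u)%N (b ^+ p)%g.
Hypothesis bcomm : forall v l, N' v l -> J (e b * e l - e l * e b).

Let B := e b - 1.
(** Polynomials in B of degree below p. The subtraction is truncated, so the coefficient of B^j is
    unconstrained once j u reaches w. *)
Let H w (a : R) := exists f : nat -> R, a = \sum_(j < p) B ^+ j * f j /\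
  forall j, (j < p)%N -> wfilt N' (w - j * u) (f j).

Let p_gt0 : (0 < p)%N. Proof. by rewrite prime_gt0 // (pcharf_prime pcharK). Qed.

Let H_of w a : wfilt N' w a -> H w a.
Proof.
move=> Fa; exists (fun j => if j is 0%N then a else 0); split.
  case: (p) p_gt0 => // q _; rewrite big_ord_recl expr0 mul1r big1 ?addr0 // => i _.
  by rewrite mulr0.
by case=> [|j] _; [rewrite subn0|exact: wfilt_zero].
Qed.

Let HD w a a' : H w a -> H w a' -> H w (a + a').
Proof.
move=> [f [-> Ff]] [g [-> Fg]]; exists (fun j => f j + g j); split.
  by rewrite -big_split; apply: eq_bigr => j _; rewrite mulrDr.
by move=> j ltj; apply: wfiltD; [apply: Ff|apply: Fg].
Qed.

Let H_le w w' a : (w' <= w)%N -> H w a -> H w' a.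
Proof.
move=> le [f [-> Ff]]; exists f; split=> // j ltj.
by apply: wfilt_le (Ff j ltj); apply: leq_sub2r.
Qed.

Let Bcomm v l j : N' v l -> J ((e l - 1) * B ^+ j - B ^+ j * (e l - 1)).
Proof.
move=> Nl; elim: j => [|j IHj]; first by rewrite !expr0 mulr1 mul1r subrr; apply: ideal0 Jideal.
have -> : B ^+ j.+1 = B ^+ j * B by exact: exprSr.
have -> : (e l - 1) * (B ^+ j * B) - B ^+ j * B * (e l - 1) =
  ((e l - 1) * B ^+ j - B ^+ j * (e l - 1)) * B - B ^+ j * (B * (e l - 1) - (e l - 1) * B).
  by nc.
apply: (idealB Jideal); first exact: (idealMr _ Jideal).
apply: (idealMl _ Jideal).
have -> : B * (e l - 1) - (e l - 1) * B = e b * e l - e l * e b by rewrite /B; nc.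
exact: bcomm Nl.
Qed.

Let HM' v w l a : N' v l -> H w a -> H (v + w) ((e l - 1) * a).
Proof.
move=> Nl [f [-> Ff]].
have -> : (e l - 1) * (\sum_(j < p) B ^+ j * f j) =
  \sum_(j < p) B ^+ j * ((e l - 1) * f j) +
  \sum_(j < p) ((e l - 1) * B ^+ j - B ^+ j * (e l - 1)) * f j.
  rewrite mulr_sumr -big_split; apply: eq_bigr => j _ /=; nc.
apply: HD.
  exists (fun j => (e l - 1) * f j); split=> // j ltj.
  apply: wfilt_le (wfiltM Nl (Ff j ltj)).
  by rewrite leq_subLR addnCA leq_add2l -leq_subLR.
apply/H_of/wfilt_sum => j _; apply/wfiltJ/(idealMr _ Jideal); exact: Bcomm Nl.
Qed.

Let HMl v w l a : N' v l -> H w a -> H w (e l * a).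
Proof.
move=> Nl Ha; have -> : e l * a = (e l - 1) * a + a by nc.
by apply: HD => //; apply: H_le (HM' Nl Ha); apply: leq_addl.
Qed.

(** Multiplication by B shifts the coefficients; the top one overflows into B^p = b^p - 1, which
    loses nothing because b^p has weight p u in the smaller family. *)
Let HB w a : H w a -> H (u + w) (B * a).
Proof.
move=> [f [-> Ff]].
have pE : p = p.-1.+1 by rewrite prednK.
pose g (j : nat) : R := if j is j'.+1 then f j' else 0.
have -> : B * (\sum_(j < p) B ^+ j * f j) =
    \sum_(j < p) B ^+ j * g j +
    (e (b ^+ p)%g - 1) * f p.-1.
  have Bp : B ^+ p = e (b ^+ p)%g - 1 by apply: esub1_expr_pchar.
  have aux q : B * (\sum_(j < q.+1) B ^+ j * f j) =
      \sum_(j < q.+1) B ^+ j * g j + B ^+ q.+1 * f q.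
    rewrite mulr_sumr big_ord_recr big_ord_recl /= mulr0 add0r mulrA -exprS.
    by congr (_ + _); apply: eq_bigr => j _; rewrite mulrA -exprS.
  by have := aux p.-1; rewrite prednK // Bp.
apply: HD.
  exists g; split=> // -[|j] ltj.
    exact: wfilt_zero.
  rewrite mulSn subnDl; apply: Ff; exact: ltnW.
apply: H_of; apply: wfilt_le (wfiltM bp (Ff _ _)); last by rewrite prednK.
rewrite {1}pE mulSn -addnA leq_add2l -leq_subLR //.
Qed.

Let Hb w a : H w a -> H w (e b * a).
Proof.
move=> Ha; have -> : e b * a = B * a + a by rewrite /B; nc.
by apply: HD => //; apply: H_le (HB Ha); apply: leq_addl.
Qed.

Let HbX w j a : H w a -> H w (e (b ^+ j)%g * a).
Proof.
move=> Ha; rewrite eX; elim: j => [|j IHj]; first by rewrite mul1r.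
by rewrite exprS -mulrA; apply: Hb.
Qed.

Let HBX w j a : H w a -> H (u + w) ((e (b ^+ j)%g - 1) * a).
Proof.
move=> Ha; elim: j => [|j IHj].
  by rewrite expg0 e1 subrr mul0r; apply: H_of; apply: wfilt_zero.
have -> : (e (b ^+ j.+1)%g - 1) * a = B * (e (b ^+ j)%g * a) + (e (b ^+ j)%g - 1) * a.
  by rewrite expgS eM /B; nc.
by apply: HD => //; apply: HB; apply: HbX.
Qed.

(** For m = b^j l, write m - 1 = (b^j - 1) l + (l - 1). The first part is a multiple of B, whose
    weight u is at least v when j is not 0; the second moves past the powers of B because b commutes
    with l modulo [J]. *)
Lemma wfilt_peel w a : wfilt N w a -> exists f : nat -> R,
  (a = \sum_(j < p) B ^+ j * f j)%R /\
  forall j, (j < p)%N -> wfilt N' (w - j * u) (f j).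
Proof.
elim=> {w a} [r|w a Ja|w a a' _ ? _ ?|v w m a Nm _ Ha|w w' a le _ Ha].
- exact/H_of/wfilt0.
- exact/H_of/wfiltJ.
- exact: HD.
- have [j [l [-> Nl jv]]] := NN' Nm.
  have -> : (e (b ^+ j * l)%g - 1) * a = (e (b ^+ j)%g - 1) * (e l * a) + (e l - 1) * a.
    by rewrite eM; nc.
  apply: HD; last exact: HM' Nl Ha.
  case: jv => [->|le_vu].
    by rewrite expg0 e1 subrr mul0r; apply/H_of/wfilt_zero.
  apply: H_le (HBX j (HMl Nl Ha)); by rewrite leq_add2r.
- exact: H_le Ha.
Qed.

End Peel.

Section Polycyclic.
Variables (p : nat) (Ninf : G -> Prop).
Hypothesis pcharK : p \in [pchar K].
Hypothesis JN : forall x, Ninf x -> J (e x - 1).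

(* A polycyclic series with weights: [wfam s v] is generated by [Ninf] and the
   [b] such that [(b, u)] is in [s] with [v <= u]. *)
Fixpoint wfam (s : seq (G * nat)) (v : nat) : G -> Prop :=
  if s is bu :: s' then
    if (v <= bu.2)%N then
      fun x => exists j y, x = (bu.1 ^+ j * y)%g /\ wfam s' v y
    else wfam s' v
  else Ninf.

(** These are the conditions for peeling the generators one at a time: no weight is lost in b^p, and
    b commutes with the later terms modulo [Ninf]. *)
Fixpoint wgood (s : seq (G * nat)) : Prop :=
  if s is bu :: s' then
    [/\ wfam s' (p * bu.2) (bu.1 ^+ p)%g,
        forall v y, wfam s' v y -> Ninf [~ bu.1, y]%g & wgood s']
  else True.

(** After all generators are peeled off, the exponents are at most p - 1, so the monomials account
    for a weight of at most (p - 1) times the sum of the weights. Any excess must be carried by a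
    factor from [Ninf], hence lies in [J]. *)
Lemma wfilt_wfam s w a : wgood s -> (p.-1 * sumn (map snd s) < w)%N ->
  wfilt (wfam s) w a -> J a.
Proof.
elim: s w a => [|[b u] s IHs] w a /=.
  rewrite muln0 => _ w_gt0 Fa; elim: Fa w_gt0 => {w a} //.
  - by move=> w a a' _ Ja _ Ja' w0; apply: (idealD Jideal); [apply: Ja|apply: Ja'].
  - by move=> v w m a Nm _ _ _; apply: (idealMr _ Jideal); apply: JN.
  - by move=> w w' a le _ Ja w'0; apply: Ja; apply: leq_trans le.
case=> bp bc gs lt_w Fa.
have [||f [-> Ff]] := wfilt_peel pcharK _ bp _ Fa.
- move=> v m /=; case: ifP => le_vu; last by exists 0%N, m; rewrite expg0 mul1g; split=> //; left.
  by move=> [j [y [-> Ny]]]; exists j, y; split=> //; right.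
- move=> v l /bc Nbl; rewrite eR; apply: (idealMl _ Jideal); exact: JN.
apply: (ideal_sum _ Jideal) => j _; apply: (idealMl _ Jideal).
apply: IHs gs _ (Ff j (ltn_ord j)).
rewrite ltn_subRL; apply: leq_ltn_trans lt_w; rewrite mulnDr leq_add2r leq_mul2r.
by rewrite -ltnS prednK ?ltn_ord ?orbT // prime_gt0 // (pcharf_prime pcharK).
Qed.

End Polycyclic.
End WeightFiltration.
End GroupAlgebra.

(** * Leading terms of Lie commutators *)

Section LeadingTerms.
Local Open Scope ring_scope.
Variables (K : fieldType) (G : groupType) (R : algType K) (e : G -> R).
Hypothesis e1 : e 1%g = 1.
Hypothesis eM : forall x y, e (x * y)%g = e x * e y.
Hypothesis espan : forall r : R, exists (s : seq G) (c : G -> K),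
  r = \sum_(g <- s) c g *: e g.
Variable J : R -> Prop.
Hypothesis Jideal : is_ideal J.
Variable N : nat -> G -> Prop.
Hypothesis Nconj : forall v x g, N v x -> N v (x ^ g)%g.
Hypothesis Ncomm1 : forall g h, N 1 [~ g, h]%g.
Hypothesis NcommS : forall v m g, N v m -> N v.+1 [~ m, g]%g.

Local Notation F := (wfilt e J N).

Let FD w a b : F w a -> F w b -> F w (a + b). Proof. exact: wfiltD. Qed.
Let FB w a b : F w a -> F w b -> F w (a - b). Proof. exact: wfiltB. Qed.
Let FN w a : F w a -> F w (- a). Proof. exact: wfiltN. Qed.
Let FMl w r a : F w a -> F w (r * a).
Proof. by move=> Fa; apply: (wfiltMl eM espan). Qed.
Let FMr w r a : F w a -> F w (a * r). Proof. exact: wfiltMr. Qed.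
Let FP u v w a b : (u + v = w)%N -> F u a -> F v b -> F w (a * b).
Proof. by move=> <- Fa Fb; apply: (wfilt_prod eM espan). Qed.
Let Fle w w' a : (w' <= w)%N -> F w a -> F w' a. Proof. exact: wfilt_le. Qed.
Let FC w a r : F w a -> F w.+1 (a * r - r * a).
Proof. by move=> Fa; apply: (wfilt_comm eM espan). Qed.
Let FZ w (k : K) a : F w a -> F w (k *: a). Proof. exact: wfiltZ. Qed.

Let F0 w a : a = 0 -> F w a. Proof. by move=> ->; apply: wfilt_zero. Qed.
Let Fm v m : N v m -> F v (e m - 1). Proof. exact: wfilt_mem. Qed.

Definition leads v (X : R) (u : G) (k : K) := N v u /\ F v.+1 (e u - 1 - k *: X).

(** Because u^g = u [u, g] and [u, g] has higher weight. *)
Lemma leadsJ v X u k g : leads v X u k -> leads v X (u ^ g)%g k.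
Proof.
move=> [Nu Fu]; split; first exact: Nconj.
have -> : e (u ^ g)%g - 1 - k *: X = (e u - 1 - k *: X) + e u * (e [~ u, g]%g - 1).
  have -> : e (u ^ g)%g = e u * e [~ u, g]%g by rewrite -eM commgEl mulgA mulgV mul1g.
  by nc.
by apply: FD => //; apply: FMl; apply: Fm; apply: NcommS.
Qed.

(** Expand uu' - 1 = (u - 1)(u' - 1) + (u - 1) + (u' - 1); the product has weight 2v, which exceeds
    v because v is positive. *)
Lemma leadsM v X u k u' k' : (0 < v)%N -> N v (u * u')%g -> 
  leads v X u k -> leads v X u' k' -> leads v X (u * u')%g (k + k').
Proof.
move=> v_gt0 Nuu [Nu Fu] [Nu' Fu']; split=> //.
have -> : e (u * u')%g - 1 - (k + k') *: X =
  (e u - 1) * (e u' - 1) + ((e u - 1 - k *: X) + (e u' - 1 - k' *: X)).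
  by rewrite eM scalerDl; nc.
apply: FD; last exact: FD.
apply: Fle (FP (erefl _) (Fm Nu) (Fm Nu')).
by rewrite -addn1 leq_add2l.
Qed.

Lemma leads_comml v X x y g k k' : (0 < v)%N -> N v [~ x * y, g]%g ->
  leads v X [~ x, g]%g k -> leads v X [~ y, g]%g k' ->
  leads v X [~ x * y, g]%g (k + k').
Proof.
have -> : [~ x * y, g]%g = ([~ x, g] ^ y * [~ y, g])%g.
  by rewrite !commgEl conjMg invgM !conjgE -!mulgA !mulVKg.
move=> v0 Nxy Lx Ly; apply: leadsM => //; exact: leadsJ.
Qed.

Lemma leads_commr v X x g h k k' : (0 < v)%N -> N v [~ x, g * h]%g ->
  leads v X [~ x, g]%g k -> leads v X [~ x, h]%g k' ->
  leads v X [~ x, g * h]%g (k + k').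
Proof.
have -> : [~ x, g * h]%g = ([~ x, h] * [~ x, g] ^ h)%g.
  by rewrite !commgEl conjMg conjgM conjVg -mulgA mulVKg.
move=> v0 Nxy Lx Ly; rewrite addrC; apply: leadsM => //; exact: leadsJ.
Qed.

(* [m'] represents the image of [m] under the derivation induced by [h] on the
   associated graded ring. *)
Definition derives w m (h : G) m' := F w m /\ F w.+2 (m * e h - e h * m - m' * e h).

Let der_mem w m h m' : derives w m h m' -> F w.+1 m'.
Proof.
move=> [Fwm Fm']; have -> : m' = (m' * e h) * e h^-1%g by rewrite -mulrA emV ?mulr1.
apply: FMr.
have -> : m' * e h = (m * e h - e h * m) - (m * e h - e h * m - m' * e h) by nc.
by apply: FB; [exact: FC|exact: Fle Fm'].
Qed.

Lemma derives_gen v b X h k : (0 < v)%N -> leads v.+1 X [~ b, h]%g k -> N v b ->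
  F v.+1 X -> derives v (e b - 1) h (k *: X).
Proof.
move=> v_gt0 [Nu Fu] Nb FX; split; first exact: Fm.
have -> : (e b - 1) * e h - e h * (e b - 1) - k *: X * e h =
  (e b * e h - e h * e b) - k *: X * e h by nc.
rewrite eR //; set u := [~ b, h]%g in Nu Fu *.
have FkX : F v.+1 (k *: X) by apply: FZ.
set Y := k *: X in Fu FkX *.
have -> : e (h * b)%g * (e u - 1) - Y * e h =
  e (h * b)%g * (e u - 1 - Y) - (Y * e h - e h * Y) + e h * ((e b - 1) * Y).
  by rewrite eM; nc.
apply: FD; first by apply: FB; [exact: FMl|exact: FC].
apply: FMl; apply: Fle (FP (erefl _) (Fm Nb) FkX).
by rewrite addnS ltnS -addn1 leq_add2l.
Qed.

Lemma derives0 w m h : F w m -> F w.+2 (m * e h - e h * m) -> derives w m h 0.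
Proof. by move=> Fm' Fh; split=> //; rewrite mul0r subr0. Qed.

Lemma derives1 h : derives 0 1 h 0.
Proof.
apply: derives0; first exact: wfilt0.
by rewrite mul1r mulr1 subrr; apply: wfilt_zero.
Qed.

Lemma derivesM u v w m h m' n n' : (u + v = w)%N ->
  derives u m h m' -> derives v n h n' -> derives w (m * n) h (m' * n + m * n').
Proof.
move=> <- Dm Dn; have [[Fu Fu'] [Fv Fv']] := (Dm, Dn); have Fn' := der_mem Dm.
split; first exact: FP.
have -> : m * n * e h - e h * (m * n) - (m' * n + m * n') * e h =
  m * (n * e h - e h * n - n' * e h) + (m * e h - e h * m - m' * e h) * n
  - m' * (n * e h - e h * n) by nc.
apply: FB; first apply: FD; apply: FP; eauto; rewrite ?addnS ?addSn //.
Qed.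

Lemma derivesZ w m h m' k : derives w m h m' -> derives w (k *: m) h (k *: m').
Proof.
move=> [Fw Fw']; split; first exact: FZ.
by rewrite -!scalerAl -scalerAr -!scalerBr; apply: FZ.
Qed.

Lemma derivesD w m h m' n n' :
  derives w m h m' -> derives w n h n' -> derives w (m + n) h (m' + n').
Proof.
move=> [Fw Fw'] [Fu Fu']; split; first exact: FD.
have -> : (m + n) * e h - e h * (m + n) - (m' + n') * e h =
  (m * e h - e h * m - m' * e h) + (n * e h - e h * n - n' * e h) by nc.
exact: FD.
Qed.

Lemma derivesB w m h m' n n' :
  derives w m h m' -> derives w n h n' -> derives w (m - n) h (m' - n').
Proof. by move=> Dm Dn; rewrite -!scaleN1r; apply: derivesD => //; apply: derivesZ. Qed.

Lemma derivesN w m h m' : derives w m h m' -> derives w (- m) h (- m').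
Proof. by move=> Dm; rewrite -!scaleN1r; apply: derivesZ. Qed.

(** The effect of one more letter h on a word with leading term m g. The group element is kept on
    the right, where it determines the scalar k that the letter contributes. *)
Lemma comm_step w a m g h m' m2 B k :
  F w.+1 (a - m * e g) -> derives w m h m' ->
  leads 1 B [~ g, h]%g k -> F w.+2 (m' + k *: (m * B) - m2) ->
  F w.+2 (a * e h - e h * a - m2 * e (g * h)%g).
Proof.
move=> Fa Dm [Nu Fu] Fm2; have [Fw Fw'] := Dm; have Fm' := der_mem Dm.
set u := [~ g, h]%g in Nu Fu.
have -> : a * e h - e h * a - m2 * e (g * h)%g =
  ((a - m * e g) * e h - e h * (a - m * e g)) + (m * e h - e h * m - m' * e h) * e g
  + m * (e g * e h - e h * e g) - m' * (e g * e h - e h * e g) + (m' - m2) * e (g * h)%g.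
  by rewrite eM; nc.
have Fgh : F 1 (e g * e h - e h * e g) by apply: FC; apply: wfilt0.
(* All summands on the right have weight at least w + 2, except the last one, k m B g h. *)
have -> : m * (e g * e h - e h * e g) = 
  - m * (e (h * g)%g * (e u - 1) * (e u - 1)) + (m * e (g * h)%g - e (g * h)%g * m) * (e u - 1)
  - (m * (e u - 1) * e (g * h)%g - e (g * h)%g * (m * (e u - 1)))
  + m * (e u - 1 - k *: B) * e (g * h)%g + k *: (m * B) * e (g * h)%g.
  have E : e (g * h)%g = e (h * g)%g * e u by rewrite commgC eM.
  by rewrite eR // -/u E scalerAr; nc.
have -> : forall X Y Z T U V : R, X + Y + (Z + T * U) - V + (m' - m2) * U =
    X + Y + Z - V + (m' + T - m2) * U by move=> *; nc.
apply: FD; last exact: FMr.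
have Fu1 : F 1 (e u - 1) by exact: Fm.
apply: FB; last exact: FP (addn1 _) Fm' Fgh.
apply: FD; first apply: FD.
- exact: FC.
- exact: FMr.
apply: FD; last by apply: FMr; exact: FP (addn2 _) Fw Fu.
apply: FB; first apply: FD.
- rewrite mulNr; apply/FN/(FP (addn2 _) Fw)/(FP (addn1 1)) => //; exact: FMl.
- by apply: FP (addn1 _) _ Fu1; exact: FC.
- by apply: FC; exact: FP (addn1 _) Fw Fu1.
Qed.

Section Words.
Hypothesis Nsub : forall v, is_subgroup (N v).

Let N1 v : N v 1%g. Proof. by case: (Nsub v). Qed.
Let NF v u w : N v u -> N v w -> N v (u * w^-1)%g.
Proof. by case: (Nsub v) => _; apply. Qed.
Let NV v u : N v u -> N v u^-1%g.
Proof. by move=> Nu; rewrite -[u^-1%g]mul1g; apply: NF. Qed.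

Lemma leadsV v X u k : (0 < v)%N -> leads v X u k -> leads v X u^-1%g (- k).
Proof.
move=> v_gt0 [Nu Fu]; split; first exact: NV.
have eVu : e u^-1%g * e u = 1 by rewrite -eM mulVg.
have -> : e u^-1%g - 1 - - k *: X =
  e u^-1%g * ((e u - 1) * (e u - 1)) - (e u - 1 - k *: X).
  have -> : e u^-1%g * ((e u - 1) * (e u - 1)) =
     e u^-1%g * e u * (e u - 1) - e u^-1%g * e u + e u^-1%g by nc.
  by rewrite eVu scaleNr; nc.
apply: FB => //; apply: FMl; apply: Fle (FP (erefl _) (Fm Nu) (Fm Nu)).
by rewrite -addn1 leq_add2l.
Qed.

Lemma leads_id u v : N v u -> leads v (e u - 1) u 1.
Proof. by move=> Nu; split=> //; rewrite scale1r subrr; apply: wfilt_zero. Qed.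

Lemma leads_0 v X u : N v u -> N v.+1 u -> leads v X u 0.
Proof. by move=> Nu Nu'; split=> //; rewrite scale0r subr0; apply: Fm. Qed.

Variables x y : G.
Let b := [~ x, y]%g.
Let c := [~ b, x]%g.
Let d := [~ c, x]%g.
Let B := e b - 1.
Let C := e c - 1.
Let D := e d - 1.
(** Secured by the choice of the pair x, y: modulo weight 3 only x moves b, so that B has derivative
    C under x and 0 under y. *)
Hypothesis by3 : N 3 [~ b, y]%g.

(* The class of [g] is [x ^ i * y ^ j] modulo what commutes with [x] and [y]
   up to terms of weight 2. *)
Let word g (i j : K) := leads 1 B [~ g, x]%g (- j) /\ leads 1 B [~ g, y]%g i.

Let word_x : word x 1 0.
Proof.
split; last by apply: leads_id; apply: Ncomm1.
by rewrite oppr0 commgg; apply: leads_0.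
Qed.

Let word_y : word y 0 1.
Proof.
split; last by rewrite commgg; apply: leads_0.
by rewrite -invgR; apply: leadsV => //; apply: leads_id; apply: Ncomm1.
Qed.

Let wordM g h i j i' j' : word g i j -> word h i' j' -> word (g * h)%g (i + i') (j + j').
Proof.
move=> [gx gy] [hx hy]; split; last by apply: leads_comml.
by rewrite opprD; apply: leads_comml.
Qed.

Let word_xy g i j : word g i j -> leads 1 B [~ g, x * y]%g (- j + i).
Proof. by move=> [gx gy]; apply: leads_commr. Qed.

Let Nb : N 1 b. Proof. exact: Ncomm1. Qed.
Let Nc : N 2 c. Proof. exact: NcommS. Qed.
Let Nd : N 3 d. Proof. exact: NcommS. Qed.
Let FBB : F 1 B. Proof. exact: Fm. Qed.
Let FCC : F 2 C. Proof. exact: Fm. Qed.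
Let FDD : F 3 D. Proof. exact: Fm. Qed.

Let bx : leads 2 C [~ b, x]%g 1. Proof. exact: leads_id. Qed.
Let by0 : leads 2 C [~ b, y]%g 0. Proof. by apply: leads_0 => //; apply: NcommS. Qed.
Let bxy : leads 2 C [~ b, x * y]%g 1.
Proof. by rewrite -[1]addr0; apply: leads_commr => //; apply: NcommS. Qed.

Let derBx : derives 1 B x C. Proof. by rewrite -[C]scale1r; apply: derives_gen. Qed.
Let derBy : derives 1 B y 0. Proof. by rewrite -[0](scale0r C); apply: derives_gen. Qed.
Let derBxy : derives 1 B (x * y)%g C. Proof. by rewrite -[C]scale1r; apply: derives_gen. Qed.

Let derCx : derives 2 C x D.
Proof. by rewrite -[D]scale1r; apply: derives_gen => //; apply: leads_id. Qed.

Let der_central w m h : F w m -> m * e h = e h * m -> derives w m h 0.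
Proof. by move=> Fw mh; apply: derives0 => //; rewrite mh subrr; apply: wfilt_zero. Qed.

Let step0 : F 2 (e x * e y - e y * e x - B * e (x * y)%g).
Proof.
have [_ xy] := word_x.
apply: (comm_step (m := 1) (w := 0) _ (derives1 y) xy).
  by rewrite mul1r subrr; apply: wfilt_zero.
by rewrite add0r mul1r scale1r subrr; apply: wfilt_zero.
Qed.

(** The derivative of B under x gives C, and [xy, x] contributes the scalar -1, hence -B^2. *)
Let step1 a : F 2 (a - B * e (x * y)%g) ->
  F 3 (a * e x - e x * a - (C - B * B) * e (x * y * x)%g).
Proof.
move=> Fa; have [xyx _] := wordM word_x word_y.
apply: (comm_step Fa derBx xyx).
by rewrite add0r scaleN1r subrr; apply: wfilt_zero.
Qed.

Let lc (s : seq R) := lcomm (nth 0 s) (size s).-1.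

Section Char3.
Hypothesis K3 : 3%:R = 0 :> K.
Hypothesis Bcube : B * B * B = 0.
Hypothesis Ccube : C * C * C = 0.
Hypothesis BC : C * B = B * C.
Hypothesis Cx : C * e x = e x * C.
Hypothesis Cy : C * e y = e y * C.

(** The successive leading terms are B, C - B^2, -BC, B^2 C, -B C^2, B^2 C^2. The sixth letter is xy
    rather than x because the last scalar is then -4 = -1 instead of -3 = 0. *)
Lemma lcomm_char3 :
  F 7 (lc [:: e x; e y; e x; e y; e y; e (x * y)%g; e x] -
       B * B * C * C * e (x * y * x * y * y * (x * y) * x)%g).
Proof.
clearbody D C B.
have Cxy : C * e (x * y)%g = e (x * y)%g * C by rewrite eM mulrA Cx -mulrA Cy mulrA.
have w2 := wordM (wordM word_x word_y) word_x.
have w3 := wordM w2 word_y; have w4 := wordM w3 word_y.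
have w5 := wordM w4 (wordM word_x word_y).
have s2 := step1 step0.
have dCx := der_central FCC Cx; have dCy := der_central FCC Cy.
have dCxy := der_central FCC Cxy.
have two : 1 + 0 + 1 = -1 :> K.
  have E : 3%:R - 1 = 1 + 0 + 1 :> K by ring.
  by rewrite -E K3 sub0r.
have BCB : B * C * B = B * B * C by rewrite -mulrA BC mulrA.
have s3 : F 4 (lc [:: e x; e y; e x; e y] - - (B * C) * e (x * y * x * y)%g).
  apply: (comm_step s2 (derivesB dCy (derivesM (erefl _) derBy derBy)) w2.2).
  rewrite two scaleN1r mulrBl Bcube BC.
  by apply: F0; nc.
have s4 : F 5 (lc [:: e x; e y; e x; e y; e y] - B * B * C * e (x * y * x * y * y)%g).
  apply: (comm_step s3 (derivesN (derivesM (erefl _) derBy dCy)) w3.2).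
  have -> : 1 + 0 + 1 + 0 = -1 :> K by rewrite addr0.
  by rewrite scaleN1r mulNr BCB; apply: F0; nc.
have s5 : F 6 (lc [:: e x; e y; e x; e y; e y; e (x * y)%g] -
    - (B * C * C) * e (x * y * x * y * y * (x * y))%g).
  apply: (comm_step s4 (derivesM (erefl _) (derivesM (erefl _) derBxy derBxy) dCxy) (word_xy w4)).
  have -> : B * B * C * B = 0 by rewrite -!mulrA BC !mulrA Bcube mul0r.
  rewrite scaler0 mulr0 !addr0 BC mulrDl.
  apply: F0; set t := B * C * C.
  have -> : t + t - - t = 3%:R *: t by rewrite scaler_nat opprK mulrS mulr2n addrA.
  by rewrite K3 scale0r.
apply: (comm_step s5 (derivesN (derivesM (erefl _) (derivesM (erefl _) derBx dCx) dCx)) w5.1).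
have -> : - (0 + 1 + 0 + 1 + 1 + (0 + 1)) = -1 :> K.
  have -> : - (0 + 1 + 0 + 1 + 1 + (0 + 1)) = -1 - 3%:R :> K by ring.
  by rewrite K3 subr0.
have -> : - (B * C * C) * B = - (B * B * C * C).
  by rewrite mulNr -[B * C * C * B]mulrA BC !mulrA BCB.
by rewrite scaleN1r !(mulr0, addr0) Ccube; apply: F0; nc.
Qed.
End Char3.

Section Char2.
Hypothesis K2 : 2%:R = 0 :> K.
Hypothesis BC : C * B = B * C.

Let signK (k : K) : - k = k.
Proof. by apply/eqP; rewrite eq_sym -addr_eq0 -mulr2n -mulr_natl K2 mul0r. Qed.

(** Once B^2 has weight 3 it is negligible in degree 2, and C alone survives. *)
Let step1' : F 3 (B * B) ->
  F 3 (lc [:: e x; e y; e x] - C * e (x * y * x)%g).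
Proof.
move=> FBB2; have Fl := step1 step0.
have -> : lc [:: e x; e y; e x] - C * e (x * y * x)%g =
  (lc [:: e x; e y; e x] - (C - B * B) * e (x * y * x)%g) - B * B * e (x * y * x)%g.
  by clearbody B C; nc.
by apply: FB => //; apply: FMr.
Qed.

Lemma lcomm_char2_short : B * B = 0 -> C * e x = e x * C ->
  F 4 (lc [:: e x; e y; e x; e x] - B * C * e (x * y * x * x)%g).
Proof.
move=> BB Cx; have w2 := wordM (wordM word_x word_y) word_x.
apply: (comm_step (step1' (F0 _ BB)) (der_central FCC Cx) w2.1).
by rewrite signK !(addr0, add0r) scale1r BC subrr; apply: wfilt_zero.
Qed.

Section Long.
Hypothesis FBB2 : F 3 (B * B).
Hypothesis DD : D * D = 0.
Hypothesis BD : D * B = B * D.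
Hypothesis Cy : C * e y = e y * C.
Hypothesis Dx : D * e x = e x * D.
Hypothesis Dy : D * e y = e y * D.

(** The successive leading terms are B, C, D + BC, BD, CD, BCD. The terms B^2 C and B^2 D that also
    arise are dropped, since B^2 counts with weight 3. The sixth letter xy, in place of x, makes the
    last scalar odd. *)
Lemma lcomm_char2_long :
  F 7 (lc [:: e x; e y; e x; e x; e y; e (x * y)%g; e x] -
       B * C * D * e (x * y * x * x * y * (x * y) * x)%g).
Proof.
have s2 := step1' FBB2.
clearbody D C B.
have Dxy : D * e (x * y)%g = e (x * y)%g * D by rewrite eM mulrA Dx -mulrA Dy mulrA.
have w2 := wordM (wordM word_x word_y) word_x.
have w3 := wordM w2 word_x; have w4 := wordM w3 word_y.
have w5 := wordM w4 (wordM word_x word_y).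
have dDx := der_central FDD Dx; have dDy := der_central FDD Dy.
have dDxy := der_central FDD Dxy; have dCy := der_central FCC Cy.
have s3 : F 4 (lc [:: e x; e y; e x; e x] - (D + B * C) * e (x * y * x * x)%g).
  apply: (comm_step s2 derCx w2.1).
  by rewrite signK addr0 add0r scale1r BC subrr; apply: wfilt_zero.
have s4 : F 5 (lc [:: e x; e y; e x; e x; e y] - B * D * e (x * y * x * x * y)%g).
  apply: (comm_step s3 (derivesD dDy (derivesM (erefl _) derBy dCy)) w3.2).
  have -> : 1 + 0 + 1 + 1 = 1 + 2%:R :> K by ring.
  rewrite K2 addr0 scale1r mulrDl BD -[B * C * B]mulrA BC !mulrA.
  have -> : 0 + (0 * C + B * 0) + (B * D + B * B * C) - B * D = B * B * C by nc.
  exact: (FP (u := 3) (v := 2)).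
have s5 : F 6 (lc [:: e x; e y; e x; e x; e y; e (x * y)%g] -
    C * D * e (x * y * x * x * y * (x * y))%g).
  apply: (comm_step s4 (derivesM (erefl _) derBxy dDxy) (word_xy w4)).
  have -> : - (0 + 1 + 0 + 0 + 1) + (1 + 0 + 1 + 1 + 0) = 1 :> K by ring.
  rewrite scale1r -[B * D * B]mulrA BD !mulrA.
  have -> : C * D + B * 0 + B * B * D - C * D = B * B * D by nc.
  exact: (FP (u := 3) (v := 3)).
apply: (comm_step s5 (derivesM (erefl _) derCx dDx) w5.1).
have -> : - (0 + 1 + 0 + 0 + 1 + (0 + 1)) = 1 - 2%:R * 2%:R :> K by ring.
rewrite K2 mul0r subr0 scale1r DD -[C * D * B]mulrA BD mulrA BC.
by apply: F0; nc.
Qed.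
End Long.
End Char2.

End Words.
End LeadingTerms.

(** * Nonvanishing elements of the group algebra *)

Section NonVanishing.
Local Open Scope ring_scope.
Variables (K : fieldType) (G : groupType) (R : algType K) (e : G -> R).
Hypothesis e1 : e 1%g = 1.
Hypothesis eM : forall x y, e (x * y)%g = e x * e y.
Hypothesis elin : forall (s : seq G) (c : G -> K), uniq s ->
  \sum_(g <- s) c g *: e g = 0 -> forall g, g \in s -> c g = 0.

Definition esum (s : seq G) : R := \sum_(g <- s) e g.

Lemma esum_neq0 s : uniq s -> s != [::] -> esum s <> 0.
Proof.
case: s => [//|g s] Us _ S0.
have H := @elin (g :: s) (fun=> 1) Us (etrans (eq_bigr _ (fun _ _ => scale1r _)) S0) g.
by have /eqP := H (mem_head _ _); rewrite oner_eq0.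
Qed.

Lemma esumM s t : esum s * esum t = esum [seq (g * h)%g | g <- s, h <- t].
Proof.
rewrite /esum big_allpairs_dep mulr_suml; apply: eq_bigr => g _.
by rewrite mulr_sumr; apply: eq_bigr => h _; rewrite eM.
Qed.

Lemma mul_e_eq0 a g : a * e g = 0 -> a = 0.
Proof.
by move=> /(congr1 (fun z => z * e g^-1%g)); rewrite -mulrA emV // mulr1 mul0r.
Qed.

(* In characteristic [p], [X ^ q - 1 = (X - 1) ^ q] for [q] a power of [p];
   divide by [X - 1] in the polynomial ring. *)
Lemma sub1_expr_pred p k (a : R) : p \in [pchar K] ->
  (a - 1) ^+ (p ^ k).-1 = \sum_(i < p ^ k) a ^+ i.
Proof.
move=> pK; set q := (p ^ k)%N.
have q_gt0 : (0 < q)%N by rewrite expn_gt0 prime_gt0 // (pcharf_prime pK).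
have P : ('X - 1) ^+ q.-1 = \sum_(i < q) 'X^i :> {poly K}.
  have X1 : 'X - 1 != 0 :> {poly K} by rewrite -polyC1 polyXsubC_eq0.
  apply: (mulfI X1).
  rewrite -exprS prednK // -subrX1.
  have pP : p \in [pchar {poly K}] by rewrite pchar_poly.
  by rewrite /q; elim: (k) => [|k' IH] //; rewrite expnSr !exprM IH -!(pFrobenius_autE pP) rmorphB rmorph1.
have := congr1 (horner_alg a) P.
rewrite rmorphXn rmorphB /= horner_algX rmorph1 => ->.
by rewrite rmorph_sum; apply: eq_bigr => i _; rewrite rmorphXn /= horner_algX.
Qed.

Lemma esub1_expr_pred p k b : p \in [pchar K] ->
  (e b - 1) ^+ (p ^ k).-1 = esum [seq (b ^+ i)%g | i <- iota 0 (p ^ k)].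
Proof.
move=> pK; rewrite (sub1_expr_pred k (e b) pK) /esum big_map.
rewrite -[in RHS](subn0 (p ^ k)%N) -/(index_iota 0 _) big_mkord.
by apply: eq_bigr => i _; rewrite eX.
Qed.

(** In characteristic p, (b - 1)^(p - 1) is the sum of the first p powers of b; the product is
    therefore a sum of distinct group elements. *)
Lemma sub1_mul2_neq0 p b c g : p \in [pchar K] ->
  uniq [seq (h * l)%g | h <- [seq (b ^+ i)%g | i <- iota 0 p],
                        l <- [seq (c ^+ i)%g | i <- iota 0 p]] ->
  (e b - 1) ^+ p.-1 * (e c - 1) ^+ p.-1 * e g <> 0.
Proof.
move=> pK Us /mul_e_eq0; rewrite -(expn1 p) !esub1_expr_pred // esumM expn1.
apply: esum_neq0 => //; rewrite -size_eq0 size_allpairs !size_map size_iota.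
by rewrite muln_eq0 orbb -lt0n prime_gt0 // (pcharf_prime pK).
Qed.

Lemma sub1_mul3_neq0 p b c d g : p \in [pchar K] ->
  uniq [seq (h * l)%g | h <- [seq (h * l)%g | h <- [seq (b ^+ i)%g | i <- iota 0 p],
                                              l <- [seq (c ^+ i)%g | i <- iota 0 p]],
                        l <- [seq (d ^+ i)%g | i <- iota 0 p]] ->
  (e b - 1) ^+ p.-1 * (e c - 1) ^+ p.-1 * (e d - 1) ^+ p.-1 * e g <> 0.
Proof.
move=> pK Us /mul_e_eq0; rewrite -(expn1 p) !esub1_expr_pred // !esumM expn1.
apply: esum_neq0 => //; rewrite -size_eq0 !size_allpairs !size_map size_iota.
by rewrite !muln_eq0 !orbb -lt0n prime_gt0 // (pcharf_prime pK).
Qed.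

Lemma sub1_expr_neq0 p k b g : p \in [pchar K] ->
  uniq [seq (b ^+ i)%g | i <- iota 0 (p ^ k)] ->
  (e b - 1) ^+ (p ^ k).-1 * e g <> 0.
Proof.
move=> pK Us /mul_e_eq0; rewrite esub1_expr_pred //.
apply: esum_neq0 => //; rewrite -size_eq0 size_map size_iota.
by rewrite -lt0n expn_gt0 prime_gt0 // (pcharf_prime pK).
Qed.

(** With u = [x, y] central, [x, y] is yx (u - 1) in R, and z moves only the factor yx; the word
    equals (v - 1)(u - 1) z y x with v = [yx, z]. *)
Lemma lcomm_class2_neq0 x y z :
  2%N \in [pchar K] ->
  (forall g, commute [~ x, y]%g g) -> (forall g, commute [~ y * x, z]%g g) ->
  uniq [:: 1; [~ x, y]; [~ y * x, z]; [~ y * x, z] * [~ x, y]]%g ->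
  lcomm (nth 0 [:: e x; e y; e z]) 2 <> 0.
Proof.
move=> pK cu cv Us /=; set u := [~ x, y]%g in cu Us *; set w := (y * x)%g in cv Us *.
set v := [~ w, z]%g in cv Us *.
have cue g : e u * e g = e g * e u by rewrite -!eM cu.
have -> : (e x * e y - e y * e x) * e z - e z * (e x * e y - e y * e x) =
  (e v - 1) * (e u - 1) * e (z * (y * x))%g.
  rewrite eR // -/u -/w mulrBr mulr1.
  have cve g : e v * e g = e g * e v by rewrite -!eM cv.
  have -> : (e w * e u - e w) * e z - e z * (e w * e u - e w)
    = (e w * e z - e z * e w) * (e u - 1) + e w * (e u * e z - e z * e u) by nc.
  have uw : (e u - 1) * e (z * w)%g = e (z * w)%g * (e u - 1).
    by rewrite mulrBl mulrBr cue mul1r mulr1.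
  have vw : (e v - 1) * e (z * w)%g = e (z * w)%g * (e v - 1).
    by rewrite mulrBl mulrBr cve mul1r mulr1.
  by rewrite cue subrr mulr0 addr0 eR // -/v -[RHS]mulrA uw mulrA vw.
rewrite -[e v - 1]expr1 -[e u - 1]expr1.
by apply: (@sub1_mul2_neq0 2) => //=; rewrite !expg0 !expg1 !mul1g !mulg1.
Qed.

(** * Engel words when the commutator subgroup is cyclic *)

Section CyclicDerived.
Hypothesis espan : forall r : R, exists (s : seq G) (c : G -> K),
  r = \sum_(g <- s) c g *: e g.
Variables (p k q : nat) (x y : G).
Let c := [~ x, y]%g.
Hypothesis pcharK : p \in [pchar K].
Hypothesis q_char : exists a, q = (p ^ a)%N.
Hypothesis q_gt2 : (2 < q)%N.
Hypothesis cyc : forall g h, exists j, [~ g, h]%g = (c ^+ j)%g.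
Hypothesis cp : forall g, exists j, [~ c, g]%g = (c ^+ (p * j))%g.
Hypothesis cy : exists j, [~ c, y]%g = (c ^+ (q * j))%g.
Hypothesis c_order : (c ^+ (p ^ k))%g = 1%g.
Hypothesis c_uniq : uniq [seq (c ^+ i)%g | i <- iota 0 (p ^ k)].

Let cpow g : exists j, (c ^ g)%g = (c ^+ j)%g.
Proof.
have [j cg] := cp g; exists (p * j).+1.
by rewrite expgS -cg commgEl mulgA mulgV mul1g.
Qed.

Let C := e c - 1.
(** The powers of c are permuted by conjugation, so each C^m R is a two-sided ideal; this chain
    takes the place of the weight filtration. *)
Let E m (a : R) := exists r, a = C ^+ m * r.

Let Cpow a : (e c - 1) ^+ (p ^ a) = e (c ^+ (p ^ a))%g - 1.
Proof.
elim: a => [|a IH]; first by rewrite expr1.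
by rewrite expnSr exprM IH esub1_expr_pchar // expgnA.
Qed.

Let CX j : exists r, e (c ^+ j)%g - 1 = C * r.
Proof. by exists (\sum_(i < j) e c ^+ i); rewrite eX // subrX1. Qed.

Let CXp a j : E (p ^ a) (e (c ^+ (p ^ a * j))%g - 1).
Proof.
exists (\sum_(i < j) e (c ^+ (p ^ a))%g ^+ i).
by rewrite Cpow -subrX1 -eX // -expgnA.
Qed.

Let E0 m : E m 0. Proof. by exists 0; rewrite mulr0. Qed.
Let ED m a b : E m a -> E m b -> E m (a + b).
Proof. by move=> [r ->] [s ->]; exists (r + s); rewrite mulrDr. Qed.
Let EMr m a r : E m a -> E m (a * r).
Proof. by move=> [s ->]; exists (s * r); rewrite mulrA. Qed.
Let EB m a b : E m a -> E m b -> E m (a - b).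
Proof. by move=> Ea Eb; apply: ED => //; rewrite -mulrN1; apply: EMr. Qed.
Let EZ m (u : K) a : E m a -> E m (u *: a).
Proof. by move=> Ea; rewrite -[a]mulr1 scalerAr; apply: EMr. Qed.

Let EMl1 r : E 1 (r * C).
Proof.
elim/(group_algebra_ind espan): r => [|a b Ea Eb|u g].
- by rewrite mul0r.
- by rewrite mulrDl; apply: ED.
rewrite -scalerAl; apply: EZ; have [j cj] := cpow g^-1%g; have [r rj] := CX j.
exists (r * e g); rewrite expr1 mulrA -rj -cj.
by rewrite /C mulrBr mulr1 mulrBl mul1r -!eM -conjgCV.
Qed.

Let EMl m r a : E m a -> E m (r * a).
Proof.
move=> [s ->]; rewrite mulrA; apply: EMr; elim: m r => [|m IH] r; first by exists r; rewrite mul1r mulr1.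
have [t tE] := EMl1 r; rewrite exprS mulrA tE expr1 -mulrA; have [t' ->] := IH t.
by exists t'; rewrite mulrA -exprS.
Qed.

Let EM m n a b : E m a -> E n b -> E (m + n) (a * b).
Proof.
move=> [r ->] Eb; have [s sE] := EMl r Eb.
by exists s; rewrite -mulrA sE mulrA -exprD.
Qed.

Let Ele m n a : (m <= n)%N -> E n a -> E m a.
Proof. by move=> le [r ->]; exists (C ^+ (n - m) * r); rewrite mulrA -exprD subnKC. Qed.

Let EC : E 1 C. Proof. by exists 1; rewrite mulr1. Qed.

Let Ecomm1 a r : E 1 (a * r - r * a).
Proof.
elim/(group_algebra_ind espan): a => [|a b Ea Eb|u g].
- by rewrite mulr0 mul0r subrr.
- have -> : (a + b) * r - r * (a + b) = (a * r - r * a) + (b * r - r * b) by nc.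
  exact: ED.
rewrite -scalerAl -scalerAr -scalerBr; apply: EZ.
elim/(group_algebra_ind espan): r => [|a b Ea Eb|v h].
- by rewrite mulr0 mul0r subrr.
- have -> : e g * (a + b) - (a + b) * e g = (e g * a - a * e g) + (e g * b - b * e g) by nc.
  exact: ED.
rewrite -scalerAl -scalerAr -scalerBr; apply: EZ.
rewrite eR //; have [j ->] := cyc g h; have [s ->] := CX j.
by apply/EMl/EMr.
Qed.

Let p_gt1 : (1 < p)%N. Proof. exact: prime_gt1 (pcharf_prime pcharK). Qed.

Let Ccomm (n a : nat) g : (n <= p ^ a)%N -> (exists j, [~ c, g]%g = (c ^+ (p ^ a * j))%g) ->
  E n (C * e g - e g * C).
Proof.
move=> le_n [j cg]; have -> : C * e g - e g * C = e c * e g - e g * e c by rewrite /C; nc.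
by rewrite eR // cg; apply: EMl; apply: Ele le_n _.
Qed.

Let EcommC r : E 2 (C * r - r * C).
Proof.
elim/(group_algebra_ind espan): r => [|a b Ea Eb|u g].
- by rewrite mulr0 mul0r subrr.
- have -> : C * (a + b) - (a + b) * C = (C * a - a * C) + (C * b - b * C) by nc.
  exact: ED.
rewrite -scalerAl -scalerAr -scalerBr; apply: EZ.
by apply: (@Ccomm 2 1) => //; rewrite expn1.
Qed.

Let EcommCX s n r : (0 < n)%N -> E n.+1 (C * r - r * C) -> E (s + n) (C ^+ s * r - r * C ^+ s).
Proof.
move=> n_gt0 Ecr; elim: s => [|s IH]; first by rewrite mul1r mulr1 subrr.
have -> : C ^+ s.+1 = C * C ^+ s by exact: exprS.
have -> : C * C ^+ s * r - r * (C * C ^+ s) =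
  C * (C ^+ s * r - r * C ^+ s) + (C * r - r * C) * C ^+ s by nc.
apply: ED; first by rewrite addSn -add1n; apply: EM.
by rewrite addSnnS addnC; apply: EM => //; exists 1; rewrite mulr1.
Qed.

Let Ecomm m a r : E m a -> E m.+1 (a * r - r * a).
Proof.
move=> [s ->].
have -> : C ^+ m * s * r - r * (C ^+ m * s) =
  C ^+ m * (s * r - r * s) + (C ^+ m * r - r * C ^+ m) * s by nc.
have ECm : E m (C ^+ m) by exists 1; rewrite mulr1.
apply: ED; first by rewrite -addn1; apply: EM.
by apply: EMr; rewrite -addn1; apply: EcommCX.
Qed.

(** Each further y multiplies the leading term by C, provided that commuting C^m with y costs two
    powers of C. This holds because y commutes with C modulo C^3, which is the purpose of q > 2. *)
Let engel m : E m.+1 (lcomm (fun i => if i is 0%N then e x else e y) m -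
  C ^+ m * e (x * y ^+ m)%g).
Proof.
elim: m => [|m IH]; first by rewrite /= expg0 mulg1 mul1r subrr.
set a := lcomm _ m in IH; rewrite /= -/a; set g := (x * y ^+ m)%g in IH *.
have -> : (x * y ^+ m.+1)%g = (g * y)%g by rewrite expgSr mulgA.
have ECm : E m (C ^+ m) by exists 1; rewrite mulr1.
have -> : C ^+ m.+1 = C ^+ m * C by exact: exprSr.
have -> : a * e y - e y * a - C ^+ m * C * e (g * y)%g =
  ((a - C ^+ m * e g) * e y - e y * (a - C ^+ m * e g)) +
  C ^+ m * (e g * e y - e y * e g - C * e (g * y)%g) +
  (C ^+ m * e y - e y * C ^+ m) * e g by nc.
apply: ED; last first.
  apply: EMr; rewrite -addn2; apply: EcommCX => //.
  have [b qE] := q_char; apply: (@Ccomm _ b); first by rewrite -qE.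
  by rewrite -qE.
apply: ED; first exact: Ecomm.
rewrite -addn2; apply: EM => //.
have -> : e g * e y - e y * e g = e (y * x)%g * C * e (y ^+ m)%g.
  have yX : e (y ^+ m)%g * e y = e y * e (y ^+ m)%g by rewrite -!eM -expgS -expgSr.
  have -> : e (y * x)%g * C = e x * e y - e y * e x by rewrite eR.
  by rewrite /g eM -mulrA yX; nc.
have -> : e (g * y)%g = e (x * y)%g * e (y ^+ m)%g.
  by rewrite -eM /g -!mulgA -expgS -expgSr.
rewrite mulrA -mulrBl; apply: EMr.
have -> : e (y * x)%g * C - C * e (x * y)%g =
  - (C * e (y * x)%g - e (y * x)%g * C) - C * (e x * e y - e y * e x) by rewrite !eM; nc.
apply: EB; last exact: EM (EC) (Ecomm1 _ _).
by rewrite -[- _]mulN1r; apply: EMl.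
Qed.

(** As c^(p^k) = 1 kills C^(p^k), the congruence for m = p^k - 1 is an equality, and C^m is the sum
    of the distinct powers of c. *)
Lemma lcomm_cyclic_neq0 :
  lcomm (fun i => if i is 0%N then e x else e y) (p ^ k).-1 <> 0.
Proof.
move=> Z; have [r] := engel (p ^ k).-1; rewrite Z sub0r => /eqP.
rewrite prednK ?expn_gt0 ?(ltnW p_gt1) // /C Cpow c_order e1 subrr mul0r oppr_eq0 => /eqP.
exact: sub1_expr_neq0.
Qed.
End CyclicDerived.
End NonVanishing.

(** * The lower central series and the commutator subgroup *)

Section LowerCentralSeries.
Local Open Scope group_scope.
Variable G : groupType.

Section Subgroup.
Variable H : G -> Prop.
Hypothesis sH : is_subgroup H.
Lemma subgroup1 : H 1. Proof. by case: sH. Qed.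
Lemma subgroupV x : H x -> H x^-1.
Proof. by case: sH => H1 HF Hx; rewrite -[x^-1]mul1g; apply: HF. Qed.
Lemma subgroupM x y : H x -> H y -> H (x * y).
Proof. by move=> Hx /subgroupV Hy; rewrite -[y]invgK; case: sH => _; apply. Qed.
Lemma subgroupX x n : H x -> H (x ^+ n).
Proof.
move=> Hx; elim: n => [|n IH]; first by rewrite expg0; apply: subgroup1.
by rewrite expgS; apply: subgroupM.
Qed.
End Subgroup.

Lemma gen_subgroup_sub (S H : G -> Prop) x :
  is_subgroup H -> (forall y, S y -> H y) -> gen_subgroup S x -> H x.
Proof. by move=> sH SH; apply. Qed.

Lemma gen_subgroup_is_subgroup (S : G -> Prop) : is_subgroup (gen_subgroup S).
Proof.
split=> [H [] //|x y Sx Sy H sH SH].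
by case: (sH) => _; apply; [apply: Sx|apply: Sy].
Qed.

Lemma lcs_subgroup n : is_subgroup (lcs G n).
Proof. by case: n => [|n]; [split|apply: gen_subgroup_is_subgroup]. Qed.

Lemma lcs_comm n x g : lcs G n x -> lcs G n.+1 [~ x, g].
Proof. by move=> nx H _; apply; exists x, g. Qed.

Lemma lcs_conj n x g : lcs G n x -> lcs G n (x ^ g).
Proof.
case: n => [//|n] nx H sH SH.
have: gen_subgroup (fun z => exists a b, lcs G n a /\ True /\ z = [~ a, b]) x by [].
move/(_ (fun x => H (x ^ g))); apply=> [|_ [a [b [na [_ ->]]]]].
  split; first by rewrite conj1g; apply: subgroup1 sH.
  by move=> y z Hy Hz; rewrite conjMg conjVg; case: sH => _ HF; exact: HF.
have -> : [~ a, b] ^ g = [~ a, g]^-1 * [~ a, b * g].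
  by rewrite !commgEl conjMg conjVg conjgM [(a^-1 * _)^-1]invgM invgK -[RHS]mulgA mulVKg.
apply: subgroupM => //; last by apply: SH; exists a, (b * g).
by apply: subgroupV => //; apply: SH; exists a, g.
Qed.

Lemma lcs_sub n x : lcs G n.+1 x -> lcs G n x.
Proof.
apply: gen_subgroup_sub; first exact: lcs_subgroup.
move=> _ [a [b [na [_ ->]]]]; rewrite commgEl; apply: (subgroupM (lcs_subgroup n)).
  exact: (subgroupV (lcs_subgroup n)).
exact: lcs_conj.
Qed.

Lemma lcs_mono m n x : m <= n -> lcs G n x -> lcs G m x.
Proof. by move/subnK <-; elim: (n - m) => [//|k IH] /lcs_sub. Qed.

Lemma lcs_min n (H : G -> Prop) : is_subgroup H ->
  (forall x g, lcs G n x -> H [~ x, g]) -> forall x, lcs G n.+1 x -> H x.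
Proof.
move=> sH SH x; apply: gen_subgroup_sub => // _ [a [b [na [_ ->]]]]; exact: SH.
Qed.

Lemma commgMr (x g h : G) : [~ x, g * h] = [~ x, h] * [~ x, g] ^ h.
Proof. by rewrite !commgEl conjMg conjVg conjgM -mulgA mulVKg. Qed.

Lemma commgMl (x y g : G) : [~ x * y, g] = [~ x, g] ^ y * [~ y, g].
Proof. by rewrite !commgEl conjMg invgM !conjgE -!mulgA !mulVKg. Qed.

Section Exponent.
Variable q : nat.
Hypothesis central_q : forall x y : G, commute x (y ^+ q).

Lemma lcs_commX n w y k : lcs G n w ->
  exists2 v, lcs G n.+2 v & [~ w, y ^+ k] = [~ w, y] ^+ k * v.
Proof.
have sW := lcs_subgroup n.+2.
move=> nw; set u := [~ w, y]; have nu : lcs G n.+1 u by apply: lcs_comm.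
have uX j : exists2 v, lcs G n.+2 v & (u ^ y) ^+ j = u ^+ j * v.
  elim: j => [|j [v nv uj]]; first by exists 1; [exact: (subgroup1 sW)|rewrite !expg0 mulg1].
  exists ([~ u, y] * v ^ (u ^ y)).
    by apply: (subgroupM sW); [apply: lcs_comm|apply: lcs_conj].
  have uy : u ^ y = u * [~ u, y] by rewrite commgEl mulgA mulgV mul1g.
  by rewrite expgSr uj -mulgA [v * _]conjgC {1}uy expgSr -!mulgA.
elim: k => [|k [v nv IH]].
  by exists 1; [exact: (subgroup1 sW)|rewrite !expg0 mulg1 commg1].
have [v' nv' uk] := uX k.
exists (v' * v ^ y); first by apply: (subgroupM sW) => //; apply: lcs_conj.
by rewrite [y ^+ _]expgSr commgMr IH conjMg conjXg -/u uk expgS -!mulgA.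
Qed.

(** Modulo the next term, the q-th power is multiplicative and sends a generator [w, g] to [w, g^q]
    = 1. *)
Lemma lcs_expg n x : lcs G n.+1 x -> lcs G n.+2 (x ^+ q).
Proof.
have sW := lcs_subgroup n.+2; have sV := lcs_subgroup n.+1.
pose H x := lcs G n.+1 x /\ lcs G n.+2 (x ^+ q).
suff: forall x, lcs G n.+1 x -> H x by move=> HH /HH [].
have MX y z k : lcs G n.+1 y -> lcs G n.+1 z ->
    exists2 v, lcs G n.+2 v & (y * z) ^+ k = y ^+ k * z ^+ k * v.
  move=> ny nz; elim: k => [|k [v nv IH]].
    by exists 1; [exact: (subgroup1 sW)|rewrite !expg0 !mulg1].
  set t := [~ z ^+ k, y] * v ^ y.
  exists (t ^ z).
    apply: lcs_conj; apply: (subgroupM sW); last exact: lcs_conj.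
    by apply: lcs_comm; apply: (subgroupX sV).
  rewrite expgSr IH [y ^+ k.+1]expgSr [z ^+ k.+1]expgSr -!mulgA.
  rewrite -[in RHS]conjgC; congr (_ * _); rewrite [v * _]mulgA [v * y]conjgC.
  by rewrite /t -!mulgA !mulVKg.
apply: lcs_min.
  split; first by split; [exact: (subgroup1 sV)|rewrite expg1n; exact: (subgroup1 sW)].
  move=> y z [ny nyq] [nz nzq]; have nz' := subgroupV sV nz.
  split; first exact: (subgroupM sV).
  have [v nv ->] := MX _ _ q ny nz'; rewrite expVgn.
  by apply: (subgroupM sW) => //; apply: (subgroupM sW) => //; apply: (subgroupV sW).
move=> w g nw; split; first exact: lcs_comm.
have [v nv] := lcs_commX g q nw.
have /eqP -> : [~ w, g ^+ q] == 1 by apply/commgP.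
by move/eqP; rewrite eq_sym mulg_eq1 => /eqP ->; apply: (subgroupV sW).
Qed.

Lemma lcs1_exponent c x : trivial_sub (lcs G c.+1) -> lcs G 1 x -> x ^+ (q ^ c) = 1.
Proof.
move=> cT x1; apply: cT; elim: c => [|c IH]; first by rewrite expg1.
by rewrite expnSr expgnA; apply: lcs_expg.
Qed.

End Exponent.
End LowerCentralSeries.

(** * A finite group isomorphic to the commutator subgroup *)

Section FiniteDerived.
Local Open Scope group_scope.
Variables (G : groupType) (s : seq G).

(** Taking [Hs] as an argument ties the type to the proof from which its group law is built. *)
Definition derived_fin (Hs : forall x, gamma G 2 x <-> x \in s) := seq_sub s.

Variable Hs : forall x, gamma G 2 x <-> x \in s.
Local Notation T := (derived_fin Hs).

HB.instance Definition _ := Finite.on T.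

Let mem1 : 1 \in s. Proof. by apply/Hs; apply: subgroup1 (lcs_subgroup _ 1). Qed.
Let memM (x y : T) : ssval x * ssval y \in s.
Proof. by apply/Hs; apply: (subgroupM (lcs_subgroup G 1)); apply/Hs; apply: ssvalP. Qed.
Let memV (x : T) : (ssval x)^-1 \in s.
Proof. by apply/Hs; apply: (subgroupV (lcs_subgroup G 1)); apply/Hs; apply: ssvalP. Qed.

Definition derived_one : T := SeqSub mem1.
Definition derived_mul (x y : T) : T := SeqSub (memM x y).
Definition derived_inv (x : T) : T := SeqSub (memV x).

Fact derived_mulA : associative derived_mul.
Proof. by move=> x y z; apply: val_inj; apply: mulgA. Qed.
Fact derived_mul1 : left_id derived_one derived_mul.
Proof. by move=> x; apply: val_inj; apply: mul1g. Qed.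
Fact derived_mulV : left_inverse derived_one derived_inv derived_mul.
Proof. by move=> x; apply: val_inj; apply: mulVg. Qed.

HB.instance Definition _ := Finite_isGroup.Build T derived_mulA derived_mul1 derived_mulV.

End FiniteDerived.

Lemma finite_derived_model (G : groupType) n : has_order (gamma G 2) n ->
  exists (gT : finGroupType) (i : gT -> G),
  [/\ {morph i : x y / (x * y)%g}, injective i,
      forall x, gamma G 2 x <-> exists a, x = i a & #|[set: gT]| = n].
Proof.
case=> s [Us sz Hs]; exists (derived_fin Hs), (fun x => ssval x); split.
- by [].
- exact: val_inj.
- move=> x; split=> [/Hs sx|[[y sy] ->]]; first by exists (SeqSub sx).
  by apply/Hs.
- by rewrite cardsT card_seq_sub.
Qed.

(* The derived subgroup is handled through a finite group [gT] and an injective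
   morphism [i] onto it; [cj g] and [kg _ g] transport to [gT] the conjugation
   by [g] and the commutator with [g]. *)
Section Model.
Local Open Scope group_scope.
Variables (G : groupType) (gT : finGroupType) (i : gT -> G).
Hypothesis iM : {morph i : x y / x * y}.
Hypothesis i_inj : injective i.
Hypothesis i_im : forall x, gamma G 2 x <-> exists a, x = i a.

Lemma i1 : i 1 = 1.
Proof. by apply: (mulgI (i 1)); rewrite -iM !mulg1. Qed.
Lemma iV a : i a^-1 = (i a)^-1.
Proof. by apply: (mulgI (i a)); rewrite -iM !mulgV i1. Qed.
Lemma iX a n : i (a ^+ n) = i a ^+ n.
Proof. by elim: n => [|n IH]; rewrite ?expg0 ?i1 // !expgS iM IH. Qed.

(** The preimage is found by search; the default 1 is never reached, because the commutator subgroup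
    is normal. *)
Definition cj (g : G) (a : gT) : gT := odflt 1 [pick b | i b == i a ^ g].

Lemma cjE g a : i (cj g a) = i a ^ g.
Proof.
rewrite /cj; case: pickP => [b /eqP //|none].
have /i_im[b ib] : gamma G 2 (i a ^ g).
  by apply: (@lcs_conj _ 1); apply/i_im; exists a.
by have := none b; rewrite ib eqxx.
Qed.

Lemma cjM g : {morph cj g : a b / a * b}.
Proof. by move=> a b; apply: i_inj; rewrite iM !cjE iM conjMg. Qed.
Lemma cj_inj g : injective (cj g).
Proof. by move=> a b /(congr1 i); rewrite !cjE => /conjg_inj /i_inj. Qed.
Lemma cj_mul g h a : cj (g * h) a = cj h (cj g a).
Proof. by apply: i_inj; rewrite !cjE conjgM. Qed.
Lemma cj_i b a : cj (i b) a = a ^ b.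
Proof. by apply: i_inj; rewrite cjE /conjg !iM iV. Qed.
Lemma cj1 a : cj 1 a = a.
Proof. by apply: i_inj; rewrite cjE conjg1. Qed.
Lemma cjX g n a : cj g (a ^+ n) = cj g a ^+ n.
Proof. by apply: i_inj; rewrite cjE !iX cjE conjXg. Qed.

Definition kg (a : gT) (g : G) : gT := a^-1 * cj g a.

Lemma kgEcj a g : kg a g = a^-1 * cj g a. Proof. by []. Qed.
Lemma kgE a g : i (kg a g) = [~ i a, g].
Proof. by rewrite /kg iM iV cjE. Qed.
Lemma kg_i a b : kg a (i b) = [~ a, b]. Proof. by rewrite /kg cj_i. Qed.
Lemma cj_kg g a : cj g a = a * kg a g. Proof. by rewrite mulKVg. Qed.
Lemma kgMl a b g : kg (a * b) g = kg a g ^ b * kg b g.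
Proof. by rewrite /kg cjM invMg conjgE !mulgA mulgK. Qed.
Lemma kgMr a g h : kg a (g * h) = kg a h * cj h (kg a g).
Proof. by apply: i_inj; rewrite iM cjE !kgE commgMr. Qed.

Definition iG (M : {set gT}) : G -> Prop := fun x => exists2 a, a \in M & x = i a.
Definition Ginv (M : {set gT}) := forall a g, a \in M -> cj g a \in M.
Definition cent_over (M N : {set gT}) := forall a g, a \in M -> kg a g \in N.

Lemma inv_norm (M : {group gT}) : Ginv M -> M <| [set: gT].
Proof.
move=> iMv; apply/andP; split; first exact: subsetT.
apply/subsetP => b _; rewrite inE; apply/subsetP => _ /imsetP[a Ma ->].
by rewrite -cj_i; apply: iMv.
Qed.

Lemma cent_over_inv (M N : {group gT}) : N \subset M -> cent_over M N -> Ginv M.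
Proof.
move=> sNM cMN a g Ma; rewrite cj_kg groupM //.
by apply: (subsetP sNM); apply: cMN.
Qed.

Section Nilpotent.
Variables (p q : nat).
Hypothesis p_pr : prime p.
Hypothesis qE : exists a, q = (p ^ a)%N.
Hypothesis central_q : forall x y : G, commute x (y ^+ q).

(** The permutations of [gT] induced by G form a finite group even if G is infinite. Its exponent
    divides q, so it is a p-group and fixed points can be counted modulo p. *)
Let phi (g : G) : {perm gT} := perm (@cj_inj g).
Let Gam := [set t : {perm gT} | `[< exists g, t = phi g >]].

Let phiM g h : phi (g * h) = phi g * phi h.
Proof. by apply/permP => a; rewrite permM !permE cj_mul. Qed.

Let Gam_group : group_set Gam.
Proof.
apply/group_setP; split.
  by rewrite inE; apply/asboolP; exists 1; apply/permP => a; rewrite perm1 permE cj1.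
move=> t u; rewrite !inE => /asboolP[g ->] /asboolP[h ->].
by apply/asboolP; exists (g * h).
Qed.
Let GamG := Group Gam_group.

Let phi_Gam g : phi g \in GamG.
Proof. by rewrite inE; apply/asboolP; exists g. Qed.

Lemma pgroup_exp (aT : finGroupType) (A : {group aT}) :
  (forall x, x \in A -> x ^+ q = 1) -> p.-group A.
Proof.
move=> Aq; apply/pgroupP => r r_pr r_dv.
have [x Ax ox] := Cauchy r_pr r_dv.
have [a qa] := qE.
have : r %| q by rewrite -ox order_dvdn Aq.
by rewrite qa Euclid_dvdX // dvdn_prime2 // => /andP[].
Qed.

Let pGam : p.-group GamG.
Proof.
apply: pgroup_exp => t; rewrite inE => /asboolP[g ->].
have phiX n : phi g ^+ n = phi (g ^+ n).
  elim: n => [|n IH]; last by rewrite !expgS phiM IH.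
  by rewrite !expg0; apply/permP => a; rewrite perm1 permE cj1.
rewrite phiX; apply/permP => a; rewrite perm1 permE; apply: i_inj; rewrite cjE.
by apply/conjg_fixP/commgP/central_q.
Qed.

(** The number of cosets of N in M fixed by the p-group is divisible by p, like the index, and N
    itself is fixed; so another coset N z is fixed too. *)
Lemma fixed_coset (M N : {group gT}) : Ginv M -> Ginv N -> N \proper M ->
  p.-nat #|M : N| -> exists2 z, z \in M :\: N & forall g, kg z g \in N.
Proof.
move=> invM invN pNM pidx; have [sNM _] := andP pNM.
have phiR g z : phi g @: (N :* z) = N :* cj g z.
  have phN : phi g @: N = N.
    apply/eqP; rewrite eqEcard card_imset; last exact: perm_inj.
    rewrite leqnn andbT; apply/subsetP => _ /imsetP[a Na ->].
    by rewrite permE; apply: invN.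
  apply/setP => b; apply/imsetP/rcosetP.
    move=> [_ /rcosetP[n Nn ->] ->]; exists (cj g n); first exact: invN.
    by rewrite permE cjM.
  move=> [n]; rewrite -{1}phN => /imsetP[m Nm ->] ->.
  by exists (m * z); rewrite ?mem_rcoset ?mulgK // !permE cjM.
have actS : [acts GamG, on rcosets N M | 'P^*].
  apply/subsetP => t Gt; rewrite !inE; apply/subsetP => A /rcosetsP[z Mz ->].
  move: Gt; rewrite !inE => /asboolP[g ->]; rewrite /= /setact.
  have -> : [set 'P%act x (phi g) | x in N :* z] = phi g @: (N :* z) by [].
  by rewrite phiR; apply/rcosetsP; exists (cj g z) => //; apply: invM.
have := pgroup_fix_mod pGam actS; rewrite -/(indexg _ _).
set F := 'Fix_(_ | _)(_) => Fmod.
have FN : (N : {set gT}) \in F.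
  rewrite inE; apply/andP; split; first by apply/rcosetsP; exists 1; rewrite ?group1 // mulg1.
  apply/afixP => t; rewrite inE => /asboolP[g ->] /=.
  have := phiR g 1; rewrite mulg1 => E.
  rewrite /setact; have -> : [set 'P%act x (phi g) | x in N] = phi g @: N by [].
  rewrite E; apply: rcoset_id; rewrite -[cj g 1]/(cj g 1); apply: invN; exact: group1.
have idx1 : 1 < #|M : N| by rewrite indexg_gt1; case/andP: pNM.
have pF : p %| #|F|.
  rewrite /dvdn -Fmod; have := pi_of_exp; move: pidx idx1; case/p_natP=> // [[|n]] -> //.
  by rewrite expnS modnMr.
have F1 : 1 < #|F|.
  have F0 : 0 < #|F| by apply/card_gt0P; exists (N : {set gT}).
  exact: leq_trans (prime_gt1 p_pr) (dvdn_leq F0 pF).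
have [A FA AN] : exists2 A, A \in F & A != N.
  move: F1; rewrite (cardD1 (N : {set gT})) FN add1n ltnS => /card_gt0P[A].
  by rewrite !inE => /andP[AN FA]; exists A; rewrite ?inE.
move: FA; rewrite inE => /andP[/rcosetsP[z Mz AE] /afixP Afix].
exists z.
  rewrite inE Mz andbT; apply: contra AN => Nz; rewrite AE; apply/eqP; exact: rcoset_id.
move=> g; have := Afix _ (phi_Gam g); rewrite AE /= /setact.
have -> : [set 'P%act x (phi g) | x in N :* z] = phi g @: (N :* z) by [].
rewrite phiR => E.
have : cj g z \in N :* z by rewrite -E rcoset_refl.
rewrite mem_rcoset /kg => Nz.
have -> : z^-1 * cj g z = (cj g z * z^-1) ^ z by rewrite conjgE -mulgA mulVg mulg1.
rewrite -(cj_i z); exact: invN.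
Qed.

Lemma pnat_index (M N : {group gT}) : N <| M -> (forall a, a \in M -> a ^+ q \in N) ->
  p.-nat #|M : N|.
Proof.
move=> nNM Mq; rewrite -card_quotient ?normal_norm //; apply: pgroup_exp => x.
case/morphimP => a Na Ma ->; rewrite -morphX //; apply: coset_id; exact: Mq.
Qed.

(* The upper central series of [G], intersected with the derived subgroup. *)
Fixpoint ucs (n : nat) : {set gT} :=
  if n is n'.+1 then [set a | `[< forall g, kg a g \in ucs n' >]] else 1.

Let ucsP n a : reflect (forall g, kg a g \in ucs n) (a \in ucs n.+1).
Proof. by rewrite inE; apply: asboolP. Qed.

Let kg1 g : kg 1 g = 1.
Proof. by apply: i_inj; rewrite kgE i1 comm1g. Qed.

Let ucs_group n : group_set (ucs n) /\ Ginv (ucs n).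
Proof.
elim: n => [|n [Gn In]].
  split; first exact: group_set_one.
  move=> a g /set1P ->; rewrite inE; apply/eqP/i_inj.
  by rewrite cjE i1 conj1g.
have Gn1 : group_set (ucs n.+1).
  apply/group_setP; split; first by apply/ucsP => g; rewrite kg1; case/group_setP: Gn.
  move=> a b /ucsP Ka /ucsP Kb; apply/ucsP => g; rewrite kgMl.
  by case/group_setP: Gn => _; apply => //; rewrite -cj_i; apply: In.
split=> // a g Ka; apply/ucsP => h.
have -> : kg (cj g a) h = cj g (kg a (h ^ g^-1)).
  by apply: i_inj; rewrite kgE !cjE kgE conjRg conjgKV.
by apply: In; move/ucsP: Ka; apply.
Qed.

Let ucs_sub n : ucs n \subset ucs n.+1.
Proof.
apply/subsetP => a Ka; apply/ucsP => g; have [Gn In] := ucs_group n.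
case/group_setP: (Gn) => _; apply; last exact: In.
exact: (groupVr (G := Group Gn)).
Qed.

(** The series stabilises by finiteness. If it stopped at a proper subgroup, a fixed coset would
    give an element of the next term outside it. The index is a power of p because every a^q is
    central in G and so already belongs to the last term. *)
Lemma ucs_full : exists n, ucs n = [set: gT].
Proof.
have [n nE] : exists n, ucs n.+1 = ucs n.
  apply: contrapT => none.
  have big n : n < #|ucs n|.
    elim: n => [|n IH]; first by rewrite cards1.
    apply: leq_ltn_trans IH _; apply: proper_card; rewrite properEneq ucs_sub andbT.
    by apply/eqP => E; apply: none; exists n.
  by have := big #|gT|; rewrite ltnNge max_card.
exists n; apply/eqP; rewrite eqEsubset subsetT /=; apply: contraT => nT.
have [Gn In] := ucs_group n; pose N := Group Gn.
have [||||z /setDP[_ Nz] zN] := @fixed_coset [group of [set: gT]] N.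
- by move=> a g _; rewrite inE.
- exact: In.
- by rewrite properE subsetT.
- apply: pnat_index; first exact: inv_norm.
  move=> a _; change (a ^+ q \in ucs n); rewrite -nE; apply/ucsP => g.
  have -> : kg (a ^+ q) g = 1; last exact: (group1 N).
  apply: i_inj; rewrite kgE i1 iX; apply/eqP/commgP/commute_sym; exact: central_q.
by case/negP: Nz; change (z \in ucs n); rewrite -nE; apply/ucsP.
Qed.

Lemma G_nilpotent : exists c, trivial_sub (lcs G c.+1).
Proof.
have [n nE] := ucs_full; exists n.
have lcs_ucs m : m <= n -> forall x, lcs G m.+1 x -> exists2 a, a \in ucs (n - m) & x = i a.
  elim: m => [|m IH] le_mn x.
    by move/i_im=> [a ->]; exists a; rewrite // subn0 nE inE.
  move: x; apply: (lcs_min (H := fun x => exists2 a, a \in ucs (n - m.+1) & x = i a)).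
    have [Gn _] := ucs_group (n - m.+1); pose N := Group Gn; split.
      by exists 1; rewrite ?i1 //; apply: (group1 N).
    move=> _ _ [a Na ->] [b Nb ->]; exists (a * b^-1); rewrite ?iM ?iV //.
    by apply: (groupM (G := N)) => //; apply: (groupVr (G := N)).
  move=> y g /IH[|a Ka ->]; first exact: ltnW.
  exists (kg a g); last by rewrite kgE.
  by move: Ka; rewrite -(subnSK le_mn) => /ucsP; apply.
by move=> x /(lcs_ucs n (leqnn n)) [a]; rewrite subnn => /set1P -> ->; rewrite i1.
Qed.

Lemma derived_pgroup : p.-group [set: gT].
Proof.
have [c cT] := G_nilpotent; have [k qk] := qE.
apply/pgroupP => r r_pr r_dv.
have [x _ ox] := @Cauchy _ r [group of [set: gT]] r_pr r_dv.
have : r %| q ^ c.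
  rewrite -ox order_dvdn; apply/eqP/i_inj; rewrite iX i1.
  by apply: (lcs1_exponent central_q cT); apply/i_im; exists x.
by rewrite qk -expnM Euclid_dvdX // dvdn_prime2 // => /andP[].
Qed.

Lemma fixed_coset_pgroup (M N : {group gT}) : Ginv M -> Ginv N -> N \proper M ->
  exists2 z, z \in M :\: N & forall g, kg z g \in N.
Proof.
move=> invM invN pNM; apply: fixed_coset => //.
apply: pnat_dvd (dvdn_indexg _ _) _.
exact: pgroupS (subsetT _) derived_pgroup.
Qed.

End Nilpotent.
End Model.

(** * Subgroups of prime index *)

Lemma dvdn_prime p d : prime p -> d %| p -> d = 1%N \/ d = p.
Proof. by case/primeP=> _ H /H /orP[] /eqP; [left|right]. Qed.

Lemma coset_eq_mulV (gT : finGroupType) (N : {group gT}) (x y : gT) :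
  (x \in 'N(N) -> y \in 'N(N) -> coset N x = coset N y -> x^-1 * y \in N)%g.
Proof.
move=> Nx Ny /esym/(rcoset_kercosetP Ny Nx); rewrite mem_rcoset => Nyx.
have -> : (x^-1 * y = (y * x^-1) ^ x)%g by rewrite conjgE -mulgA mulVg mulg1.
by rewrite memJ_norm.
Qed.

Section PrimeIndex.
Local Open Scope group_scope.
Variables (gT : finGroupType) (p : nat) (M N : {group gT}).
Hypothesis p_pr : prime p.
Hypothesis nNM : N <| M.
Hypothesis idx : #|M : N| = p.

Lemma prime_index_ex : exists x, x \in M :\: N.
Proof.
apply/set0Pn; apply: contraTneq (prime_gt1 p_pr) => /eqP.
by rewrite setD_eq0 -idx -leqNgt -indexgI => /setIidPl ->; rewrite indexgg.
Qed.

Lemma prime_index_gen x a : x \in M :\: N -> a \in M ->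
  exists j n, n \in N /\ a = x ^+ j * n.
Proof.
case/setDP => Mx Nx Ma; have nN := subsetP (normal_norm nNM).
have cQ : #|M / N| = p by rewrite card_quotient ?normal_norm.
have x1 : coset N x != 1 by apply: contra Nx => /eqP/coset_idr; apply; apply: nN.
have Qx : coset N x \in M / N by apply: mem_quotient.
have cyc : <[coset N x]> = M / N.
  apply/eqP; rewrite eqEcard cycle_subG Qx /= cQ -orderE.
  have : #[coset N x] %| p by rewrite -cQ order_dvdG.
  by case/(dvdn_prime p_pr) => [/eqP|-> //]; rewrite order_eq1 (negPf x1).
have /cycleP[j aj] : coset N a \in <[coset N x]> by rewrite cyc mem_quotient.
exists j, (x ^- j * a); split; last by rewrite mulKVg.
have Nxj : x ^+ j \in 'N(N) by rewrite groupX // nN.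
by apply: coset_eq_mulV => //; [apply: nN|rewrite morphX ?nN // aj].
Qed.

Lemma prime_index_expg x j : x \in M :\: N -> (x ^+ j \in N) = (p %| j).
Proof.
case/setDP => Mx Nx; have nN := subsetP (normal_norm nNM).
have cQ : #|M / N| = p by rewrite card_quotient ?normal_norm.
have x1 : coset N x != 1 by apply: contra Nx => /eqP/coset_idr; apply; apply: nN.
have ox : #[coset N x] = p.
  have : #[coset N x] %| p by rewrite -cQ order_dvdG ?mem_quotient.
  by case/(dvdn_prime p_pr) => [/eqP|//]; rewrite order_eq1 (negPf x1).
rewrite -ox order_dvdn -morphX ?nN //; apply/idP/eqP; first exact: coset_id.
by apply: coset_idr; rewrite groupX // nN.
Qed.

Lemma prime_index_gen_lt x a : x \in M :\: N -> a \in M ->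
  exists j n, [/\ j < p, n \in N & a = x ^+ j * n].
Proof.
move=> Dx Ma; have [j [n [Nn ->]]] := prime_index_gen Dx Ma.
exists (j %% p), (x ^+ (j %/ p * p) * n); split; first by rewrite ltn_pmod ?prime_gt0.
  by rewrite groupM // prime_index_expg // dvdn_mull.
by rewrite mulgA -expgnDr addnC -divn_eq.
Qed.

End PrimeIndex.

(** * Chains of invariant subgroups with steps of index p *)

Section Chains.
Local Open Scope group_scope.
Variables (G : groupType) (gT : finGroupType) (i : gT -> G).
Hypothesis iM : {morph i : x y / x * y}.
Hypothesis i_inj : injective i.
Hypothesis i_im : forall x, gamma G 2 x <-> exists a, x = i a.
Variable p : nat.
Hypothesis p_pr : prime p.
Hypothesis pgT : p.-group [set: gT].
Local Notation Ginv := (Ginv i).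
Local Notation kg := (kg i).
Local Notation cj := (cj i).
Local Notation cent_over := (cent_over i).
Local Notation T := [set: gT]%G.
Hypothesis fixed : forall (M N : {group gT}), Ginv M -> Ginv N -> N \proper M ->
  exists2 z, z \in M :\: N & forall g, kg z g \in N.

Lemma inv_normal (M N : {group gT}) : Ginv N -> N \subset M -> N <| M.
Proof.
move=> invN sNM; apply: normalS (inv_norm iM i_inj i_im invN) => //; exact: subsetT.
Qed.

Lemma invT : Ginv T. Proof. by move=> a g _; rewrite inE. Qed.

Lemma inv1 : Ginv 1%G.
Proof.
move=> a g /set1P ->; rewrite inE; apply/eqP/i_inj.
by rewrite cjE // i1 // conj1g.
Qed.

(** Take an element fixed modulo N and pass to its last p-power outside N: it is still fixed modulo
    N, and together with N it generates an invariant subgroup in which N has index p. *)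
Lemma chain_up (M N : {group gT}) : Ginv M -> Ginv N -> N \proper M ->
  exists (L : {group gT}) z, [/\ Ginv L, N \proper L, L \subset M, #|L : N| = p &
    cent_over L N /\ z \in L :\: N].
Proof.
move=> invM invN pNM; have [sNM _] := andP pNM.
have [z0 /setDP[Mz0 Nz0] cz0] := fixed invM invN pNM.
have nNM := inv_normal invN sNM; have nN := subsetP (normal_norm nNM).
have [n] : exists n, z0 ^+ (p ^ n) \in N.
  have /p_natP[n on] : p.-nat #[z0] := mem_p_elt pgT (in_setT z0).
  by exists n; rewrite -on expg_order group1.
have cX z j g : z \in M -> kg z g \in N -> kg (z ^+ j) g \in N.
  move=> Mz Nz; rewrite kgEcj cjX // cj_kg.
  have zN : z \in 'N(N) by apply: nN.
  have kN : kg z g \in 'N(N) by apply: (subsetP (normG N)).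
  apply: coset_eq_mulV; [by rewrite groupX|by rewrite groupX // groupM|].
  have E : coset N (z * kg z g) = coset N z.
    by rewrite (morphM (coset_morphism N)) //= (coset_id Nz) mulg1.
  rewrite (morphX (coset_morphism N)) // (morphX (coset_morphism N)) /= ?E //.
  by rewrite groupM.
elim: n => [|n IH] Nzn; first by case/negP: Nz0; rewrite expg1 in Nzn.
case Nz : (z0 ^+ (p ^ n) \in N); first exact: IH.
set z := z0 ^+ (p ^ n) in Nz; have Mz : z \in M by rewrite groupX.
have zp : z ^+ p \in N by rewrite -expgnA -expnSr.
have cz g : kg z g \in N by apply: cX.
have zN : z \in 'N(N) by apply: nN.
have nzN : <[z]> \subset 'N(N) by rewrite cycle_subG.
pose L := (N <*> <[z]>)%G; have sNL : N \subset L by apply: joing_subl.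
have LE a : a \in L -> exists j m, m \in N /\ a = z ^+ j * m.
  rewrite /= norm_joinEr // -normC // => /mulsgP[_ m /cycleP[j ->] Nm ->].
  by exists j, m.
have Lz : z \in L by rewrite mem_gen // inE cycle_id orbT.
have cLN : cent_over L N.
  move=> a g /LE[j [m [Nm ->]]]; rewrite kgMl //; apply: groupM.
    rewrite memJ_norm; first exact: cX.
    by apply: (subsetP (normG N)).
  by rewrite kgEcj groupM ?groupV //; apply: invN.
have invL := cent_over_inv sNL cLN.
have nNL := inv_normal invN sNL.
exists L, z; split=> //.
- by rewrite properE sNL; apply/negP => /subsetP/(_ z Lz); rewrite Nz.
- by rewrite join_subG sNM cycle_subG.
- rewrite -card_quotient ?normal_norm // /L /= quotientYidl // quotient_cycle // -orderE.
  have : #[coset N z] %| p by rewrite order_dvdn -morphX //= (coset_id zp).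
  case/(dvdn_prime p_pr) => [/eqP|//]; rewrite order_eq1 => /eqP/coset_idr.
  by move=> /(_ zN); rewrite Nz.
- by split=> //; rewrite inE Nz.
Qed.

(** From a maximal proper invariant subgroup, one step upwards must reach N. *)
Lemma chain_down (N : {group gT}) : Ginv N -> N :!=: 1 ->
  exists M : {group gT}, [/\ Ginv M, M \proper N, #|N : M| = p & cent_over N M].
Proof.
move=> invN N1.
pose P (A : {set gT}) := [&& `[< Ginv A >], group_set A & A \proper N].
have [A maxA _] : {A | maxset P A & [1 gT] \subset A}.
  apply: maxset_exists; apply/and3P; split; first by apply/asboolP; apply: inv1.
    exact: group_set_one.
  by rewrite proper1G.
have [/and3P[/asboolP invA gA pA] maxi] := maxsetP maxA.
pose M := Group gA.
have [L [z [invL pML sLN idxL [cLM _]]]] := @chain_up N M invN invA pA.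
have LN : L :=: N.
  apply/eqP; rewrite eqEproper sLN /=; apply/negP => pLN.
  have E := maxi L _ (proper_sub pML); rewrite E in pML.
    by rewrite properxx in pML.
  by apply/and3P; split=> //; [exact/asboolP|exact: groupP].
exists M; split=> //; first by rewrite -LN.
by move=> a g Na; apply: cLM; rewrite LN.
Qed.

Lemma index_p_cent (M N : {group gT}) : Ginv M -> Ginv N -> N \subset M -> #|M : N| = p ->
  cent_over M N.
Proof.
move=> invM invN sNM idx.
have pNM : N \proper M by rewrite properEneq sNM andbT; apply/eqP => E; move: idx p_pr; rewrite E indexgg => <-.
have [L [z [invL pNL sLM idxL [cLM _]]]] := chain_up invM invN pNM.
have LM : L :=: M.
  by apply/eqP; rewrite eqEcard sLM -(Lagrange sNM) -(Lagrange (proper_sub pNL)) idx idxL leqnn.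
by move=> a g Ma; apply: cLM; rewrite LM.
Qed.

(** Conjugation by an element of G need not be inner on [gT], but it is an automorphism, and the
    Frattini subgroup is characteristic. *)
Lemma Phi_inv : Ginv 'Phi(T).
Proof.
move=> a g Pa.
have cjm : {in T &, {morph cj g : x y / x * y}} by move=> x y _ _; apply: cjM.
pose f := Morphism cjm.
have injf : 'injm f by apply/injmP => x y _ _; apply: cj_inj.
have fT : f @* T = T.
  apply/eqP; rewrite eqEcard subsetT /= card_injm //.
have E := injm_Phi injf (subxx _); rewrite /= fT in E.
suff : f a \in f @* 'Phi(T) by rewrite E.
by apply: mem_morphim; rewrite ?inE.
Qed.

(** N is maximal among the invariant subgroups that contain the Frattini subgroup and have a
    noncyclic quotient. For the next subgroup L, the quotient T/L is cyclic of exponent dividing p;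
    it is not trivial, for otherwise T/N would have order p and be cyclic. *)
Lemma noncyclic_chain : ~~ cyclic T -> exists N L : {group gT},
  [/\ Ginv N, Ginv L, N \subset L, #|T : L| = p & #|L : N| = p] /\ (forall a, a ^+ p \in N).
Proof.
move=> ncT.
have PhiX a : a ^+ p \in 'Phi(T).
  rewrite (Phi_joing pgT); apply: (subsetP (joing_subr _ _)).
  have := Mho_p_elt 1 (in_setT a) (mem_p_elt pgT (in_setT a)).
  by rewrite expn1.
pose P (A : {set gT}) := [&& `[< Ginv A >], group_set A, 'Phi(T) \subset A & ~~ cyclic (T / A)].
have [A maxA _] : {A | maxset P A & 'Phi(T) \subset A}.
  apply: maxset_exists; apply/and4P; split; [exact/asboolP/Phi_inv|exact: groupP|by []|].
  by apply: contra ncT; apply: Phi_quotient_cyclic.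
have [/and4P[/asboolP invA gA sPA ncA] maxi] := maxsetP maxA.
pose N := Group gA; have NX a : a ^+ p \in N by apply: (subsetP sPA).
have pNT : N \proper T.
  rewrite properE subsetT; apply: contra ncA => sTN.
  by rewrite (quotientS1 sTN) cyclic1.
have [L [z [invL pNL _ idxL [cLN _]]]] := chain_up invT (invA : Ginv N) pNT.
exists N, L; split=> //; split=> //; first exact: proper_sub.
have cL : cyclic (T / L).
  apply: contraT => ncL.
  have E : L :=: N.
    apply: maxi; last exact: proper_sub.
    apply/and4P; split=> //; [exact/asboolP|exact: groupP|].
    exact: subset_trans sPA (proper_sub pNL).
  by move: pNL; rewrite E properxx.
have nLT := inv_normal invL (subsetT L).
have nNT := inv_normal (invA : Ginv N) (subsetT N).
have [x Tx] : exists x, coset L x \in T / L /\ T / L = <[coset L x]>.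
  case/cyclicP: cL => y yE; have : y \in T / L by rewrite yE cycle_id.
  by case/morphimP => x _ Tx xE; exists x; rewrite -xE; split=> //; rewrite yE cycle_id.
rewrite -card_quotient ?normal_norm //.
case: Tx => Tx Tx'; rewrite Tx' -orderE.
have : #[coset L x] %| p.
  rewrite order_dvdn -morphX ?(subsetP (normal_norm nLT)) ?inE //.
  by apply/eqP/coset_id; apply: (subsetP (proper_sub pNL)).
case/(dvdn_prime p_pr) => // ox1; case/negP: ncA.
have TL : T \subset L.
  by rewrite -(quotient_sub1 (normal_norm nLT)) Tx' cycle_subG; apply/set1P/eqP; rewrite -order_eq1 ox1.
change (cyclic (T / N)); apply: prime_cyclic; rewrite card_quotient ?normal_norm //.
by have -> : #|T : N| = #|L : N|; [congr #|_ : _|; apply/eqP; rewrite eqEsubset TL subsetT|rewrite idxL].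
Qed.
End Chains.

(** * Upper bounds *)

Section Engel.
Local Open Scope ring_scope.
Variables (K : fieldType) (R : algType K).

Lemma lcomm_binomial (x y : R) n :
  lcomm (fun k => if k is 0%N then x else y) n =
  \sum_(k < n.+1) ((-1) ^+ k * (y ^+ k * x * y ^+ (n - k))) *+ 'C(n, k).
Proof.
elim: n => [|n IH]; first by rewrite big_ord_recl big_ord0 addr0 bin0 !mul1r mulr1.
set t := fun m k : nat => (-1) ^+ k * (y ^+ k * x * y ^+ (m - k)).
rewrite /= IH mulr_suml mulr_sumr.
have -> : \sum_(k < n.+1) t n k *+ 'C(n, k) * y =
    \sum_(k < n.+2) t n.+1 k *+ 'C(n, k).
  rewrite [RHS]big_ord_recr /= bin_small // mulr0n addr0; apply: eq_bigr => k _.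
  by rewrite mulrnAl /t subSn; [rewrite exprSr -!mulrA|rewrite -ltnS].
have -> : \sum_(k < n.+1) y * (t n k *+ 'C(n, k)) =
    - \sum_(k < n.+1) t n.+1 k.+1 *+ 'C(n, k).
  rewrite -sumrN; apply: eq_bigr => k _.
  rewrite mulrnAr -mulNrn /t subSS; congr (_ *+ _).
  rewrite [(-1) ^+ k.+1]exprS mulN1r mulNr opprK mulrA commr_sign -mulrA.
  by rewrite [y ^+ k.+1]exprS !mulrA.
rewrite opprK [in RHS]big_ord_recl /= bin0 big_ord_recl /= bin0 -addrA; congr (_ + _).
rewrite -big_split; apply: eq_bigr => k _ /=.
by rewrite binS mulrnDr.
Qed.

(** In characteristic p the inner binomial coefficients vanish. Applied to group elements, this
    turns vanishing Engel words into central p-powers. *)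
Lemma lcomm_pchar (x y : R) p a : p \in [pchar K] ->
  lcomm (fun k => if k is 0%N then x else y) (p ^ a) = x * y ^+ (p ^ a) - y ^+ (p ^ a) * x.
Proof.
move=> pK; have p_pr := pcharf_prime pK.
have pR : p \in [pchar R] by rewrite pchar_lalg.
have q_gt0 : (0 < p ^ a)%N by rewrite expn_gt0 prime_gt0.
rewrite lcomm_binomial; case qE : (p ^ a)%N q_gt0 => [//|q] _.
rewrite big_ord_recl big_ord_recr big1 /=.
  rewrite add0r subn0 mul1r mul1r bin0 binn subnn mulr1 !mulr1n; congr (_ + _).
  have -> : (-1) ^+ q.+1 = -1 :> R.
    rewrite -qE; elim: (a) => [|b IH]; first by rewrite expr1.
    by rewrite expnSr exprM IH -(pFrobenius_autE pR) pFrobenius_autN pFrobenius_aut1.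
  by rewrite mulN1r.
move=> k _; apply/eqP; rewrite -mulr_natr.
suff -> : ('C(q.+1, bump 0 k)%:R = 0 :> R) by rewrite mulr0.
apply/eqP; rewrite -(dvdn_pcharf pR); set j := bump 0 k.
have lt_j : (j < p ^ a)%N by rewrite qE /j /bump add1n ltnS ltn_ord.
(* From j C(q, j) = q C(q - 1, j - 1) with q = p^a: if p did not divide C(q, j), then q would divide
   j < q. *)
have := mul_bin_diag (p ^ a) j.-1; rewrite qE /= -qE => binE.
apply: contraLR lt_j => p_bin; rewrite -leqNgt dvdn_leq //.
have co : coprime (p ^ a) 'C(p ^ a, j) by rewrite coprimeXl // prime_coprime.
by rewrite -(Gauss_dvdl _ co) -[j in (j * _)%N]/(j.-1.+1) -binE qE dvdn_mulr.
Qed.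
End Engel.

(** * Vanishing thresholds for upper powers modulo invariant subgroups *)

Section Bounds.
Local Open Scope group_scope.
Local Open Scope ring_scope.
Variables (K : fieldType) (G : groupType) (R : algType K) (e : G -> R).
Hypothesis e1 : e 1%g = 1.
Hypothesis eM : forall x y, e (x * y)%g = e x * e y.
Hypothesis espan : forall r : R, exists (s : seq G) (c : G -> K),
  r = \sum_(g <- s) c g *: e g.
Variables (gT : finGroupType) (i : gT -> G).
Hypothesis iM : {morph i : x y / (x * y)%g}.
Hypothesis i_inj : injective i.
Hypothesis i_im : forall x, gamma G 2 x <-> exists a, x = i a.
Variable p : nat.
Hypothesis pcharK : p \in [pchar K].
Let p_pr : prime p := pcharf_prime pcharK.
Hypothesis pgT : p.-group [set: gT].
Local Notation Ginv := (Ginv i).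
Local Notation kg := (kg i).
Local Notation cj := (cj i).
Local Notation cent_over := (cent_over i).
Local Notation iG := (iG i).
Local Notation T := [set: gT]%G.
Hypothesis fixed : forall (M N : {group gT}), Ginv M -> Ginv N -> N \proper M ->
  exists2 z, z \in M :\: N & forall g, kg z g \in N.

(** A central step of index p multiplies the upper index by p; a chain of such steps leads from M
    down to N. *)
Lemma upper_index (M N : {group gT}) S : Ginv M -> Ginv N -> N \subset M ->
  (forall a : R, upper S a -> aug e (iG M) a) ->
  forall a : R, upper (#|M : N| * S) a -> aug e (iG N) a.
Proof.
move: {2}(#|M : N|) (leqnn #|M : N|) => n; elim: n N => [|n IH] N le_n invM invN sNM US.
  by move: le_n; rewrite leqNgt indexg_gt0.
case pNM: (N \proper M); last first.
  have MN : M :=: N.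
    by apply/eqP; rewrite eqEsubset sNM andbT; move: pNM; rewrite properE sNM => /negbFE.
  by rewrite MN indexgg mul1n => a Ua; rewrite -MN; apply: US.
have [L [z [invL pNL sLM idxL [cLN Lz]]]] := chain_up iM i_inj i_im p_pr pgT fixed invM invN pNM.
have sNL := proper_sub pNL.
have idx : (#|M : L| * p = #|M : N|)%N.
  by rewrite -idxL mulnC; apply/eqP; rewrite -(eqn_pmul2l (cardG_gt0 N)) mulnA !Lagrange // Lagrange //.
have IH' : forall a : R, upper (#|M : L| * S) a -> aug e (iG L) a.
  apply: IH => //; rewrite -ltnS; apply: leq_trans le_n; rewrite -idx.
  by rewrite -{1}[#|M : L|]muln1 ltn_pmul2l // prime_gt1.
move=> a; rewrite -idx [(_ * p)%N]mulnC -mulnA.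
apply: (upper_central_ext e1 eM espan (z := i z) pcharK _ _ _ IH').
- move=> g; exists (kg z g); last by rewrite kgE.
  by apply: cLN; case/setDP: Lz.
- exists (z ^+ p)%g; last by rewrite iX.
  have nNL := inv_normal iM i_inj i_im invN sNL.
  by rewrite (prime_index_expg p_pr nNL idxL).
- move=> _ [b Lb ->]; have nNL := inv_normal iM i_inj i_im invN sNL.
  have [j [n' [Nn' ->]]] := prime_index_gen p_pr nNL idxL Lz Lb.
  by exists j, (i n'); rewrite iM iX //; split=> //; exists n'.
Qed.

Lemma aug1 a : aug e (iG 1%G) a -> a = 0.
Proof. by apply: (aug_trivial e1) => x [b /set1P -> ->]; apply: i1. Qed.

Lemma upper_card (M : {group gT}) S : Ginv M ->
  (forall a : R, upper S a -> aug e (iG M) a) ->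
  forall a : R, upper (#|M| * S) a -> a = 0.
Proof.
move=> invM US a; rewrite -indexg1 => Ua; apply: aug1.
by apply: upper_index US _ Ua => //; [exact: inv1|exact: sub1G].
Qed.

Lemma wfam_base (P : G -> Prop) s v x : P x -> wfam P s v x.
Proof.
move=> Px; elim: s => [//|[b u] s IH] /=; case: ifP => // _.
by exists 0%N, x; rewrite expg0 mul1g.
Qed.

Lemma wfam_in (M N : {group gT}) s v y : N \subset M ->
  (forall b u, (b, u) \in s -> b \in M) ->
  wfam (iG N) [seq (i bu.1, bu.2) | bu <- s] v y -> exists2 l, l \in M & y = i l.
Proof.
move=> sNM; elim: s v y => [|[b u] s IH] v y sM /=.
  by move=> [l Nl ->]; exists l => //; apply: (subsetP sNM).
have Mb : b \in M by apply: (sM b u); rewrite mem_head.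
have sM' b' u' : (b', u') \in s -> b' \in M by move=> H; apply: (sM b' u'); rewrite inE H orbT.
case: ifP => _; last exact: IH.
move=> [j [y' [-> /IH[//|l Ml ->]]]]; exists (b ^+ j * l)%g.
  by rewrite groupM ?groupX.
by rewrite iM iX.
Qed.

Lemma comm_in (M N : {group gT}) b l : cent_over M N -> l \in M -> iG N [~ i b, i l]%g.
Proof.
move=> cMN Ml; exists (kg l (i b))^-1%g; first by rewrite groupV; apply: cMN.
by rewrite iV // kgE // invgR.
Qed.

(* The weight filtration attached to [T >= l`_0 >= ... >= N], the terms having
   weights 1, 2, ... *)
Definition chain_fam (l : seq {group gT}) (N : {group gT}) (v : nat) :=
  iG (nth N (T :: l) v.-1).

Definition central_chain (l : seq {group gT}) (N : {group gT}) :=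
  forall k, Ginv (nth N (T :: l) k) /\ cent_over (nth N (T :: l) k) (nth N (T :: l) k.+1).

Section CentralChain.
Variables (l : seq {group gT}) (N : {group gT}).
Hypothesis cl : central_chain l N.

Lemma chain_fam_conj v x g : chain_fam l N v x -> chain_fam l N v (x ^ g)%g.
Proof.
by case=> b Nb ->; exists (cj g b); [apply: (cl _).1|rewrite cjE].
Qed.

Lemma chain_fam_comm1 g h : chain_fam l N 1 [~ g, h]%g.
Proof.
have /i_im[b ->] : gamma G 2 [~ g, h]%g by apply: (@lcs_comm _ 0).
by exists b; rewrite ?inE.
Qed.

Lemma chain_fam_commS v m g : chain_fam l N v m -> chain_fam l N v.+1 [~ m, g]%g.
Proof.
case=> b Nb ->; exists (kg b g); last by rewrite kgE.
by case: v Nb => [|v] Nb; [apply: in_setT|apply: (cl _).2].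
Qed.

Lemma chain_fam_subgroup v : is_subgroup (chain_fam l N v).
Proof.
split; first by exists 1%g; rewrite ?i1.
move=> _ _ [a Na ->] [b Nb ->]; exists (a * b^-1)%g; first by rewrite groupM ?groupV.
by rewrite iM iV.
Qed.

Lemma upper_chain w (a : R) : upper w a -> wfilt e (aug e (iG N)) (chain_fam l N) w a.
Proof.
apply: (upper_wfilt eM espan (aug_ideal e (iG N))).
- exact: chain_fam_conj.
- exact: chain_fam_comm1.
- exact: chain_fam_commS.
Qed.

Lemma wfilt_chain s w :
  (forall v a, a \in nth N (T :: l) v.-1 -> wfam (iG N) s v (i a)) ->
  wgood p (iG N) s -> (p.-1 * sumn (map snd s) < w)%N ->
  forall a : R, wfilt e (aug e (iG N)) (chain_fam l N) w a -> aug e (iG N) a.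
Proof.
move=> Hs gs lt_w a Fa.
apply: (wfilt_wfam e1 eM (aug_ideal e (iG N)) pcharK _ gs lt_w).
  exact: aug_mem.
by apply: wfilt_sub Fa => v x [b Nb ->]; apply: Hs.
Qed.

End CentralChain.

Section Step2.
Variables L N : {group gT}.
Hypotheses (invL : Ginv L) (invN : Ginv N) (sNL : N \subset L).
Hypotheses (idxTL : #|T : L| = p) (idxLN : #|L : N| = p).

Let cTL : cent_over T L.
Proof. exact: (index_p_cent iM i_inj i_im p_pr pgT fixed (@invT _ _ i) invL (subsetT _)). Qed.
Let cLN : cent_over L N.
Proof. exact: (index_p_cent iM i_inj i_im p_pr pgT fixed invL invN sNL). Qed.
Let nLT := inv_normal iM i_inj i_im invL (subsetT L).
Let nNL := inv_normal iM i_inj i_im invN sNL.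

Hypothesis Tp : forall a, (a ^+ p)%g \in N.

Lemma chain12 : central_chain [:: L] N.
Proof.
move=> k; split; first by case: k => [|[|k]] /=; rewrite ?nth_nil //; exact: invT.
case: k => [|[|k]] /=; rewrite ?nth_nil // => a g Na.
by rewrite kgEcj groupM ?groupV //; apply: invN.
Qed.

(** The threshold is (p - 1)(1 + 2) + 1: generators b of weight 1 and c of weight 2, both with p-th
    power in N. *)
Lemma wfilt_step12 : forall a : R,
  wfilt e (aug e (iG N)) (chain_fam [:: L] N) (3 * p - 2) a -> aug e (iG N) a.
Proof.
have [b Db] := prime_index_ex p_pr idxTL; have [c Dc] := prime_index_ex p_pr idxLN.
have Lc : c \in L by case/setDP: Dc.
apply: (wfilt_chain (s := [seq (i bu.1, bu.2) | bu <- [:: (b, 1%N); (c, 2%N)]])).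
- have LE a : a \in L -> exists j y, i a = (i c ^+ j * y)%g /\ iG N y.
    move=> La; have [j [n [Nn ->]]] := prime_index_gen p_pr nNL idxLN Dc La.
    by exists j, (i n); rewrite iM iX //; split=> //; exists n.
  have TE a : exists j y, i a = (i b ^+ j * y)%g /\ exists j' z, y = (i c ^+ j' * z)%g /\ iG N z.
    have [j [l [Ll ->]]] := prime_index_gen p_pr nLT idxTL Db (in_setT a).
    by exists j, (i l); rewrite iM iX //; split=> //; apply: LE.
  move=> [|[|[|v]]] a //=; try by move=> _; apply: TE.
    exact: LE.
  by rewrite nth_nil => Na; exists a.
- split; first by apply: wfam_base; exists (b ^+ p)%g; rewrite ?iX.
    move=> v y /(wfam_in (M := L) (s := [:: (c, 2%N)]) sNL)[|l Ll ->].
      by move=> b' u'; rewrite inE => /eqP[-> _].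
    exact: (comm_in _ cLN).
  split=> //=; first by exists (c ^+ p)%g; rewrite ?iX.
  move=> _ _ [l Nl ->]; apply: (comm_in _ cLN); exact: (subsetP sNL).
by rewrite /= addn0; case: (p) p_pr => // q _ /=; rewrite mulnC mulnS subSS addnC.
Qed.

Lemma upper_step12 (a : R) : upper (3 * p - 2) a -> aug e (iG N) a.
Proof. by move/(upper_chain chain12)/wfilt_step12. Qed.

(** If G centralises T/N, both generators can be given weight 1, and the threshold drops to 2(p - 1)
    + 1. *)
Lemma upper_step11 : cent_over T N -> forall a : R, upper (2 * p - 1) a -> aug e (iG N) a.
Proof.
move=> cTN.
have [b Db] := prime_index_ex p_pr idxTL; have [c Dc] := prime_index_ex p_pr idxLN.
have Lc : c \in L by case/setDP: Dc.
have chain11 : central_chain [::] N.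
  move=> k; split; first by case: k => [|k] /=; rewrite ?nth_nil //; exact: invT.
  case: k => [|k] /=; rewrite ?nth_nil // => a g Na.
  by rewrite kgEcj groupM ?groupV //; apply: invN.
move=> r /(upper_chain chain11).
apply: (wfilt_chain (s := [seq (i bu.1, bu.2) | bu <- [:: (b, 1%N); (c, 1%N)]])).
- have LE a : a \in L -> exists j y, i a = (i c ^+ j * y)%g /\ iG N y.
    move=> La; have [j [n [Nn ->]]] := prime_index_gen p_pr nNL idxLN Dc La.
    by exists j, (i n); rewrite iM iX //; split=> //; exists n.
  have TE a : exists j y, i a = (i b ^+ j * y)%g /\ exists j' z, y = (i c ^+ j' * z)%g /\ iG N z.
    have [j [l [Ll ->]]] := prime_index_gen p_pr nLT idxTL Db (in_setT a).
    by exists j, (i l); rewrite iM iX //; split=> //; apply: LE.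
  move=> [|[|v]] a //=; try by move=> _; apply: TE.
  by rewrite nth_nil => Na; exists a.
- split; first by apply: wfam_base; exists (b ^+ p)%g; rewrite ?iX.
    move=> v y /(wfam_in (M := L) (s := [:: (c, 1%N)]) sNL)[|l Ll ->].
      by move=> b' u'; rewrite inE => /eqP[-> _].
    exact: (comm_in _ cLN).
  split=> //=; first by exists (c ^+ p)%g; rewrite ?iX.
  move=> _ _ [l Nl ->]; apply: (comm_in _ cLN); exact: (subsetP sNL).
by rewrite /= addn0; case: (p) p_pr => // q _ /=; rewrite mulnC mulnS add2n subn1.
Qed.

End Step2.

Section Step3.
Variables L N N2 : {group gT}.
Hypothesis p2 : p = 2%N.
Hypotheses (invL : Ginv L) (invN : Ginv N) (invN2 : Ginv N2).
Hypotheses (sNL : N \subset L) (sN2N : N2 \subset N).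
Hypotheses (idxTL : #|T : L| = 2%N) (idxLN : #|L : N| = 2%N) (idxNN2 : #|N : N2| = 2%N).
Hypothesis abT : forall a a' : gT, [~ a, a']%g \in N2.
Hypothesis sqL : forall a, a \in L -> (a ^+ 2)%g \in N2.

Let cTL : cent_over T L.
Proof.
exact: (index_p_cent iM i_inj i_im p_pr pgT fixed (@invT _ _ i) invL (subsetT _) (etrans idxTL (esym p2))).
Qed.
Let cLN : cent_over L N.
Proof. exact: (index_p_cent iM i_inj i_im p_pr pgT fixed invL invN sNL (etrans idxLN (esym p2))). Qed.
Let cNN2 : cent_over N N2.
Proof. exact: (index_p_cent iM i_inj i_im p_pr pgT fixed invN invN2 sN2N (etrans idxNN2 (esym p2))). Qed.
Let nLT := inv_normal iM i_inj i_im invL (subsetT L).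
Let nNL := inv_normal iM i_inj i_im invN sNL.
Let nN2N := inv_normal iM i_inj i_im invN2 sN2N.
Let sN2L := subset_trans sN2N sNL.

(** Only b may have its square outside [N2], which is harmless: b^2 lies in L, where the weight is u
    >= 2, twice the weight of b. *)
Let chain3 b c d u v :
  b \in T :\: L -> c \in L :\: N -> d \in N :\: N2 -> (1 < u)%N -> (u <= v)%N ->
  let s := [seq (i bu.1, bu.2) | bu <- [:: (b, 1%N); (c, u); (d, v)]] in
  [/\ forall w a, (w <= 1)%N -> wfam (iG N2) s w (i a),
      forall w a, (1 < w <= u)%N -> a \in L -> wfam (iG N2) s w (i a),
      forall w a, (u < w <= v)%N -> a \in N -> wfam (iG N2) s w (i a) &
      wgood 2 (iG N2) s].
Proof.
move=> Db Dc Dd u_gt1 le_uv s.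
have [Lc Nd] : c \in L /\ d \in N by split; [case/setDP: Dc|case/setDP: Dd].
have pr2 : prime 2 by [].
have NE w a : (w <= v)%N -> a \in N -> wfam (iG N2) [:: (i d, v)] w (i a).
  move=> le_wv Na; rewrite /= le_wv.
  have [j [n [Nn ->]]] := prime_index_gen pr2 nN2N idxNN2 Dd Na.
  by exists j, (i n); rewrite iM iX //; split=> //; exists n.
have LE w a : (w <= u)%N -> a \in L -> wfam (iG N2) [:: (i c, u); (i d, v)] w (i a).
  move=> le_wu La; rewrite /wfam -/wfam /= le_wu.
  have [j [n [Nn ->]]] := prime_index_gen pr2 nNL idxLN Dc La.
  by exists j, (i n); rewrite iM iX //; split=> //; apply: NE => //; apply: leq_trans le_uv.
split.
- move=> w a le_w1; rewrite /s /wfam -/wfam /= le_w1.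
  have [j [n [Nn ->]]] := prime_index_gen pr2 nLT idxTL Db (in_setT a).
  exists j, (i n); rewrite iM iX //; split=> //; apply: (LE w) => //.
  exact: leq_trans le_w1 (ltnW u_gt1).
- move=> w a /andP[w1 le_wu] La; rewrite /s /= leqNgt w1 /=; exact: LE.
- move=> w a /andP[uw le_wv] Na; rewrite /s /= leqNgt (leq_trans u_gt1 (ltnW uw)) /= leqNgt uw /=.
  exact: NE.
split.
- rewrite -iX //; apply: LE; first by rewrite muln1.
  by rewrite (prime_index_expg pr2 nLT idxTL).
- move=> w y /(wfam_in (M := L) (s := [:: (c, u); (d, v)]) sN2L)[|l Ll ->].
    move=> b' u'; rewrite !inE => /orP[] /eqP[-> _] //; exact: (subsetP sNL).
  by exists [~ b, l]%g; rewrite // -(kg_i iM i_inj i_im) kgE.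
split.
- by apply: wfam_base; exists (c ^+ 2)%g; rewrite ?iX //; apply: sqL.
- move=> w y /(wfam_in (M := L) (s := [:: (d, v)]) sN2L)[|l Ll ->].
    move=> b' u'; rewrite !inE => /eqP[-> _] //; exact: (subsetP sNL).
  by exists [~ c, l]%g; rewrite // -(kg_i iM i_inj i_im) kgE.
split=> //=.
- exists (d ^+ 2)%g; rewrite ?iX //; apply: sqL; exact: (subsetP sNL).
- by move=> _ _ [l Nl ->]; exists [~ d, l]%g; rewrite // -(kg_i iM i_inj i_im) kgE.
Qed.

Let stable a g : a \in N2 -> kg a g \in N2.
Proof. by move=> Na; rewrite kgEcj groupM ?groupV //; apply: invN2. Qed.

Lemma chain123 : central_chain [:: L; N] N2.
Proof.
move=> k; split; first by case: k => [|[|[|k]]] /=; rewrite ?nth_nil //; exact: invT.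
by case: k => [|[|[|k]]] /=; rewrite ?nth_nil // => a g; exact: stable.
Qed.

(** Weights 1, 2, 3 with exponents at most 1 give a total of at most 6. *)
Lemma wfilt_step123 (a : R) :
  wfilt e (aug e (iG N2)) (chain_fam [:: L; N] N2) 7 a -> aug e (iG N2) a.
Proof.
have [b Db] := prime_index_ex p_pr (etrans idxTL (esym p2)).
have [c Dc] := prime_index_ex p_pr (etrans idxLN (esym p2)).
have [d Dd] := prime_index_ex p_pr (etrans idxNN2 (esym p2)).
have [HT HL HN gs] := chain3 (u := 2%N) (v := 3%N) Db Dc Dd isT isT.
apply: (wfilt_chain (s := [seq (i bu.1, bu.2) | bu <- [:: (b, 1%N); (c, 2%N); (d, 3%N)]])); last 2 first.
- by rewrite p2; exact: gs.
- by rewrite p2.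
case=> [|[|[|[|v]]]] x Hx; [exact: HT|exact: HT|exact: HL|exact: HN|].
by apply: wfam_base; exists x => //; move: Hx; rewrite /= nth_nil.
Qed.

Lemma upper_step123 (a : R) : upper 7 a -> aug e (iG N2) a.
Proof. by move/(upper_chain chain123)/wfilt_step123. Qed.

(** When G centralises L/N2, the term N can be skipped in the series; c and d both have weight 2,
    and the threshold becomes 1 + 2 + 2 + 1. *)
Lemma upper_step122 : cent_over L N2 -> forall a : R, upper 6 a -> aug e (iG N2) a.
Proof.
move=> cLN2.
have [b Db] := prime_index_ex p_pr (etrans idxTL (esym p2)).
have [c Dc] := prime_index_ex p_pr (etrans idxLN (esym p2)).
have [d Dd] := prime_index_ex p_pr (etrans idxNN2 (esym p2)).
have [HT HL HN gs] := chain3 (u := 2%N) (v := 2%N) Db Dc Dd isT isT.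
have chain122 : central_chain [:: L] N2.
  move=> k; split; first by case: k => [|[|k]] /=; rewrite ?nth_nil //; exact: invT.
  by case: k => [|[|k]] /=; rewrite ?nth_nil // => a g; exact: stable.
move=> a /(upper_chain chain122).
apply: (wfilt_chain (s := [seq (i bu.1, bu.2) | bu <- [:: (b, 1%N); (c, 2%N); (d, 2%N)]])); last 2 first.
- by rewrite p2; exact: gs.
- by rewrite p2.
case=> [|[|[|v]]] x Hx; [exact: HT|exact: HT|exact: HL|].
by apply: wfam_base; exists x => //; move: Hx; rewrite /= nth_nil.
Qed.

End Step3.
End Bounds.

(** * Lower bounds *)

Section Seeds.
Local Open Scope group_scope.
Variables (G : groupType) (gT : finGroupType) (i : gT -> G).
Hypothesis iM : {morph i : x y / x * y}.
Hypothesis i_inj : injective i.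
Hypothesis i_im : forall x, gamma G 2 x <-> exists a, x = i a.
Local Notation Ginv := (Ginv i).
Local Notation kg := (kg i).
Local Notation cj := (cj i).
Local Notation cent_over := (cent_over i).
Local Notation iG := (iG i).
Local Notation T := [set: gT]%G.

Lemma iG_subgroup (M : {group gT}) : is_subgroup (iG M).
Proof.
split; first by exists 1; rewrite ?i1.
move=> _ _ [a Ma ->] [b Mb ->]; exists (a * b^-1); first by rewrite groupM ?groupV.
by rewrite iM iV.
Qed.

Lemma comm_iE x y : exists b, i b = [~ x, y].
Proof.
have /i_im[b ->] : gamma G 2 [~ x, y] by apply: (@lcs_comm _ 0).
by exists b.
Qed.

Lemma comm_notin (M : {group gT}) : M \proper T ->
  exists x y b, i b = [~ x, y] /\ b \notin M.
Proof.
move=> pM; apply: contrapT => none; case/properP: pM => _ [b _]; apply/negP; rewrite negbK.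
have: lcs G 1 (i b) by apply/i_im; exists b.
move/(@lcs_min _ 0 (iG M) (iG_subgroup M)); case=> [x g _|b' Mb' /i_inj ->//].
have [c cE] := comm_iE x g; exists c => //.
by apply: contrapT => /negP Mc; apply: none; exists x, g, c.
Qed.

Section Step.
Variables (p : nat) (L N : {group gT}).
Hypothesis p_pr : prime p.
Hypotheses (invL : Ginv L) (invN : Ginv N) (sNL : N \subset L).
Hypotheses (idxTL : #|T : L| = p) (idxLN : #|L : N| = p).
Hypotheses (cTL : cent_over T L) (cLN : cent_over L N).

Let nLT := inv_normal iM i_inj i_im invL (subsetT L).
Let nNL := inv_normal iM i_inj i_im invN sNL.
Let nNT := inv_normal iM i_inj i_im invN (subsetT N).
Let NJ a b : a \in N -> a ^ b \in N.
Proof. by move=> Na; rewrite memJ_norm // (subsetP (normal_norm nNT)) ?inE. Qed.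

Definition acts_trivially (g : G) := forall m, kg m g \in N.
Local Notation A := acts_trivially.

Lemma acts_triviallyM g h : A g -> A h -> A (g * h).
Proof. by move=> Ag Ah m; rewrite kgMr // groupM //; apply: invN. Qed.

Lemma acts_triviallyV g : A g -> A g^-1.
Proof.
move=> Ag m; have : kg m (g * g^-1) = 1 by apply: i_inj; rewrite kgE // mulgV commg1 i1.
by rewrite kgMr // => /eqP; rewrite mulg_eq1 => /eqP ->; rewrite groupV; apply: invN.
Qed.

(** T is generated by b and L, and L/N is centralised by all of G, so the action on T/N is decided
    on b. *)
Lemma acts_trivially_gen b g : b \notin L -> kg b g \in N -> A g.
Proof.
move=> Lb Nb m.
have [j [l [Ll ->]]] := prime_index_gen (x := b) p_pr nLT idxTL (ltac:(by rewrite !inE Lb)) (in_setT m).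
rewrite kgMl //; apply: groupM; last exact: cLN.
apply: NJ; elim: j => [|j IH]; first by rewrite expg0 (_ : kg 1 g = 1) //; apply: i_inj; rewrite kgE // i1 // comm1g.
by rewrite expgSr kgMl // groupM // NJ.
Qed.

(** Modulo N, g -> [b, g] is a homomorphism to L/N, of order p. The image c of x generates it, so a
    power of x cancels the image of any g. *)
Lemma acts_trivially_adjust x g : ~ A x -> exists j, A (g * x ^+ j).
Proof.
move=> nAx; have [b] : exists b, b \in T :\: L by exact: prime_index_ex p_pr idxTL.
case/setDP => _ Lb; set c := kg b x.
have Nc : c \notin N by apply/negP => Nc; apply: nAx; apply: acts_trivially_gen Lb Nc.
have Lc : c \in L by apply: cTL; rewrite inE.
have Dc : c \in L :\: N by rewrite inE Nc.
have [k [n [Nn gE]]] := prime_index_gen p_pr nNL idxLN Dc (cTL g (in_setT b)).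
have xj j : exists2 n', n' \in N & kg b (x ^+ j) = c ^+ j * n'.
  elim: j => [|j [n' Nn' IH]].
    exists 1; first exact: group1.
    by rewrite !expg0 mulg1; apply: i_inj; rewrite kgE // commg1 i1.
  exists (n' * kg (kg b (x ^+ j)) x).
    by rewrite groupM //; apply: cLN; apply: cTL; rewrite inE.
  by rewrite expgSr kgMr // -/c cj_kg IH !mulgA -expgS.
(* If g has image c^k, the exponent k(p - 1) makes the product c^(kp), which lies in N. *)
exists (k * p.-1)%N; apply: (acts_trivially_gen Lb).
have [n' Nn' E] := xj (k * p.-1)%N.
rewrite kgMr // cj_kg E gE.
have Lck : c ^+ k * n \in L by rewrite groupM ?groupX // (subsetP sNL).
have -> : c ^+ (k * p.-1) * n' * (c ^+ k * n * kg (c ^+ k * n) (x ^+ (k * p.-1))) =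
  c ^+ (k * p.-1) * c ^+ k * (n' ^ (c ^+ k) * (n * kg (c ^+ k * n) (x ^+ (k * p.-1)))).
  move: (conjgC n' (c ^+ k)); move: (n' ^ _) (kg (_ * n) _) => v u vE.
  by rewrite -!mulgA; congr (_ * _); rewrite mulgA vE -mulgA.
apply: groupM; last by apply: groupM; [apply: NJ|apply: groupM => //; apply: cLN].
rewrite -expgnDr.
by rewrite -mulnSr prednK ?prime_gt0 // (prime_index_expg p_pr nNL idxLN _ Dc) dvdn_mull.
Qed.

(** It suffices to find [x, y] outside L with x acting nontrivially: multiplying y by a power of x
    makes y act trivially and only conjugates [x, y]. If both entries of a commutator outside L act
    trivially, take z that does not: either [z, y] is outside L, or xz can replace x. *)
Lemma seed : ~ cent_over T N -> exists x y b c,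
  [/\ i b = [~ x, y], b \notin L, c = kg b x, c \in L :\: N &
      [/\ A y, ~ A x & forall g, exists j, A (g * x ^+ j)]].
Proof.
move=> ncTN.
have pLT : L \proper T.
  rewrite properEneq subsetT andbT; apply/eqP => E; move: idxTL; rewrite E indexgg => p1.
  by move: p_pr; rewrite -p1.
have [x0 [y0 [b0 [b0E Lb0]]]] := comm_notin pLT.
have [z nAz] : exists z, ~ A z.
  by apply: contrapT => none; apply: ncTN => a g _; apply: contrapT => H; apply: none; exists g => /(_ a).
suff [x [y [b [bE Lb nAx]]]] : exists x y b, [/\ i b = [~ x, y], b \notin L & ~ A x].
  have [j Aj] := acts_trivially_adjust y nAx.
  have [b' b'E] := comm_iE x (y * x ^+ j).
  have b'bE : b' = b * kg b (x ^+ j).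
    apply: i_inj; rewrite -cj_kg b'E cjE // bE commgMr.
    by have /eqP -> : [~ x, x ^+ j] == 1; [rewrite commgXg|rewrite mul1g].
  have Lb' : b' \notin L by rewrite b'bE groupMr //; apply: cTL; rewrite inE.
  exists x, (y * x ^+ j), b', (kg b' x); split=> //.
    rewrite inE cTL ?inE // andbT; apply/negP => Nk; apply: nAx; exact: acts_trivially_gen Lb' Nk.
  split=> // g; exact: acts_trivially_adjust.
have LV x y b : i b = [~ x, y] -> b \notin L -> exists b', i b' = [~ y, x] /\ b' \notin L.
  by move=> bE Lb; exists b^-1; rewrite iV // bE invgR groupV.
have [Ax0|nAx0] := pselect (A x0); last by exists x0, y0, b0.
have [Ay0|nAy0] := pselect (A y0); last first.
  by have [b [bE Lb]] := LV _ _ _ b0E Lb0; exists y0, x0, b.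
have [bz bzE] := comm_iE z y0.
case Lbz: (bz \in L); last by exists z, y0, bz; rewrite Lbz.
have [b bE] := comm_iE (x0 * z) y0; exists (x0 * z), y0, b; split=> //.
  have -> : b = b0 * kg b0 z * bz.
    by apply: i_inj; rewrite iM -cj_kg cjE // b0E bE bzE commgMl.
  by rewrite -mulgA groupMr // groupM //; apply: cTL; rewrite inE.
move=> Axz; apply: nAz; rewrite -[z](mulKg x0); apply: acts_triviallyM => //.
exact: acts_triviallyV.
Qed.

End Step.
End Seeds.

Section UniqPowers.
Local Open Scope group_scope.
Variables (G : groupType) (gT : finGroupType) (i : gT -> G).
Hypothesis iM : {morph i : x y / x * y}.
Hypothesis i_inj : injective i.

(** Counting shows that the monomials b^i c^j d^k are pairwise distinct: they cover the group and
    there are exactly as many as its order. *)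
Lemma uniq_cover (s : seq gT) : (forall a, a \in s) -> size s = #|gT| -> uniq s.
Proof.
move=> cov sz; apply/card_uniqP; rewrite sz; apply: eq_card => a; by rewrite !inE cov.
Qed.

Definition powers (H : groupType) (n : nat) (b : H) := [seq b ^+ k | k <- iota 0 n].
Definition prods (H : groupType) (s t : seq H) := [seq h * l | h <- s, l <- t].

Lemma map_powers n b : powers n (i b) = map i (powers n b).
Proof. by rewrite -map_comp; apply: eq_map => k /=; rewrite iX. Qed.

Lemma map_prods s t : prods (map i s) (map i t) = map i (prods s t).
Proof.
by rewrite /prods map_allpairs allpairs_mapl allpairs_mapr; apply: eq_allpairs => a b /=; rewrite iM.
Qed.

Lemma mem_powers n (b : gT) j : j < n -> b ^+ j \in powers n b.
Proof. by move=> lt_jn; apply: map_f; rewrite mem_iota. Qed.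

Lemma mem_prods (s t : seq gT) b c : b \in s -> c \in t -> b * c \in prods s t.
Proof. by move=> bs ct; apply/allpairsP; exists (b, c). Qed.

End UniqPowers.

Section Lower.
Local Open Scope group_scope.
Local Open Scope ring_scope.
Variables (K : fieldType) (G : groupType) (R : algType K) (e : G -> R).
Hypothesis e1 : e 1%g = 1.
Hypothesis eM : forall x y, e (x * y)%g = e x * e y.
Hypothesis espan : forall r : R, exists (s : seq G) (c : G -> K),
  r = \sum_(g <- s) c g *: e g.
Hypothesis elin : forall (s : seq G) (c : G -> K), uniq s ->
  \sum_(g <- s) c g *: e g = 0 -> forall g, g \in s -> c g = 0.
Variables (gT : finGroupType) (i : gT -> G).
Hypothesis iM : {morph i : x y / (x * y)%g}.
Hypothesis i_inj : injective i.
Hypothesis i_im : forall x, gamma G 2 x <-> exists a, x = i a.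
Variable p : nat.
Hypothesis pcharK : p \in [pchar K].
Let p_pr : prime p := pcharf_prime pcharK.
Hypothesis pgT : p.-group [set: gT].
Local Notation Ginv := (Ginv i).
Local Notation kg := (kg i).
Local Notation cj := (cj i).
Local Notation cent_over := (cent_over i).
Local Notation iG := (iG i).
Local Notation T := [set: gT]%G.
Hypothesis fixed : forall (M N : {group gT}), Ginv M -> Ginv N -> N \proper M ->
  exists2 z, z \in M :\: N & forall g, kg z g \in N.

Let e_comm a b : commute a b -> (e (i a) - 1) * (e (i b) - 1) = (e (i b) - 1) * (e (i a) - 1).
Proof.
move=> ab; have E : e (i a) * e (i b) = e (i b) * e (i a) by rewrite -!eM -!iM ab.
by rewrite !mulrBl !mulrBr E !mul1r !mulr1 !opprB addrACA [RHS]addrACA; congr (_ + _); rewrite addrC.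
Qed.

Let e_fix a g : kg a g = 1%g -> (e (i a) - 1) * e g = e g * (e (i a) - 1).
Proof.
move=> ag; have E : e (i a) * e g = e g * e (i a).
  by rewrite -!eM; congr e; apply/commgP; rewrite -kgE // ag i1.
by rewrite mulrBl mulrBr E mul1r mulr1.
Qed.

Section Rank2.
Variable L : {group gT}.
Hypotheses (invL : Ginv L) (idxTL : #|T : L| = p) (cardL : #|L| = p).
Hypothesis Tp : forall a : gT, (a ^+ p)%g = 1%g.
Hypothesis ncT1 : ~ cent_over T 1%G.

Let idxL1 : #|L : 1%G| = p. Proof. by rewrite indexg1. Qed.
Let inv1' : Ginv 1%G. Proof. exact: inv1. Qed.
Let cTL : cent_over T L.
Proof. exact: (index_p_cent iM i_inj i_im p_pr pgT fixed (@invT _ _ i) invL (subsetT _)). Qed.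
Let cL1 : cent_over L 1%G.
Proof. exact: (index_p_cent iM i_inj i_im p_pr pgT fixed invL inv1' (sub1G _)). Qed.

Let cover b c : b \notin L -> c \in L :\: 1%G ->
  uniq (prods (powers p (i b)) (powers p (i c))).
Proof.
move=> Lb Dc; rewrite !map_powers // map_prods // map_inj_uniq //; apply: uniq_cover.
  move=> a; have nLT := inv_normal iM i_inj i_im invL (subsetT L).
  have n1L := inv_normal iM i_inj i_im inv1' (sub1G L).
  have [|j [l [lt_jp Ll ->]]] := prime_index_gen_lt p_pr nLT idxTL _ (in_setT a) (x := b).
    by rewrite inE Lb in_setT.
  have [k [n [lt_kp /set1P -> ->]]] := prime_index_gen_lt p_pr n1L idxL1 Dc Ll.
  by rewrite mulg1; apply: mem_prods; apply: mem_powers.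
by rewrite size_allpairs !size_map !size_iota -cardsT -(Lagrange (subsetT L)) cardL idxTL.
Qed.

Let Tp1 (a : gT) : (a ^+ p)%g \in (1%G : {group gT}). Proof. by rewrite Tp group1. Qed.
Let J_eq a : aug e (iG 1%G) a -> a = 0. Proof. exact: aug1. Qed.

Lemma lower_rank2 : exists x y b c, [/\ i b = [~ x, y]%g, i c = [~ i b, x]%g,
  b \notin L, c \in L :\: 1%G & kg b y = 1%g].
Proof.
have [x [y [b [c [bE Lb cE Dc [Ay _ _]]]]]] := seed iM i_inj i_im p_pr invL inv1' (sub1G _) idxTL idxL1 cTL cL1 ncT1.
by exists x, y, b, c; split=> //; [rewrite cE kgE|apply/set1P; apply: Ay].
Qed.

Let ccent : central_chain i [:: L] 1%G.
Proof. exact: (chain12 iM i_inj i_im pcharK pgT fixed invL inv1' (sub1G _) idxTL idxL1). Qed.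

(** Every element of weight 4 = 3p - 2 is zero. If the word of four letters vanished, its leading
    term BC g would have weight 4; but BC g is a sum of distinct group elements. *)
Lemma lower_short : p = 2%N -> ~ lie_power_zero R 4%N.
Proof.
move=> p2 /lie_power_zeroP Z.
have [x [y [b [c [bE cE Lb Dc by1]]]]] := lower_rank2.
have [Lc _] := setDP Dc.
have K2 : 2%:R = 0 :> K by rewrite -p2; apply: pcharf0 pcharK.
have bc : commute c b.
  by apply/commgP; rewrite -(kg_i iM i_inj i_im); apply/eqP/set1P; apply: cL1.
have BB : (e (i b) - 1) * (e (i b) - 1) = 0.
  have := esub1_expr_pchar e1 eM (i b) pcharK.
  by rewrite {1}p2 expr2 -iX // Tp i1 // e1 subrr.
have Cx : (e (i c) - 1) * e x = e x * (e (i c) - 1) by apply: e_fix; apply/set1P; apply: cL1.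
have F := lcomm_char2_short e1 eM espan (aug_ideal e (iG 1%G))
  (chain_fam_conj i_im ccent) (chain_fam_comm1 i_im [:: L] 1%G)
  (chain_fam_commS iM i_im ccent) (chain_fam_subgroup iM [:: L] 1%G) (x := x) (y := y) K2.
rewrite -bE -cE in F; have := F (e_comm bc) BB Cx; rewrite Z sub0r => {}F.
have F' : wfilt e (aug e (iG 1%G)) (chain_fam i [:: L] 1%G) (3 * p - 2)
    (- ((e (i b) - 1) * (e (i c) - 1) * e (x * y * x * x)%g)) by rewrite p2.
have /J_eq/eqP := wfilt_step12 e1 eM iM i_inj i_im pcharK pgT fixed invL inv1' (sub1G _) idxTL idxL1 Tp1 F'.
rewrite oppr_eq0 => /eqP.
have := sub1_mul2_neq0 e1 eM elin (g := (x * y * x * x)%g) pcharK (cover Lb Dc).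
by rewrite p2 !expr1.
Qed.

(** The same argument at weight 7 = 3p - 2, with a word whose leading term B^2 C^2 g has weight
    6. *)
Lemma lower_char3 : p = 3%N -> ~ lie_power_zero R 7%N.
Proof.
move=> p3 /lie_power_zeroP Z.
have [x [y [b [c [bE cE Lb Dc by1]]]]] := lower_rank2.
have [Lc _] := setDP Dc.
have K3 : 3%:R = 0 :> K by rewrite -p3; apply: pcharf0 pcharK.
have bc : commute c b.
  by apply/commgP; rewrite -(kg_i iM i_inj i_im); apply/eqP/set1P; apply: cL1.
have cube a : (e (i a) - 1) * (e (i a) - 1) * (e (i a) - 1) = 0.
  have := esub1_expr_pchar e1 eM (i a) pcharK.
  by rewrite {1}p3 !exprS expr0 mulr1 mulrA -iX // Tp i1 // e1 subrr.
have Cg g : (e (i c) - 1) * e g = e g * (e (i c) - 1) by apply: e_fix; apply/set1P; apply: cL1.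
have by3 : chain_fam i [:: L] 1%G 3 [~ [~ x, y], y]%g.
  by rewrite -bE; exists (kg b y); [rewrite by1|rewrite kgE].
have F := lcomm_char3 e1 eM espan (aug_ideal e (iG 1%G))
  (chain_fam_conj i_im ccent) (chain_fam_comm1 i_im [:: L] 1%G)
  (chain_fam_commS iM i_im ccent) (chain_fam_subgroup iM [:: L] 1%G) by3 K3.
rewrite -bE -cE in F; have := F (cube b) (cube c) (e_comm bc) (Cg x) (Cg y); rewrite Z sub0r => {}F.
set m := - _ in F.
have F' : wfilt e (aug e (iG 1%G)) (chain_fam i [:: L] 1%G) (3 * p - 2) m by rewrite p3.
have /J_eq/eqP := wfilt_step12 e1 eM iM i_inj i_im pcharK pgT fixed invL inv1' (sub1G _) idxTL idxL1 Tp1 F'.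
rewrite oppr_eq0 => /eqP.
have := sub1_mul2_neq0 e1 eM elin (g := (x * y * x * y * y * (x * y) * x)%g) pcharK (cover Lb Dc).
by rewrite p3 !expr2 !mulrA.
Qed.

End Rank2.

Section Rank3.
Variables L N : {group gT}.
Hypothesis p2 : p = 2%N.
Hypotheses (invL : Ginv L) (invN : Ginv N) (sNL : N \subset L).
Hypotheses (idxTL : #|T : L| = 2%N) (idxLN : #|L : N| = 2%N) (cardN : #|N| = 2%N).
Hypothesis abT : forall a b : gT, commute a b.
Hypothesis sqL : forall a, a \in L -> (a ^+ 2)%g = 1%g.
Hypothesis sqT : forall a, (a ^+ 2)%g \in N.
Hypothesis ncTN : ~ cent_over T N.
Hypothesis ncL1 : ~ cent_over L 1%G.

Let pr2 : prime 2. Proof. by []. Qed.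
Let idxN1 : #|N : 1%G| = 2%N. Proof. by rewrite indexg1. Qed.
Let inv1' : Ginv 1%G. Proof. exact: inv1. Qed.
Let cTL : cent_over T L.
Proof.
exact: (index_p_cent iM i_inj i_im p_pr pgT fixed (@invT _ _ i) invL (subsetT _) (etrans idxTL (esym p2))).
Qed.
Let cLN : cent_over L N.
Proof. exact: (index_p_cent iM i_inj i_im p_pr pgT fixed invL invN sNL (etrans idxLN (esym p2))). Qed.
Let cN1 : cent_over N 1%G.
Proof. exact: (index_p_cent iM i_inj i_im p_pr pgT fixed invN inv1' (sub1G _) (etrans idxN1 (esym p2))). Qed.
Let nLT := inv_normal iM i_inj i_im invL (subsetT L).
Let nNL := inv_normal iM i_inj i_im invN sNL.
Let n1N := inv_normal iM i_inj i_im inv1' (sub1G N).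

Let cover b c d : b \in T :\: L -> c \in L :\: N -> d \in N :\: 1%G ->
  uniq (prods (prods (powers 2 (i b)) (powers 2 (i c))) (powers 2 (i d))).
Proof.
move=> Db Dc Dd; rewrite !map_powers // !map_prods // map_inj_uniq //; apply: uniq_cover.
  move=> a.
  have [j [l [lt_j Ll ->]]] := prime_index_gen_lt pr2 nLT idxTL Db (in_setT a).
  have [k [n [lt_k Nn ->]]] := prime_index_gen_lt pr2 nNL idxLN Dc Ll.
  have [m [o [lt_m /set1P -> ->]]] := prime_index_gen_lt pr2 n1N idxN1 Dd Nn.
  by rewrite mulg1 mulgA; apply: mem_prods; [apply: mem_prods|]; apply: mem_powers.
rewrite !size_allpairs !size_map !size_iota -cardsT -(Lagrange (subsetT L)) idxTL.
by rewrite -(Lagrange sNL) idxLN cardN.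
Qed.

(** Every g acting trivially on T/N fixes c, as a comparison of b^(xg) and b^(gx) shows; in
    particular y does. If x fixed c as well, so would all of G, since any g becomes trivial on T/N
    after multiplication by a power of x; then G would centralise L. *)
Lemma seed_rank3 : exists x y b c, [/\ i b = [~ x, y]%g, i c = [~ i b, x]%g,
  b \in T :\: L, c \in L :\: N & [/\ kg b y \in N, kg c y = 1%g & kg c x <> 1%g]].
Proof.
have [x [y [b [c [bE Lb cE Dc [Ay nAx adj]]]]]] :=
  seed iM i_inj i_im pr2 invL invN sNL idxTL idxLN cTL cLN ncTN.
have [Lc _] := setDP Dc.
have fixN n g : n \in N -> cj g n = n.
  by move=> Nn; have /set1P := cN1 g Nn; rewrite kgEcj => /eqP; rewrite mulg_eq1 => /eqP/invg_inj.
(* [x] and [g] commute modulo the derived subgroup, which is abelian *)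
have Ac g : acts_trivially i N g -> kg c g = 1%g.
  move=> Ag; have bc : cj x b = (b * c)%g by rewrite cE -cj_kg.
  have E : cj g (cj x b) = cj x (cj g b).
    rewrite -!cj_mul // (commgC x g) cj_mul //.
    have [t <-] := comm_iE i_im x g.
    by rewrite (cj_i iM i_inj i_im) /conjg [(_ * t)%g]abT mulKg.
  have [n Nn gb] : exists2 n, n \in N & cj g b = (b * n)%g.
    by exists (kg b g); [apply: Ag|rewrite -cj_kg].
  move: E; rewrite bc !(cjM iM i_inj i_im) gb !(cjM iM i_inj i_im) bc (fixN _ _ Nn) -!mulgA => /mulgI.
  by rewrite [(c * n)%g]abT => /mulgI cgc; rewrite kgEcj cgc mulVg.
exists x, y, b, c; split=> //; first by rewrite cE kgE.
  by rewrite inE Lb in_setT.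
split=> //; first exact: Ac.
move=> cx; apply: ncL1 => l g Ll.
have cg : kg c g = 1%g.
  have [j /Ac] := adj g; rewrite kgMr //.
  have -> : kg c (x ^+ j)%g = 1%g.
    apply: i_inj; rewrite (kgE iM i_im) (i1 iM); apply/eqP/commgP/commuteX/commgP.
    by rewrite -kgE // cx i1.
  by rewrite mul1g => /eqP E; apply: (cj_inj i_inj i_im (g := (x ^+ j)%g)); rewrite (eqP E) -{1}(mulg1 1%g); apply: i_inj; rewrite cjE // mulg1 i1 // conj1g.
have [j [n [Nn ->]]] := prime_index_gen pr2 nNL idxLN Dc Ll.
apply/set1P; rewrite kgMl // [kg n g]kgEcj fixN // mulVg mulg1.
rewrite (_ : kg (c ^+ j)%g g = 1%g) ?conj1g //.
apply: i_inj; rewrite kgE // i1 // iX //; apply/eqP/commgP/commute_sym/commuteX/commute_sym/commgP.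
by rewrite -kgE // cg i1.
Qed.

(** The leading term BCD has weight 1 + 2 + 3 = 6, the top weight, and everything of weight 7 is
    zero. *)
Lemma lower_long : ~ lie_power_zero R 7%N.
Proof.
move=> /lie_power_zeroP Z.
have [x [y [b [c [bE cE Db Dc [bY cY cX]]]]]] := seed_rank3.
have [Lc _] := setDP Dc; have K2 : 2%:R = 0 :> K by rewrite -p2; apply: pcharf0 pcharK.
set d := kg c x in cX; have dE : i d = [~ i c, x]%g by rewrite kgE.
have Nd : d \in N by apply: cLN.
have Dd : d \in N :\: 1%G by rewrite !inE Nd andbT; apply/eqP.
have sq a : (e (i a) - 1) * (e (i a) - 1) = e (i (a ^+ 2)%g) - 1.
  by have := esub1_expr_pchar e1 eM (i a) pcharK; rewrite {1 2}p2 expr2 -iX.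
have ccent : central_chain i [:: L; N] 1%G.
  exact: (chain123 iM i_inj i_im pcharK pgT fixed p2 invL invN inv1' sNL (sub1G _) idxTL idxLN idxN1).
have by3 : chain_fam i [:: L; N] 1%G 3 [~ [~ x, y], y]%g.
  by rewrite -bE; exists (kg b y); rewrite // kgE.
have FBB : wfilt e (aug e (iG 1%G)) (chain_fam i [:: L; N] 1%G) 3 ((e (i b) - 1) * (e (i b) - 1)).
  by rewrite sq; apply: wfilt_mem; exists (b ^+ 2)%g.
have DD : (e (i d) - 1) * (e (i d) - 1) = 0.
  by rewrite sq sqL ?i1 ?e1 ?subrr // (subsetP sNL).
have F := lcomm_char2_long e1 eM espan (aug_ideal e (iG 1%G))
  (chain_fam_conj i_im ccent) (chain_fam_comm1 i_im [:: L; N] 1%G)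
  (chain_fam_commS iM i_im ccent) (chain_fam_subgroup iM [:: L; N] 1%G) by3 K2.
rewrite -bE -cE -dE in F.
have dfix g : kg d g = 1%g by apply/set1P; apply: cN1.
have := F (e_comm (abT _ _)) FBB DD (e_comm (abT _ _))
  (e_fix cY) (e_fix (dfix x)) (e_fix (dfix y)).
rewrite Z sub0r => {}F.
have abT1 a a' : [~ a, a']%g \in (1%G : {group gT}) by apply/set1P/eqP/commgP/abT.
have sqL1 a : a \in L -> (a ^+ 2)%g \in (1%G : {group gT}) by move/sqL ->; rewrite group1.
have /(aug1 e1 iM)/eqP := wfilt_step123 e1 eM iM i_inj i_im pcharK p2 invL invN inv1' sNL (sub1G _)
  idxTL idxLN idxN1 abT1 sqL1 F.
rewrite oppr_eq0 => /eqP.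
have := sub1_mul3_neq0 e1 eM elin (g := (x * y * x * x * y * (x * y) * x)%g) (p := 2%N) _ (cover Db Dc Dd).
by rewrite !expr1 -p2; apply.
Qed.

End Rank3.
End Lower.

Section LowerMore.
Local Open Scope group_scope.
Variables (K : fieldType) (G : groupType) (R : algType K) (e : G -> R).
Hypothesis e1 : e 1%g = 1%R.
Hypothesis eM : forall x y, (e (x * y)%g = e x * e y)%R.
Hypothesis espan : forall r : R, exists (s : seq G) (c : G -> K),
  (r = \sum_(g <- s) c g *: e g)%R.
Hypothesis elin : forall (s : seq G) (c : G -> K), uniq s ->
  (\sum_(g <- s) c g *: e g = 0)%R -> forall g, g \in s -> (c g = 0)%R.
Variables (gT : finGroupType) (i : gT -> G).
Hypothesis iM : {morph i : x y / (x * y)%g}.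
Hypothesis i_inj : injective i.
Hypothesis i_im : forall x, gamma G 2 x <-> exists a, x = i a.
Variable p : nat.
Hypothesis pcharK : p \in [pchar K]%R.
Let p_pr : prime p := pcharf_prime pcharK.
Hypothesis pgT : p.-group [set: gT].
Local Notation Ginv := (Ginv i).
Local Notation kg := (kg i).
Local Notation cj := (cj i).
Local Notation cent_over := (cent_over i).
Local Notation iG := (iG i).
Local Notation T := [set: gT]%G.
Hypothesis fixed : forall (M N : {group gT}), Ginv M -> Ginv N -> N \proper M ->
  exists2 z, z \in M :\: N & forall g, kg z g \in N.

(* If R^[3] = 0 and [x, y] <> 1, then [y, z] is 1 or [x, y] for every z. For
   independent commutators u = [x, y] and v = [k, l] this gives [xk, yl] = uv,
   and then [yl, x] = u is neither 1 nor uv. *)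
Lemma lower_class2 : p = 2 -> cent_over T 1 -> (forall a : gT, a ^+ 2 = 1) ->
  2 < #|gT| -> ~ lie_power_zero R 3.
Proof.
move=> p2 cT1 sq big /lie_power_zeroP Z.
have cent (x y g : G) : commute [~ x, y] g.
  have [b <-] := comm_iE i_im x y; apply/commgP; rewrite -kgE //.
  by have /set1P -> := cT1 b g (in_setT b); rewrite i1.
have fixc (x y g : G) : [~ x, y] ^ g = [~ x, y].
  by apply/conjg_fixP/commgP/cent.
have ml (x y g : G) : [~ x * y, g] = [~ x, g] * [~ y, g].
  by rewrite commgMl fixc.
have mr (x g h : G) : [~ x, g * h] = [~ x, h] * [~ x, g].
  by rewrite commgMr fixc.
have csq (x y : G) : [~ x, y] * [~ x, y] = 1.
  by have [b <-] := comm_iE i_im x y; rewrite -iM -expg2 sq i1.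
have csym (x y : G) : [~ y, x] = [~ x, y].
  by rewrite -invgR; apply/eqP; rewrite eqg_invLR -mulg_eq1 csq.
(* Otherwise 1, u, v and vu are distinct and the word [x, y, z] is nonzero in R. *)
have step (x y z : G) : [~ x, y] != 1 -> [~ y * x, z] = 1 \/ [~ y * x, z] = [~ x, y].
  move=> u1; set u := [~ x, y]; set v := [~ y * x, z].
  have [->|v1] := eqVneq v 1; first by left.
  have [->|vu] := eqVneq v u; first by right.
  have p2K : 2 \in [pchar K]%R by rewrite -p2.
  case: (lcomm_class2_neq0 e1 eM elin (x := x) (y := y) (z := z) p2K) => //.
  rewrite -/u -/v /= !inE !negb_or ![1 == _]eq_sym u1 v1 [u == v]eq_sym vu !andbT /=.
  apply/andP; split; [|apply/andP; split].
  - by apply: contra vu; rewrite mulg_eq1 -[u in v == u^-1](mulgK u) /u csq mul1g invgK.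
  - by apply: contra v1; rewrite -{1}[u]mul1g => /eqP/mulIg <-.
  - by apply: contra u1; rewrite -/u -{1}[v]mulg1 => /eqP/mulgI <-.
(* Replace y by yx in the previous claim: [x, yx] = [x, y], and [yxx, z] = [y, z] because
   commutators square to 1. *)
have P (x y z : G) : [~ x, y] != 1 -> [~ y, z] = 1 \/ [~ y, z] = [~ x, y].
  move=> u1; have xyx : [~ x, y * x] = [~ x, y] by rewrite mr commgg mul1g.
  have := @step x (y * x) z; rewrite xyx => /(_ u1).
  by rewrite ml ml -mulgA csq mulg1.
have [x [y [b [bE b1]]]] : exists x y b, i b = [~ x, y] /\ b \notin (1%G : {group gT}).
  apply: (comm_notin iM i_inj i_im); rewrite properE sub1G /=.
  apply: contraL big => /subset_leq_card; rewrite cards1 cardsT => H; rewrite -leqNgt.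
  exact: leq_trans H _.
have [k [l [a [aE ab]]]] : exists x y a, i a = [~ x, y] /\ a \notin <[b]>%G.
  apply: (comm_notin iM i_inj i_im); rewrite properE subsetT /=.
  apply: contraL big => /subset_leq_card; rewrite -leqNgt cardsT => /leq_trans; apply.
  by rewrite -orderE dvdn_leq // order_dvdn sq.
set u := [~ x, y] in bE; set v := [~ k, l] in aE.
have u1 : u != 1 by rewrite -bE -(i1 iM) (inj_eq i_inj); move: b1; rewrite inE.
have v1 : v != 1.
  by rewrite -aE -(i1 iM) (inj_eq i_inj); apply: contraNneq ab => ->; apply: group1.
have uv : u != v.
  by rewrite -bE -aE (inj_eq i_inj); apply: contraNneq ab => <-; apply: cycle_id.
have both (s t : G) : [~ s, t] = 1 \/ [~ s, t] = u -> [~ s, t] = 1 \/ [~ s, t] = v -> [~ s, t] = 1.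
  by move=> [//|->] [//|E]; case/eqP: uv.
have yx : [~ y, x] = u by rewrite csym.
have lk : [~ l, k] = v by rewrite csym.
have xk : [~ x, k] = 1.
  apply: both; first by rewrite -yx; apply: P; rewrite yx.
  by rewrite csym -lk; apply: P; rewrite lk.
have xl : [~ x, l] = 1.
  apply: both; first by rewrite -yx; apply: P; rewrite yx.
  by rewrite csym; apply: P.
have yk : [~ y, k] = 1.
  apply: both; first by apply: P.
  by rewrite csym -lk; apply: P; rewrite lk.
have yl : [~ y, l] = 1.
  apply: both; first by apply: P.
  by rewrite csym; apply: P.
have w : [~ x * k, y * l] = u * v.
  by rewrite ml !mr xl [[~ k, y]]csym yk mul1g mulg1.
have w1 : [~ x * k, y * l] != 1.
  rewrite w mulg_eq1; apply: contra uv => /eqP ->.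
  by rewrite eqg_invLR -mulg_eq1 /v csq.
have := P _ _ x w1; rewrite w ml yx csym xl mulg1 => -[E|].
  by move: u1; rewrite E eqxx.
by rewrite -{1}[u]mulg1 => /mulgI E; move: v1; rewrite -E eqxx.
Qed.

(** In a cyclic p-group a proper subgroup has order dividing that of the subgroup M of index p,
    hence lies in M. *)
Lemma cyclic_prime_index_gen (M : {group gT}) b : cyclic T -> #|T : M| = p ->
  b \notin M -> <[b]> = T.
Proof.
move=> cT idx Mb; have [k Tk] := p_natP pgT.
apply/eqP; rewrite eqEcard subsetT /=; rewrite leqNgt; apply: contra Mb => lt_b.
rewrite -cycle_subG -(cardSg_cyclic cT) ?subsetT //.
have : p.-nat #|<[b]>| := pgroupS (subsetT _) pgT.
case/p_natP=> j bj; have := Lagrange (subsetT M); rewrite idx.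
case: k Tk => [|k] Tk.
  by rewrite Tk expn0 in lt_b; move: lt_b; rewrite ltnNge cardG_gt0.
rewrite Tk expnSr => /eqP; rewrite eqn_pmul2r ?prime_gt0 // => /eqP ->.
move: lt_b; rewrite bj Tk ltn_exp2l ?prime_gt1 // ltnS; exact: dvdn_exp2l.
Qed.

(** A commutator b = [x, y] outside the invariant subgroup of index p generates G'. The Engel word
    in x, y works if [b, y] is a q-th power of b with q > 2. For odd p, q = p will do. For p = 2, q
    = 4 is needed: with b^x = b^(2j + 1) and b^y = b^(2l + 1), take y if l is even, exchange x and y
    if j is even, and otherwise use yx, since (2j + 1)(2l + 1) = 1 modulo 4. *)
Lemma lower_cyclic : cyclic T -> ~ lie_power_zero R #|gT|.
Proof.
move=> cT; have [k Tk] := p_natP pgT; rewrite cardsT in Tk.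
have [T1|T1] := eqVneq [set: gT] 1.
  have -> : #|gT| = 1%N by rewrite -cardsT T1 cards1.
  move/lie_power_zeroP/(_ (fun=> e 1)) => /= e0.
  by apply: (esum_neq0 elin (s := [:: 1])) => //; rewrite /esum big_seq1.
have [M [invM pMT idx cTM]] := chain_down iM i_inj i_im p_pr pgT fixed (@invT _ _ i) T1.
have [x0 [y0 [b0 [b0E Mb0]]]] := comm_notin iM i_inj i_im pMT.
have nMT := inv_normal iM i_inj i_im invM (subsetT M).
have gen b : b \notin M -> forall a, exists j, a = b ^+ j.
  move=> Mb a; have : a \in <[b]> by rewrite (cyclic_prime_index_gen cT idx Mb) inE.
  by case/cycleP => j ->; exists j.
have kgp b g : b \notin M -> exists j, kg b g = b ^+ (p * j).
  move=> Mb; have [j jE] := gen b Mb (kg b g).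
  have Db : b \in T :\: M by rewrite inE Mb in_setT.
  have : kg b g \in M by apply: cTM; rewrite inE.
  rewrite jE (prime_index_expg p_pr nMT idx _ Db) => /dvdnP[m ->].
  by exists m; rewrite mulnC.
suff [x [y [b [q [a]]]]] : exists x y b q a, [/\ i b = [~ x, y], b \notin M, q = (p ^ a)%N, 2 < q
    & exists j, kg b y = b ^+ (q * j)].
  case=> bE Mb qE q2 [j yj]; rewrite Tk -(prednK (n := p ^ k)) ?expn_gt0 ?prime_gt0 //.
  move/lie_power_zeroP/(_ (fun m => if m is 0 then e x else e y)).
  have powE g h : exists m, [~ g, h] = [~ x, y] ^+ m.
    have [c <-] := comm_iE i_im g h; have [m ->] := gen b Mb c.
    by exists m; rewrite iX // bE.
  apply: (lcomm_cyclic_neq0 e1 eM elin espan pcharK (q := q)) => //.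
  - by exists a.
  - by move=> g; have [m mE] := kgp b g Mb; exists m; rewrite -bE -kgE // mE iX.
  - by exists j; rewrite -bE -kgE // yj iX.
  - by rewrite -bE -iX // -Tk -cardsT expg_cardG ?inE // i1.
  - rewrite -bE -/(powers _ _) map_powers // map_inj_uniq //; apply: uniq_cover.
      move=> c; have [m ->] := gen b Mb c.
      rewrite -(expg_mod_order b) mem_powers // -Tk -cardsT -(cyclic_prime_index_gen cT idx Mb) -orderE.
      by rewrite ltn_pmod ?order_gt0.
    by rewrite size_map size_iota Tk.
have [p_odd|] := ltnP 2 p.
  have [j y0j] := kgp b0 y0 Mb0.
  by exists x0, y0, b0, p, 1%N; split=> //; exists j.
move=> le_p2; have p2 : p = 2 by apply/eqP; rewrite eqn_leq le_p2 prime_gt1.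
suff [x [y [b [bE Mb yj]]]] : exists x y b, [/\ i b = [~ x, y], b \notin M
    & exists j, kg b y = b ^+ (4 * j)].
  by exists x, y, b, 4, 2; split=> //; rewrite p2.
have [j xE] := kgp b0 x0 Mb0; have [l yE] := kgp b0 y0 Mb0; rewrite p2 in xE yE.
have half (n m : nat) : odd n = false -> m = (2 * n)%N -> m = (4 * n./2)%N by lia.
case ol: (odd l); last first.
  by exists x0, y0, b0; split=> //; exists l./2; rewrite yE -(half l _ ol (erefl _)).
case oj: (odd j); last first.
  exists y0, x0, b0^-1; split; [by rewrite iV // b0E invgR|by rewrite groupV|].
  exists j./2; rewrite -(half j _ oj (erefl _)).
  have -> : kg b0^-1 x0 = (kg b0 x0)^-1.
    have cV : cj x0 b0^-1 = (cj x0 b0)^-1 by apply: i_inj; rewrite cjE // !iV // cjE // conjVg.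
    by rewrite kgEcj cV invMg invgK (centsP (cyclic_abelian cT)) ?inE.
  by rewrite xE expVgn.
have xb : cj x0 b0 = b0 ^+ (2 * j).+1 by rewrite cj_kg xE expgS.
have yb : cj y0 b0 = b0 ^+ (2 * l).+1 by rewrite cj_kg yE expgS.
(* The commutator changes only by conjugation: [x, yx] = [x, y]^x. *)
exists x0, (y0 * x0), (cj x0 b0); split.
- by rewrite cjE // b0E commgMr commgg mul1g.
- by rewrite cj_kg groupMr //; apply: cTM; rewrite inE.
set c := cj x0 b0 in xb *; exists (2 * j * l + j + l)./2%N.
have -> : kg c (y0 * x0) = c^-1 * c ^+ ((2 * l).+1 * (2 * j).+1).
  by rewrite kgEcj cj_mul // {2}xb !cjX // yb cjX // -/c expgnA.
have -> : ((2 * l).+1 * (2 * j).+1 = (4 * (2 * j * l + j + l)./2).+1)%N by lia.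
by rewrite expgS mulKg.
Qed.

End LowerMore.

(** * The exceptional cases *)

Section ModelGroups.
Local Open Scope group_scope.
Variables (G : groupType) (gT : finGroupType) (i : gT -> G).
Hypothesis iM : {morph i : x y / x * y}.
Hypothesis i_inj : injective i.
Hypothesis i_im : forall x, gamma G 2 x <-> exists a, x = i a.
Local Notation Ginv := (Ginv i).
Local Notation kg := (kg i).
Local Notation cj := (cj i).
Local Notation cent_over := (cent_over i).
Local Notation iG := (iG i).
Local Notation T := [set: gT]%G.

Lemma has_order_model (A : G -> Prop) (M : {group gT}) m :
  (forall x, A x <-> iG M x) -> has_order A m <-> #|M| = m.
Proof.
move=> AM; split=> [[s [Us <- sA]]|<-].
  rewrite cardE -(size_map i); apply/perm_size/uniq_perm => //.
    by rewrite map_inj_uniq ?enum_uniq.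
  move=> x; apply/mapP/idP => [[a]|/sA/AM[a Ma ->]].
    by rewrite mem_enum => Ma ->; apply/sA/AM; exists a.
  by exists a; rewrite ?mem_enum.
exists (map i (enum M)); split; first by rewrite map_inj_uniq ?enum_uniq.
  by rewrite size_map -cardE.
move=> x; split=> [/AM[a Ma ->]|/mapP[a]]; first by rewrite map_f ?mem_enum.
by rewrite mem_enum => Ma ->; apply/AM; exists a.
Qed.

Lemma gamma2_model x : gamma G 2 x <-> iG T x.
Proof.
by split=> [/i_im[a ->]|[a _ ->]]; [exists a; rewrite ?inE|apply/i_im; exists a].
Qed.

Lemma cyclic_model : cyclic_sub (gamma G 2) <-> cyclic T.
Proof.
split=> [[g [/i_im[b ->] gen]]|/cyclicP[b Tb]].
  apply/cyclicP; exists b; apply/eqP; rewrite eqEsubset subsetT andbT.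
  apply/subsetP => a _; have [|k] := gen (i a); first by apply/i_im; exists a.
  case; rewrite -(iX iM); first by move/i_inj ->; rewrite mem_cycle.
  by rewrite -(iV iM) => /i_inj ->; rewrite groupV mem_cycle.
exists (i b); split; first by apply/i_im; exists b.
move=> x /i_im[a ->]; have : a \in <[b]> by rewrite -Tb inE.
by case/cycleP => k ->; exists k; left; rewrite iX.
Qed.

Lemma iso_card (H : groupType) (A : H -> Prop) a b : 0 < a -> 0 < b ->
  iso_Ca_x_Cb A a b -> has_order A (a * b).
Proof.
move=> a0 b0 [f [fM fE fA]].
have fmod j k : f j k = f (j %% a) (k %% b) by apply/fE; rewrite !modn_mod.
exists [seq f j k | j <- iota 0 a, k <- iota 0 b]; split.
- apply: allpairs_uniq; rewrite ?iota_uniq // => -[j k] [j' k'].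
  move=> /allpairsP[[j1 k1] /= [+ + [-> ->]]] /allpairsP[[j2 k2] /= [+ + [-> ->]]].
  rewrite !mem_iota /= !add0n => *.
  have [] : j1 = j2 %[mod a] /\ k1 = k2 %[mod b] by apply/fE.
  by rewrite !modn_small // => -> ->.
- by rewrite size_allpairs !size_iota.
- move=> x; split=> [/fA[j [k <-]]|/allpairsP[[j k] /= [_ _ ->]]]; last first.
    by apply/fA; exists j, k.
  by rewrite fmod; apply/allpairsP; exists (j %% a, k %% b); rewrite !mem_iota !ltn_pmod.
Qed.

Lemma iso_abelian (H : groupType) (A : H -> Prop) a b : iso_Ca_x_Cb A a b -> abelian_sub A.
Proof.
by move=> [f [fM _ fA]] x y /fA[j [k <-]] /fA[j' [k' <-]]; rewrite !fM addnC [(k + _)%N]addnC.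
Qed.

Lemma iso_exponent (H : groupType) (A : H -> Prop) a x : iso_Ca_x_Cb A a a -> A x -> x ^+ a = 1.
Proof.
move=> [f [fM fE fA]] /fA[j [k <-]].
have f0 : f 0 0 = 1 by apply: (mulgI (f 0 0)); rewrite fM mulg1.
have -> : f j k ^+ a = f (a * j)%N (a * k)%N.
  by elim: a {fE} => [|a IH]; rewrite ?expg0 ?f0 // expgS IH fM -!mulSn.
by rewrite -f0; apply/fE; rewrite !modnMr mod0n.
Qed.

Lemma iso_model (A : G -> Prop) (M : {group gT}) x y a b :
  0 < a -> 0 < b -> (forall z, A z <-> iG M z) ->
  commute x y -> x ^+ a = 1 -> y ^+ b = 1 ->
  (forall j k, x ^+ j * y ^+ k = 1 -> a %| j /\ b %| k) ->
  (forall c, c \in M <-> exists j k, c = x ^+ j * y ^+ k) -> iso_Ca_x_Cb A a b.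
Proof.
move=> a0 b0 AM xy xa yb ker gen; exists (fun j k => i (x ^+ j * y ^+ k)).
have fM j k j' k' : x ^+ j * y ^+ k * (x ^+ j' * y ^+ k') = x ^+ (j + j')%N * y ^+ (k + k')%N.
  by rewrite !expgnDr -!mulgA; congr (_ * _); rewrite !mulgA (commuteX2 _ _ xy).
have expmod (z : gT) n j : z ^+ n = 1 -> z ^+ j = z ^+ (j %% n).
  by move=> zn; rewrite {1}(divn_eq j n) mulnC expgnDr expgnA zn expg1n mul1g.
have eqmod n j j' : 0 < n -> n %| (j + n.-1 * j')%N -> j = j' %[mod n].
  move=> n0 /dvdnP[m E]; rewrite -(modnMDl j' j n) -(modnMDl m j' n) -E; congr (_ %% _).
  by case: n n0 {E} => // n _; lia.
split.
- by move=> *; rewrite -iM fM.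
- move=> j k j' k'; split=> [/i_inj E|[ja kb]].
    (* Exponents are natural numbers, so j + (a - 1) j' stands for j - j' modulo a. *)
    have [] := ker (j + a.-1 * j')%N (k + b.-1 * k')%N.
      rewrite -fM E fM -!mulSn !prednK // [(a * _)%N]mulnC [(b * _)%N]mulnC !expgnA.
      by rewrite [x ^+ j' ^+ a]expgnAC xa [y ^+ k' ^+ b]expgnAC yb !expg1n mulg1.
    by move=> /(eqmod _ _ _ a0) -> /(eqmod _ _ _ b0) ->.
  by congr i; rewrite (expmod _ _ j xa) (expmod _ _ j' xa) ja (expmod _ _ k yb) (expmod _ _ k' yb) kb.
- move=> z; split=> [/AM[c /gen[j [k ->]] ->]|[j [k <-]]]; first by exists j, k.
  by apply/AM; exists (x ^+ j * y ^+ k) => //; apply/gen; exists j, k.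
Qed.

Lemma lcs_in k (M N : {group gT}) : cent_over M N ->
  (forall x, lcs G k x -> iG M x) -> forall x, lcs G k.+1 x -> iG N x.
Proof.
move=> cMN sM; apply: lcs_min; first exact: iG_subgroup.
by move=> x g /sM[a Ma ->]; exists (kg a g); [apply: cMN|rewrite kgE].
Qed.

Fact lcs_set_group k : group_set [set a | `[< lcs G k (i a) >]].
Proof.
have sk := lcs_subgroup G k; apply/group_setP; split.
  by rewrite inE; apply/asboolP; rewrite i1 //; apply: subgroup1 sk.
move=> a b; rewrite !inE => /asboolP ka /asboolP kb; apply/asboolP; rewrite iM.
exact: (subgroupM sk).
Qed.
Definition lcs_grp k : {group gT} := Group (lcs_set_group k).

Lemma lcs_grpP k a : reflect (lcs G k (i a)) (a \in lcs_grp k).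
Proof. by rewrite inE; apply: asboolP. Qed.

Lemma lcs_grp_inv k : Ginv (lcs_grp k).
Proof. by move=> a g /lcs_grpP ka; apply/lcs_grpP; rewrite cjE //; apply: lcs_conj. Qed.

Lemma lcs_grp_cent k : cent_over (lcs_grp k) (lcs_grp k.+1).
Proof. by move=> a g /lcs_grpP ka; apply/lcs_grpP; rewrite kgE //; apply: lcs_comm. Qed.

Lemma lcs_grp_sub k : lcs_grp k.+1 \subset lcs_grp k.
Proof. by apply/subsetP => a /lcs_grpP/lcs_sub ka; apply/lcs_grpP. Qed.

Lemma lcs_grp1 : lcs_grp 1 :=: T.
Proof.
apply/setP => a; rewrite [in RHS]inE; apply/lcs_grpP.
by apply/i_im; exists a.
Qed.

Lemma lcs_grpE k x : 0 < k -> lcs G k x <-> iG (lcs_grp k) x.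
Proof.
move=> k0; split=> [kx|[a /lcs_grpP ka ->] //].
have /i_im[a xa] : lcs G 1 x by apply: lcs_mono kx.
by exists a => //; apply/lcs_grpP; rewrite -xa.
Qed.

(** A repeated term would make the series constant from there on, hence trivial before the step
    prescribed by the class. *)
Lemma lcs_grp_proper c k : nil_class G c -> 0 < k < c -> lcs_grp k.+1 \proper lcs_grp k.
Proof.
move=> [tc ntc] /andP[k0 lt_kc]; rewrite properE lcs_grp_sub; apply/negP => sk.
have const m x : lcs G k x -> lcs G (k + m) x.
  elim: m x => [|m IH] x kx; first by rewrite addn0.
  have /(lcs_grpE _ k0)[a ka ->] := kx.
  have /lcs_grpP := subsetP sk _ ka; rewrite addnS; move: (i a).
  apply: lcs_min; first exact: lcs_subgroup.
  by move=> y g /IH; apply: lcs_comm.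
apply: (ntc k lt_kc) => x kx; apply: tc; rewrite /gamma /=.
by rewrite -(subnKC (ltnW lt_kc)); apply: const.
Qed.

Lemma lcs_grp_top c : nil_class G c -> 0 < c -> lcs_grp c :=: 1.
Proof.
move=> [tc _] c0; apply/trivgP/subsetP => a /lcs_grpP/tc; rewrite inE => E.
by apply/eqP/i_inj; rewrite i1.
Qed.

Lemma nil_class_model c : 0 < c -> (forall x, lcs G c x -> x = 1) -> 
  ~ (forall x, lcs G c.-1 x -> x = 1) -> nil_class G c.
Proof.
case: c => // c _ tc ntc; split=> // k lt_kc tk; apply: ntc => x cx; apply: tk.
exact: lcs_mono cx.
Qed.

End ModelGroups.

(** * Quotients of order 8 of the commutator subgroup *)

Section Index8.
Local Open Scope group_scope.
Variables (G : groupType) (gT : finGroupType) (i : gT -> G).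
Hypothesis iM : {morph i : x y / x * y}.
Hypothesis i_inj : injective i.
Hypothesis i_im : forall x, gamma G 2 x <-> exists a, x = i a.
Local Notation Ginv := (Ginv i).
Local Notation kg := (kg i).
Local Notation cj := (cj i).
Local Notation cent_over := (cent_over i).
Local Notation iG := (iG i).
Local Notation T := [set: gT]%G.
Variables L N N2 : {group gT}.
Hypotheses (invL : Ginv L) (invN : Ginv N) (invN2 : Ginv N2).
Hypotheses (sNL : N \subset L) (sN2N : N2 \subset N).
Hypotheses (idxTL : #|T : L| = 2) (idxLN : #|L : N| = 2) (idxNN2 : #|N : N2| = 2).
Hypotheses (cTL : cent_over T L) (cLN : cent_over L N) (cNN2 : cent_over N N2).
Hypothesis sqT : forall a, a ^+ 2 \in N.
Hypothesis ncTN : ~ cent_over T N.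

Let pr2 : prime 2. Proof. by []. Qed.
Let nLT := inv_normal iM i_inj i_im invL (subsetT L).
Let nNL := inv_normal iM i_inj i_im invN sNL.
Let nNT := inv_normal iM i_inj i_im invN (subsetT N).
Let nN2N := inv_normal iM i_inj i_im invN2 sN2N.
Let nN2 (a : gT) : a \in 'N(N2).
Proof. by apply: (subsetP (normal_norm (inv_normal iM i_inj i_im invN2 (subsetT N2)))); rewrite inE. Qed.
Local Notation f := (coset N2).

Let fM a b : f (a * b) = f a * f b. Proof. exact: morphM. Qed.
Let fV a : f a^-1 = (f a)^-1. Proof. exact: morphV. Qed.
Let fX a n : f (a ^+ n) = f a ^+ n. Proof. exact: morphX. Qed.
Let f1 a : f a = 1 -> a \in N2. Proof. exact: coset_idr. Qed.
Let f0 a : a \in N2 -> f a = 1. Proof. exact: coset_id. Qed.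

Let NN2 a b : a \in N -> b \in N -> f a * f b = f b * f a.
Proof.
move=> Na Nb; have [x Dx] := prime_index_ex pr2 idxNN2.
have [j [n [Nn ->]]] := prime_index_gen pr2 nN2N idxNN2 Dx Na.
have [k [m [Nm ->]]] := prime_index_gen pr2 nN2N idxNN2 Dx Nb.
by rewrite !fM (f0 Nn) (f0 Nm) !mulg1 !fX; apply: commuteX2.
Qed.

Let fcjN n g : n \in N -> f (cj g n) = f n.
Proof. by move=> Nn; rewrite cj_kg fM (f0 (cNN2 g Nn)) mulg1. Qed.

Let fkgM l g h : l \in L -> f (kg l (g * h)) = f (kg l h) * f (kg l g).
Proof. by move=> Ll; rewrite kgMr // fM fcjN //; apply: cLN. Qed.

(** Modulo [N2], x -> [l, x] is a homomorphism from G to the abelian group N/N2, so it kills the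
    commutator subgroup. *)
Let L_central l a : l \in L -> f l * f a = f a * f l.
Proof.
move=> Ll.
have kgR x y : kg l [~ x, y] \in N2.
  apply: f1; have := fkgM x y Ll.
  rewrite commgC fkgM // fkgM // (NN2 (cLN x Ll) (cLN y Ll)) => E.
  by apply: (mulIg (f (kg l y) * f (kg l x))); rewrite mul1g.
have : kg l (i a) \in N2.
  have : lcs G 1 (i a) by apply/i_im; exists a.
  move: (i a); apply: lcs_min.
    split; first by rewrite (_ : kg l 1 = 1) ?group1 //; apply: i_inj; rewrite kgE // commg1 i1.
    move=> x y Kx Ky; have E := fkgM (x * y^-1) y Ll; rewrite mulgKV (f0 Kx) (f0 Ky) mul1g in E.
    exact: f1.
  by move=> x y _; apply: kgR.
rewrite kg_i // => /f0; rewrite commgEl conjgE !fM !fV => E.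
by move: E; rewrite mulgA -invMg => /mulg1_eq; rewrite invgK.
Qed.

(** L/N2 is central in T/N2 with cyclic quotient. *)
Lemma index8_abelian a b : [~ a, b] \in N2.
Proof.
have [x Dx] := prime_index_ex pr2 idxTL.
have [j [l [Ll ->]]] := prime_index_gen pr2 nLT idxTL Dx (in_setT a).
have [k [m [Lm ->]]] := prime_index_gen pr2 nLT idxTL Dx (in_setT b).
apply: f1; rewrite /= (morphR (coset_morphism N2)) ?nN2 //=; apply/eqP/commgP.
have lx n c : c \in L -> commute (f c) (f x ^+ n) by move=> Lc; apply: commuteX; apply: L_central.
have lm : commute (f l) (f m) by apply: L_central.
rewrite !fM !fX; apply: commuteM; apply: commute_sym; apply: commuteM.
- exact: commuteX2.
- exact: commute_sym (lx _ _ Ll).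
- exact: lx.
- exact: commute_sym.
Qed.

Let fcomm a b : commute (f a) (f b).
Proof.
by apply/commgP; rewrite -(morphR (coset_morphism N2)) ?nN2 //= f0 // index8_abelian.
Qed.

(** Suppose l^2 is not in [N2]. If a^2 is in [N2], so is the square of u = [a, g]; were u outside N,
    then l would be u times an element of N and l^2 would lie in [N2]. If a^2 is not in [N2], then
    (al)^2 is, and [al, g] differs from a conjugate of [a, g] by an element of N. So G would
    centralise T/N. *)
Lemma index8_sq l : l \in L -> l ^+ 2 \in N2.
Proof.
move=> Ll; apply/negPn/negP => l2; apply: ncTN => a g _.
have Nl : l \notin N.
  apply: contra l2 => Nl; have [Nl2|Nl2] := boolP (l \in N2); first by rewrite groupX.
  by rewrite (prime_index_expg pr2 nN2N idxNN2) // inE Nl2.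
have Dl2 : l ^+ 2 \in N :\: N2 by rewrite inE l2 sqT.
have f4 : f l ^+ 4 = 1.
  by rewrite -fX f0 // (expgnA l 2 2) (prime_index_expg pr2 nN2N idxNN2 _ Dl2).
have key a' : a' ^+ 2 \in N2 -> kg a' g \in N.
  move=> sqa; apply: contraT => Nu; set u := kg a' g in Nu.
  have Lu : u \in L by apply: cTL; rewrite inE.
  have Du : u \in L :\: N by rewrite inE Nu.
  have fu : f u ^+ 2 = 1.
    rewrite /u kgEcj fM fV expgMn; last by rewrite -fV; apply: fcomm.
    rewrite expVgn -!fX -cjX // (f0 sqa) invg1 mul1g f0 //; exact: invN2.
  have [j [n [lt_j Nn lE]]] := prime_index_gen_lt pr2 nNL idxLN Du Ll.
  case: j lt_j lE => [|[|//]] _ lE; first by case/negP: Nl; rewrite lE expg0 mul1g.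
  case/negP: l2; apply: f1; rewrite fX lE expg1 fM expgMn; last exact: fcomm.
  rewrite fu mul1g -fX f0 //; have [Nn2|Nn2] := boolP (n \in N2); first by rewrite groupX.
  by rewrite (prime_index_expg pr2 nN2N idxNN2) // inE Nn2.
have [j [n [lt_j Nn aE]]] := prime_index_gen_lt pr2 nN2N idxNN2 Dl2 (sqT a).
case: j lt_j aE => [|[|//]] _ aE; first by apply: key; rewrite aE expg0 mul1g.
suff /key : (a * l) ^+ 2 \in N2.
  rewrite kgMl // groupMr; last exact: cLN.
  by rewrite memJ_norm // (subsetP (normal_norm nNT)) ?inE.
apply: f1; rewrite fX fM expgMn; last exact: fcomm.
by rewrite -[f a ^+ 2]fX aE expg1 fM (f0 Nn) mulg1 fX -expgnDr f4.
Qed.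

End Index8.

Section Order8.
Local Open Scope group_scope.
Variables (G : groupType) (gT : finGroupType) (i : gT -> G).
Hypothesis iM : {morph i : x y / x * y}.
Hypothesis i_inj : injective i.
Hypothesis i_im : forall x, gamma G 2 x <-> exists a, x = i a.
Local Notation Ginv := (Ginv i).
Local Notation kg := (kg i).
Local Notation cj := (cj i).
Local Notation cent_over := (cent_over i).
Local Notation iG := (iG i).
Local Notation T := [set: gT]%G.
Variables L N : {group gT}.
Hypotheses (invL : Ginv L) (invN : Ginv N).
Hypotheses (sNL : N \subset L).
Hypotheses (idxTL : #|T : L| = 2) (idxLN : #|L : N| = 2) (cardN : #|N| = 2).
Hypotheses (cTL : cent_over T L) (cLN : cent_over L N) (cN1 : cent_over N 1).
Hypothesis sqT : forall a, a ^+ 2 \in N.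
Hypothesis sqL : forall a, a \in L -> a ^+ 2 = 1.
Hypothesis abT : forall a b : gT, commute a b.
Hypothesis ncTN : ~ cent_over T N.
Hypothesis ncL1 : ~ cent_over L 1.

Let pr2 : prime 2. Proof. by []. Qed.
Let nLT := inv_normal iM i_inj i_im invL (subsetT L).
Let nNL := inv_normal iM i_inj i_im invN sNL.
Let idxN1 : #|N : 1| = 2. Proof. by rewrite indexg1. Qed.

Let kgX a g j : kg a g = 1 -> kg (a ^+ j) g = 1.
Proof.
move=> ag; apply: i_inj; rewrite kgE // i1 // iX //.
by apply/eqP/commgP/commute_sym/commuteX/commute_sym/commgP; rewrite -kgE // ag i1.
Qed.

(** Each of the two noncentrality hypotheses yields a commutator one step further down the series; u
    and w are what makes gamma_3 and gamma_4 fill L and N. *)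
Lemma order8_gens : exists u w, [/\ u \in L :\: N, lcs G 2 (i u), lcs G 3 (i w), w != 1 & N :=: [set 1; w]].
Proof.
have [a [g Nk]] : exists a g, kg a g \notin N.
  by apply: contrapT => none; apply: ncTN => a g _; apply: contrapT => /negP H; apply: none; exists a, g.
set u := kg a g in Nk; have Lu : u \in L by apply: cTL; rewrite inE.
have Du : u \in L :\: N by rewrite inE Nk.
have u2 : lcs G 2 (i u) by rewrite kgE //; apply: lcs_comm; apply/i_im; exists a.
have [h uh] : exists h, kg u h <> 1.
  apply: contrapT => none; apply: ncL1 => l h Ll; apply/set1P.
  have [j [n [Nn ->]]] := prime_index_gen pr2 nNL idxLN Du Ll.
  rewrite kgMl // kgX; last by apply: contrapT => uh; apply: none; exists h.
  by rewrite conj1g mul1g; apply/set1P; apply: cN1.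
exists u, (kg u h); split=> //; first by rewrite kgE //; apply: lcs_comm.
  exact/eqP.
apply/eqP; rewrite eq_sym eqEcard cards2 cardN eq_sym (introN eqP uh) andbT subUset !sub1set.
by rewrite group1 cLN.
Qed.

Lemma order8_lcs x : lcs G 2 x <-> iG L x.
Proof.
have [u [w [Du u2 w3 _ NE]]] := order8_gens.
split; first by apply: (lcs_in iM i_im cTL) => y /i_im[a ->]; exists a; rewrite ?inE.
move=> [l Ll ->]; have [j [n [Nn ->]]] := prime_index_gen pr2 nNL idxLN Du Ll.
rewrite iM iX //; apply: (subgroupM (lcs_subgroup G 2)).
  exact: (subgroupX (lcs_subgroup G 2)).
move: Nn; rewrite NE !inE => /orP[] /eqP ->; last exact: lcs_sub.
by rewrite i1 //; apply: subgroup1 (lcs_subgroup G 2).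
Qed.

Lemma order8_class : nil_class G 4.
Proof.
have [u [w [Du u2 w3 w1 NE]]] := order8_gens.
have sT x : lcs G 1 x -> iG T x by move/i_im=> [a ->]; exists a; rewrite ?inE.
apply: nil_class_model => //.
  move=> x; move/(lcs_in iM i_im (N := 1%G) cN1 (lcs_in iM i_im cLN (lcs_in iM i_im cTL sT))) => [a /set1P -> ->].
  exact: i1.
by move/(_ _ w3)=> E; case/eqP: w1; apply: i_inj; rewrite E i1.
Qed.

(** If some square is nontrivial, say that of b, then b is outside L and b^2 is the generator w of
    N; hence T is the product of the groups generated by b and u, and L of those generated by u and
    w. *)
Lemma order8_cases :
  (iso_Ca_x_Cb (gamma G 2) 4 2 /\ iso_Ca_x_Cb (gamma G 3) 2 2) \/
  (elem_abelian (gamma G 2) /\ has_order (gamma G 2) 8).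
Proof.
have [u [w [Du _ _ w1 NE]]] := order8_gens.
have [Lu Nu] := setDP Du.
have cardT : #|T| = 8 by rewrite -(Lagrange (subsetT L)) -(Lagrange sNL) idxTL idxLN cardN.
have [all2|] := pselect (forall a : gT, a ^+ 2 = 1).
  right; split; last first.
    by case: (has_order_model i_inj 8 (gamma2_model i_im)) => _; apply.
  split; first by move=> x y /i_im[a ->] /i_im[b ->]; rewrite -!iM abT.
  by exists 2; split=> // x /i_im[a ->]; rewrite -iX // all2 i1.
move=> /existsNP[b b2]; left.
have Lb : b \notin L by apply/negP => /sqL.
have Db : b \in T :\: L by rewrite inE Lb in_setT.
have b2w : b ^+ 2 = w.
  by move: (sqT b); rewrite NE !inE => /orP[] /eqP.
have Lw : w \in L by apply: (subsetP sNL); rewrite NE !inE eqxx orbT.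
have b4 : b ^+ 4 = 1 by rewrite (expgnA b 2 2) b2w sqL.
have u2 : u ^+ 2 = 1 by apply: sqL.
have NXw n : n \in N -> exists k, n = w ^+ k.
  by rewrite NE !inE => /orP[] /eqP ->; [exists 0%N|exists 1%N].
have LE l : l \in L -> exists j k, l = u ^+ j * w ^+ k.
  move=> Ll; have [j [n [Nn ->]]] := prime_index_gen pr2 nNL idxLN Du Ll.
  by have [k ->] := NXw n Nn; exists j, k.
have uw j k : u ^+ j * w ^+ k = 1 -> 2 %| j /\ 2 %| k.
  move=> E; have j2 : 2 %| j.
    rewrite -(prime_index_expg pr2 nNL idxLN _ Du).
    have /eqP := E; rewrite mulg_eq1 => /eqP ->; rewrite groupV groupX // NE !inE eqxx orbT //.
  split=> //; move: E; case/dvdnP: j2 => m ->; rewrite mulnC expgnA u2 expg1n mul1g => wk.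
  have w2 : w ^+ 2 = 1 by apply: sqL.
  have : #[w] = 2 by apply/prime_nt_dvdP => //; [rewrite order_eq1|rewrite order_dvdn w2].
  by move=> <-; rewrite order_dvdn wk.
split.
- apply: (iso_model iM i_inj (M := T) (x := b) (y := u)) => //.
  + exact: gamma2_model.
  + move=> j k E.
    have j2 : 2 %| j.
      rewrite -(prime_index_expg pr2 nLT idxTL _ Db).
      by have /eqP := E; rewrite mulg_eq1 => /eqP ->; rewrite groupV groupX.
    move: E; case/dvdnP: j2 => m ->; rewrite mulnC expgnA b2w abT => /uw[k2 m2].
    by split=> //; rewrite (@dvdn_pmul2l 2 2).
  + move=> c; split=> _; last by rewrite inE.
    have [j [l [Ll ->]]] := prime_index_gen pr2 nLT idxTL Db (in_setT c).
    have [k [m ->]] := LE l Ll; exists (j + 2 * m)%N, k.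
    by rewrite expgnDr expgnA b2w -mulgA [u ^+ k * _]abT.
- apply: (iso_model iM i_inj (M := L) (x := u) (y := w)) => //.
  + exact: order8_lcs.
  + exact: sqL.
  + by move=> c; split=> [/LE //|[j [k ->]]]; rewrite groupM ?groupX.
Qed.

End Order8.

(** * The two implications for the finite model *)

Section Main.
Local Open Scope group_scope.
Variables (K : fieldType) (G : groupType) (R : algType K) (e : G -> R).
Hypothesis e1 : e 1%g = 1%R.
Hypothesis eM : forall x y, (e (x * y)%g = e x * e y)%R.
Hypothesis espan : forall r : R, exists (s : seq G) (c : G -> K),
  (r = \sum_(g <- s) c g *: e g)%R.
Hypothesis elin : forall (s : seq G) (c : G -> K), uniq s ->
  (\sum_(g <- s) c g *: e g = 0)%R -> forall g, g \in s -> (c g = 0)%R.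
Variables (gT : finGroupType) (i : gT -> G).
Hypothesis iM : {morph i : x y / (x * y)%g}.
Hypothesis i_inj : injective i.
Hypothesis i_im : forall x, gamma G 2 x <-> exists a, x = i a.
Variable p : nat.
Hypothesis pcharK : p \in [pchar K]%R.
Let p_pr : prime p := pcharf_prime pcharK.
Hypothesis pgT : p.-group [set: gT].
Local Notation Ginv := (Ginv i).
Local Notation kg := (kg i).
Local Notation cj := (cj i).
Local Notation cent_over := (cent_over i).
Local Notation iG := (iG i).
Local Notation T := [set: gT]%G.
Hypothesis fixed : forall (M N : {group gT}), Ginv M -> Ginv N -> N \proper M ->
  exists2 z, z \in M :\: N & forall g, kg z g \in N.

Let idxc (M N : {group gT}) : Ginv M -> Ginv N -> N \subset M -> #|M : N| = p -> cent_over M N.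
Proof. exact: (index_p_cent iM i_inj i_im p_pr pgT fixed). Qed.

Lemma upper_lie_power_zero m : (forall a : R, upper m a -> a = 0%R) -> lie_power_zero R m.+1.
Proof. by move=> Z a /lie_power_upper/Z. Qed.

Lemma upper_le m n (a : R) : m <= n -> upper n a -> upper m a.
Proof.
move/subnK <-; elim: (n - m) a => [//|k IH] a Ua; apply: IH.
move: Ua; rewrite addSn /=; apply; first exact: upper_ideal.
move=> _ [b [r [Ub ->]]]; apply: idealB; first exact: upper_ideal.
- by apply: idealMr Ub; exact: upper_ideal.
- by apply: idealMl Ub; exact: upper_ideal.
Qed.

Lemma lcs1_T x : lcs G 1 x -> iG T x.
Proof. by move/i_im => [a ->]; exists a; rewrite ?inE. Qed.

Section Forward.
Local Notation n := #|gT|.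
Hypothesis le_pn : p <= n.
Hypothesis Zt : lie_power_zero R (n - p + 2).
Hypothesis NZ : ~ lie_power_zero R (n - p + 1).

(** An upper power of index at most n - p that vanishes would annihilate the lower power of index n
    - p + 1. *)
Let kill (M : {group gT}) S : Ginv M -> (forall a : R, upper S a -> aug e (iG M) a) ->
  #|M| * S <= n - p -> False.
Proof.
move=> invM US le; apply: NZ; rewrite addn1; apply: upper_lie_power_zero => a Ua.
exact: (upper_card e1 eM espan iM i_inj i_im pcharK pgT fixed invM US (upper_le le Ua)).
Qed.

Lemma forward :
   [\/ [/\ p = 2, nil_class G 2, has_order (gamma G 2) 4 & ~ cyclic_sub (gamma G 2)],
       [/\ p = 2, nil_class G 4, iso_Ca_x_Cb (gamma G 2) 4 2 & iso_Ca_x_Cb (gamma G 3) 2 2],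
       [/\ p = 2, nil_class G 4, elem_abelian (gamma G 2) & has_order (gamma G 2) 8]
     | [/\ p = 3, nil_class G 3, elem_abelian (gamma G 2) & has_order (gamma G 2) 9]].
Proof.
have p_gt1 : 1 < p := prime_gt1 p_pr.
(* For cyclic G' the lower power of index n is nonzero, although n - p + 2 <= n. *)
have ncT : ~~ cyclic T.
  apply/negP => cT; apply: (lower_cyclic e1 eM espan elin iM i_inj i_im pcharK pgT fixed cT).
  apply: lie_power_zero_mono Zt; first by rewrite addn2.
  by rewrite addnC -leq_subRL ?leq_sub2l // (leq_trans _ le_pn).
have [N [L [[invN invL sNL idxTL idxLN] Tp]]] := noncyclic_chain iM i_inj i_im p_pr pgT fixed ncT.
have nE : n = (#|N| * (p * p))%N.
  by rewrite -cardsT -(Lagrange (subsetT L)) -(Lagrange sNL) idxTL idxLN mulnA.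
have cTL := idxc (@invT _ _ i) invL (subsetT L) idxTL.
have cLN := idxc invL invN sNL idxLN.
have U12 := upper_step12 e1 eM espan iM i_inj i_im pcharK pgT fixed invL invN sNL idxTL idxLN Tp.
have U11 := upper_step11 e1 eM espan iM i_inj i_im pcharK pgT fixed invL invN sNL idxTL idxLN Tp.
have p_le (M : {group gT}) : M :!=: 1 -> p <= #|M|.
  move=> M1; have : p.-nat #|M| := pgroupS (subsetT _) pgT.
  case/p_natP=> [[|k]] Mk; last by rewrite Mk expnS leq_pmulr ?expn_gt0 ?prime_gt0.
  by case/eqP: M1; apply/card1_trivg; rewrite Mk.
have ntcT (N' : {group gT}) : cent_over T N' -> forall x, lcs G 2 x -> iG N' x.
  by move=> cTN; apply: (lcs_in iM i_im cTN); apply: lcs1_T.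
have Tnt : ~ (forall x, lcs G 1 x -> x = 1).
  move=> T1; case/negP: ncT; suff -> : T = 1%G by apply: cyclic1.
  by apply/trivGP/subsetP => a _; rewrite inE; apply/eqP/i_inj; rewrite i1 //; apply: T1; apply/i_im; exists a.
have [N1|N1] := eqVneq (N : {set gT}) 1; last first.
  have leN := p_le N N1.
  (* Here n = |N| p^2, and |N|(3p - 2) <= n - p for p >= 3 and |N| >= p. *)
  have [p3|p2] := ltnP 2 p.
    by case: (kill invN U12); rewrite nE; nia.
  have {p2} p2 : p = 2 by lia.
  (* For p = 2 and G centralising T/N the threshold is 3, and 3 |N| <= 4 |N| - 2. *)
  have [cTN|ncTN] := pselect (cent_over T N).
    by case: (kill invN (U11 cTN)); rewrite nE; nia.
  have [N2 [invN2 pN2N idxNN2 cNN2]] := chain_down iM i_inj i_im p_pr pgT fixed invN N1.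
  have sN2N := proper_sub pN2N.
  rewrite p2 in idxTL idxLN idxNN2.
  have sqT (a : gT) : a ^+ 2 \in N by have := Tp a; rewrite p2.
  have abT := index8_abelian iM i_inj i_im invL invN2 sN2N idxTL idxNN2 cLN cNN2.
  have sqL := index8_sq iM i_inj i_im invL invN invN2 sNL sN2N idxTL idxLN idxNN2 cTL cLN cNN2 sqT ncTN.
  have U123 := upper_step123 e1 eM espan iM i_inj i_im pcharK pgT fixed p2 invL invN invN2 sNL sN2N
    idxTL idxLN idxNN2 abT sqL.
  have NN2 : #|N| = (#|N2| * 2)%N by rewrite -(Lagrange sN2N) idxNN2.
  (* If [N2] is nontrivial, 7 |N2| <= 8 |N2| - 2; so |G'| = 8. *)
  have [N21|N21] := eqVneq (N2 : {set gT}) 1; last first.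
    by have := p_le N2 N21 => leN2; case: (kill invN2 U123); rewrite nE NN2; nia.
  have card2 : #|N| = 2 by rewrite NN2 N21 cards1.
  (* The threshold 6 of weights 1, 2, 2 is exactly n - p = 8 - 2, so G does not centralise L. *)
  have [cL2|ncL2] := pselect (cent_over L N2).
    have U122 := upper_step122 e1 eM espan iM i_inj i_im pcharK pgT fixed p2 invL invN invN2 sNL sN2N
      idxTL idxLN idxNN2 abT sqL cL2.
    by case: (kill invN2 U122); rewrite nE card2 N21 cards1 p2.
  have abT1 (a b : gT) : commute a b by apply/commgP; have := abT a b; rewrite N21 inE.
  have sqL1 (a : gT) : a \in L -> a ^+ 2 = 1 by move/sqL; rewrite N21 => /set1P.
  have cN1 : cent_over N 1 by rewrite -N21.
  have ncL1 : ~ cent_over L 1 by rewrite -N21.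
  have c4 := order8_class iM i_inj i_im invN sNL idxLN card2 cTL cLN cN1 ncTN ncL1.
  case: (order8_cases iM i_inj i_im invL invN sNL idxTL idxLN card2 cTL cLN cN1 sqT sqL1 abT1 ncTN ncL1).
    by case=> iso2 iso3; constructor 2.
  by case=> el o8; constructor 3.
have NG1 : N = 1%G by apply: group_inj.
have Tp1 (a : gT) : a ^+ p = 1 by have := Tp a; rewrite N1 => /set1P.
have {}nE : n = (p * p)%N by rewrite nE N1 cards1 mul1n.
have cardL : #|L| = p by rewrite -(Lagrange sNL) N1 cards1 mul1n -N1.
have cL1 : cent_over L 1 by rewrite -N1.
have [cTN|ncTN] := pselect (cent_over T N).
  (* The inequality 2p - 1 <= p^2 - p holds from p = 3 on. *)
  have [p3|p2] := ltnP 2 p.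
    by case: (kill invN (U11 cTN)); rewrite N1 cards1 nE; nia.
  have {p2} p2 : p = 2 by lia.
  constructor 1; split=> //.
  - apply: nil_class_model => // x /(ntcT _ cTN) [a]; rewrite N1 => /set1P -> ->; exact: i1.
  - have [_ H] := has_order_model i_inj 4 (gamma2_model i_im); apply: H.
    by rewrite cardsT nE p2.
  - by move/(cyclic_model iM i_inj i_im); apply/negP.
have ncT1 : ~ cent_over T 1%G by rewrite -NG1.
(* Among primes, 3p - 2 <= p^2 - p fails only for 2 and 3. *)
have [p4|p3] := ltnP 4 p.
  by case: (kill invN U12); rewrite N1 cards1 nE; nia.
(* G' has order 4 and is not central: the lower power of index 4 = n - p + 2 is nonzero. *)
have [p2|p2] := eqVneq p 2.
  case: (lower_short e1 eM espan elin iM i_inj i_im pcharK pgT fixed invL idxTL cardL Tp1 ncT1 p2).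
  by move: Zt; rewrite nE p2.
have {p3 p2} p3 : p = 3.
  by case: (p) p_pr p_gt1 p3 p2 => [|[|[|[|[|]]]]].
constructor 4; split=> //.
- apply: nil_class_model => //.
    move=> x /(lcs_in iM i_im (N := 1%G) cL1 (ntcT _ cTL)) [a /set1P -> ->]; exact: i1.
  move=> t3; apply: ncT1 => a g _; apply/set1P/i_inj; rewrite i1 //; apply: t3; rewrite kgE //.
  by apply: lcs_comm; apply/i_im; exists a.
- split; last by exists 3; split=> // x /i_im[a ->]; rewrite -iX // -p3 Tp1 i1.
  move=> x y /i_im[a ->] /i_im[b ->]; rewrite -!iM; congr i.
  have : abelian T by apply: (card_p2group_abelian p_pr); rewrite cardsT nE mulnn.
  by move/centsP; apply; rewrite inE.
- have [_ H] := has_order_model i_inj 9 (gamma2_model i_im); apply: H.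
  by rewrite cardsT nE p3.
Qed.

End Forward.

Lemma tL_eq t m : is_tL R t -> 0 < m -> lie_power_zero R m.+1 -> ~ lie_power_zero R m -> t = m.+1.
Proof.
move=> [t0 Zt mint] m0 Zm NZm; apply/eqP; rewrite eqn_leq.
apply/andP; split; rewrite leqNgt; apply/negP => lt; first exact: (mint m.+1).
by apply: NZm; apply: lie_power_zero_mono Zt.
Qed.

Lemma lcs_grp_cent_top c : nil_class G c.+1 -> cent_over (lcs_grp iM c) 1.
Proof. by move=> nc; rewrite -(lcs_grp_top iM i_inj nc) //; apply: lcs_grp_cent. Qed.

(** Class 2 makes G' central, so both generators have weight 1 and the upper power of index 2p - 1 =
    3 vanishes. *)
Lemma tL_class2 t : p = 2 -> nil_class G 2 -> #|gT| = 4 -> ~~ cyclic T -> is_tL R t -> t = 4.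
Proof.
move=> p2 c2 n4 ncT tL.
have [N [L [[invN invL sNL idxTL idxLN] Tp]]] := noncyclic_chain iM i_inj i_im p_pr pgT fixed ncT.
have N1 : N = 1%G.
  apply/group_inj/card1_trivg; have := Lagrange (subsetT L).
  by rewrite -(Lagrange sNL) idxTL idxLN cardsT n4 p2; lia.
have cT1 : cent_over T 1 by rewrite -(lcs_grp1 iM i_im); apply: lcs_grp_cent_top.
have U := upper_step11 e1 eM espan iM i_inj i_im pcharK pgT fixed invL invN sNL idxTL idxLN Tp.
apply: (tL_eq tL) => //.
  by apply: upper_lie_power_zero => a Ua; apply: (aug1 e1 iM); rewrite -N1; apply: U; rewrite ?N1 // p2.
have sq (a : gT) : a ^+ 2 = 1 by have := Tp a; rewrite N1 p2 => /set1P.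
have n2 : 2 < #|gT| by rewrite n4.
exact: (lower_class2 e1 eM elin iM i_inj i_im pcharK p2 cT1 sq n2).
Qed.

(** gamma_3 and gamma_4 serve as L and N; class 4 and order 8 force all the indices to be 2. *)
Lemma tL_class4 t : p = 2 -> nil_class G 4 -> #|gT| = 8 -> abelian_sub (gamma G 2) ->
  (forall x, gamma G 3 x -> x ^+ 2 = 1) -> is_tL R t -> t = 8.
Proof.
move=> p2 c4 n8 ab sq tL.
set L := lcs_grp iM 2; set N := lcs_grp iM 3.
have abT (a b : gT) : commute a b.
  by apply: i_inj; rewrite !iM; apply: ab; apply/i_im; [exists a|exists b].
have sqL (a : gT) : a \in L -> a ^+ 2 = 1.
  by move/lcs_grpP/sq; rewrite -iX // => E; apply: i_inj; rewrite E i1.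
have invL : Ginv L by apply: lcs_grp_inv.
have invN : Ginv N by apply: lcs_grp_inv.
have sNL : N \subset L by apply: lcs_grp_sub.
have pTL : L \proper T by rewrite -(lcs_grp1 iM i_im); apply: (lcs_grp_proper iM i_im c4).
have pLN : N \proper L by apply: (lcs_grp_proper iM i_im c4).
have pN1 : 1%G \proper N by have := lcs_grp_proper iM i_im (k := 3) c4 isT; rewrite (lcs_grp_top iM i_inj c4).
have [idxTL idxLN cardN] : [/\ #|T : L| = 2, #|L : N| = 2 & #|N| = 2].
  have := Lagrange (subsetT L); rewrite -(Lagrange sNL) cardsT n8.
  have : 1 < #|T : L| by rewrite indexg_gt1 (proper_subn pTL).
  have : 1 < #|L : N| by rewrite indexg_gt1 (proper_subn pLN).
  have : 1 < #|N| by rewrite -indexg1 indexg_gt1 (proper_subn pN1).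
  by move: #|_ : L| #|_ : N| #|N| => x y z *; split; nia.
have cTL : cent_over T L by rewrite -(lcs_grp1 iM i_im); apply: lcs_grp_cent.
have cN1 : cent_over N 1 by apply: lcs_grp_cent_top.
have ncTN : ~ cent_over T N.
  move=> cTN; case/negP: (proper_subn pLN); apply/subsetP => a /lcs_grpP.
  by case/(lcs_in iM i_im cTN (@lcs1_T)) => b Nb /i_inj ->.
have ncL1 : ~ cent_over L 1%G.
  move=> cL1; case/negP: (proper_subn pN1); apply/subsetP => a /lcs_grpP.
  case/(lcs_in iM i_im cL1 (k := 2)); last by move=> b Nb /i_inj ->.
  by move=> x x2; apply/(lcs_grpE iM i_im).
(* The square of a is centralised by G, as [a^2, g] = [a, g]^2 = 1. It lies in L; were it outside N,
   it would generate L together with the central subgroup N, and L would be central. *)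
have sqT (a : gT) : a ^+ 2 \in N.
  have nLT := inv_normal iM i_inj i_im invL (subsetT L).
  have a2L : a ^+ 2 \in L.
    have [La|La] := boolP (a \in L); first by rewrite groupX.
    by rewrite (prime_index_expg _ nLT idxTL) // inE La in_setT.
  have a2c g : kg (a ^+ 2) g = 1.
    have kL : kg a g \in L by apply: cTL; rewrite inE.
    by rewrite expgS expg1 kgMl // (conjg_fixP (introT commgP (abT _ _))) -[RHS](sqL _ kL) expgS expg1.
  apply: contraT => Na; case: ncL1 => l g Ll; apply/set1P.
  have nNL := inv_normal iM i_inj i_im invN sNL.
  have Da : a ^+ 2 \in L :\: N by rewrite inE Na.
  have [j [n [Nn ->]]] := prime_index_gen (isT : prime 2) nNL idxLN Da Ll.
  have kn : kg n g = 1 by apply/set1P/cN1.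
  rewrite kgMl // kn mulg1 (_ : kg _ g = 1) ?conj1g //.
  apply: i_inj; rewrite kgE // i1 // iX //.
  apply/eqP/commgP/commute_sym/commuteX/commute_sym/commgP; rewrite -kgE // a2c i1 //.
have inv1' : Ginv 1%G by exact: inv1.
have U := upper_step123 e1 eM espan iM i_inj i_im pcharK pgT fixed p2 invL invN inv1' sNL (sub1G N)
    idxTL idxLN.
apply: (tL_eq tL) => //.
  apply: upper_lie_power_zero => a Ua; apply: (aug1 e1 iM); apply: U => //.
  - by rewrite indexg1.
  - by move=> b c; apply/set1P/eqP/commgP.
  - by move=> b /sqL ->.
exact: (lower_long e1 eM espan elin iM i_inj i_im pcharK pgT fixed p2 invL invN sNL idxTL idxLN).
Qed.

(** Class 3 and order 9 force gamma_3 to have order and index 3; it serves as L, with N trivial. *)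
Lemma tL_class3 t : p = 3 -> nil_class G 3 -> #|gT| = 9 ->
  (forall x, gamma G 2 x -> x ^+ 3 = 1) -> is_tL R t -> t = 8.
Proof.
move=> p3 c3 n9 cube tL.
set L := lcs_grp iM 2.
have Tp (a : gT) : a ^+ p = 1.
  by apply: i_inj; rewrite iX // i1 // p3; apply: cube; apply/i_im; exists a.
have invL : Ginv L by apply: lcs_grp_inv.
have pTL : L \proper T by rewrite -(lcs_grp1 iM i_im); apply: (lcs_grp_proper iM i_im c3).
have pL1 : 1%G \proper L by have := lcs_grp_proper iM i_im (k := 2) c3 isT; rewrite (lcs_grp_top iM i_inj c3).
have [idxTL cardL] : #|T : L| = p /\ #|L| = p.
  have := Lagrange (subsetT L); rewrite cardsT n9.
  have : 1 < #|T : L| by rewrite indexg_gt1 (proper_subn pTL).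
  have : 1 < #|L| by rewrite -indexg1 indexg_gt1 (proper_subn pL1).
  move: #|_ : L| #|L| => x y x1 y1 xy; rewrite p3.
  have x5 : x < 5 by nia.
  by case: x x5 x1 xy y1 => [|[|[|[|[|x]]]]] // _ _; lia.
have ncT1 : ~ cent_over T 1%G.
  move=> cT1; case/negP: (proper_subn pL1); apply/subsetP => a /lcs_grpP.
  by case/(lcs_in iM i_im cT1 (@lcs1_T)) => b Nb /i_inj ->.
have inv1' : Ginv 1%G by exact: inv1.
have U := upper_step12 e1 eM espan iM i_inj i_im pcharK pgT fixed invL inv1' (sub1G L) idxTL.
apply: (tL_eq tL) => //; last exact: (lower_char3 e1 eM espan elin iM i_inj i_im pcharK pgT fixed invL idxTL cardL).
apply: upper_lie_power_zero => a Ua; apply: (aug1 e1 iM); apply: U.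
- by rewrite indexg1.
- by move=> b; rewrite Tp group1.
- by rewrite p3.
Qed.

End Main.

(** The prime in [elem_abelian] is existential; an element of order p identifies it with the
    characteristic. *)
Lemma pgroup_exponent_prime (gT : finGroupType) p q : prime p -> prime q -> p %| #|gT| ->
  (forall a : gT, a ^+ q = 1)%g -> q = p.
Proof.
move=> p_pr q_pr; rewrite -cardsT => /(Cauchy p_pr)[x _ ox] /(_ x)/eqP.
by rewrite -order_dvdn ox dvdn_prime2 // => /eqP.
Qed.

(** * From Lie nilpotency to central p-powers *)

Section Embedding.
Local Open Scope ring_scope.
Variables (K : fieldType) (p : nat) (G : groupType) (R : algType K) (e : G -> R).
Hypothesis e1 : e 1%g = 1.
Hypothesis eM : forall x y, e (x * y)%g = e x * e y.
Hypothesis elin : forall (s : seq G) (c : G -> K), uniq s ->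
  \sum_(g <- s) c g *: e g = 0 -> forall g, g \in s -> c g = 0.

Lemma group_algebra_inj : injective e.
Proof.
move=> g h egh; apply/eqP/contraT => gh.
have /= := @elin [:: g; h] (fun k => if k == g then 1 else -1).
rewrite inE gh big_cons big_seq1 eqxx eq_sym (negPf gh) egh scale1r scaleN1r subrr.
move=> /(_ isT (erefl _) g); rewrite mem_head eqxx => /(_ isT)/eqP; by rewrite oner_eq0.
Qed.

(** As p^m > m, the Engel word with p^m letters y vanishes, and it equals x y^(p^m) - y^(p^m) x. *)
Lemma lie_nilpotent_central : p \in [pchar K] -> lie_nilpotent R ->
  exists a, forall x y : G, (commute x (y ^+ (p ^ a)))%g.
Proof.
move=> pK [[|m] [] // _ /lie_power_zeroP Z]; exists m => x y.
have p_gt1 := prime_gt1 (pcharf_prime pK).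
have := lcomm_pchar (e x) (e y) m pK; rewrite (lcomm_zero _ (Z _)); last exact/ltnW/ltn_expl.
by move=> /esym/eqP; rewrite subr_eq0 -(eX e1 eM) -!eM => /eqP/group_algebra_inj.
Qed.

End Embedding.

Theorem theorem1 (K : fieldType) (p : nat) (G : groupType) (R : algType K)
  (e : G -> R) :
  (p \in [pchar K])%R ->
  is_group_algebra e ->
  lie_nilpotent R ->
  forall (t n : nat), is_tL R t -> has_order (gamma G 2) n ->
  ((t%:Z = n%:Z - p%:Z + 2)%R <->
   [\/ [/\ p = 2, nil_class G 2, has_order (gamma G 2) 4 & ~ cyclic_sub (gamma G 2)],
       [/\ p = 2, nil_class G 4, iso_Ca_x_Cb (gamma G 2) 4 2 & iso_Ca_x_Cb (gamma G 3) 2 2],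
       [/\ p = 2, nil_class G 4, elem_abelian (gamma G 2) & has_order (gamma G 2) 8]
     | [/\ p = 3, nil_class G 3, elem_abelian (gamma G 2) & has_order (gamma G 2) 9]]).
Proof.
move=> pK [e1 eM elin espan] nilR t n tL oG.
have [a central] := lie_nilpotent_central e1 eM elin pK nilR.
have p_pr := pcharf_prime pK.
have [gT [i [iM i_inj i_im cT]]] := finite_derived_model oG.
have qE : exists b, (p ^ a = p ^ b)%N by exists a.
have pgT := derived_pgroup iM i_inj i_im p_pr qE central.
have fixed := @fixed_coset_pgroup _ _ _ iM i_inj i_im _ _ p_pr qE central.
have orderE m : has_order (gamma G 2) m -> #|gT| = m.
  by move/(has_order_model i_inj m (gamma2_model i_im)); rewrite cardsT.
have expE x b : gamma G 2 x -> (forall c : gT, c ^+ b = 1)%g -> (x ^+ b = 1)%g.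
  by move=> /i_im[c ->] Tb; rewrite -iX // Tb i1.
have expT b : (forall x, gamma G 2 x -> x ^+ b = 1)%g -> forall c : gT, (c ^+ b = 1)%g.
  by move=> Tb c; apply: i_inj; rewrite iX // i1 // Tb //; apply/i_im; exists c.
rewrite -(orderE n oG); split=> [tE|].
  have [t0 Zt mint] := tL.
  (* If n < p then G' is trivial and the formula reads t = 3 - p. Since t >= 1, this means t = 1 and
     R = 0, against e(1) = 1. Otherwise the difference can be taken in natural numbers. *)
  have [lt_np|le_pn] := ltnP #|gT| p.
    have n1 : #|gT| = 1%N.
      move: pgT; rewrite /pgroup cardsT => /p_natP[[|k]] nE //.
      by move: lt_np; rewrite nE expnS ltnNge leq_pmulr ?expn_gt0 ?prime_gt0.
    have p2 := prime_gt1 p_pr; have t1 : t = 1%N by move: tE; rewrite n1; lia.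
    have := lie_power_zeroP R 0; rewrite -t1 => -[/(_ Zt)/(_ (fun=> e 1%g)) /= + _].
    by rewrite e1 => /eqP; rewrite oner_eq0.
  have {}tE : t = (#|gT| - p + 2)%N by lia.
  apply: (forward e1 eM espan elin iM i_inj i_im pK pgT fixed le_pn); first by rewrite -tE.
  by apply: mint; lia.
case=> [[p2 c2 /orderE n4 ncG]|[p2 c4 iso2 iso3]|[p2 c4 [ab [q [q_pr sq]]] /orderE n8]|[p3 c3 [_ [q [q_pr cube]]] /orderE n9]].
- have ncT : ~~ cyclic [set: gT] by apply/negP => /(cyclic_model iM i_inj i_im).
  by rewrite (tL_class2 e1 eM espan elin iM i_inj i_im pK pgT fixed p2 c2 n4 ncT tL) n4 p2.
- have n8 := orderE _ (iso_card (isT : 0 < 4) (isT : 0 < 2) iso2).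
  by rewrite (tL_class4 e1 eM espan elin iM i_inj i_im pK pgT fixed p2 c4 n8 (iso_abelian iso2)
    (fun x => @iso_exponent _ _ _ x iso3) tL) n8 p2.
- have q2 : q = 2 by apply: (@pgroup_exponent_prime gT) => //; [rewrite n8|exact: expT].
  rewrite q2 in sq.
  have sq3 x : gamma G 3 x -> (x ^+ 2 = 1)%g by move=> x3; apply/sq/lcs_sub.
  by rewrite (tL_class4 e1 eM espan elin iM i_inj i_im pK pgT fixed p2 c4 n8 ab sq3 tL) n8 p2.
- have q3 : q = 3 by apply: (@pgroup_exponent_prime gT) => //; [rewrite n9|exact: expT].
  rewrite q3 in cube.
  by rewrite (tL_class3 e1 eM espan elin iM i_inj i_im pK pgT fixed p3 c3 n9 cube tL) n9 p3.
Qed.
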